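(* Let $w$ be a normal function and let $1/2<p<\infty$. (i) Assume that $a_w<2p-2$, $b_w>-1$ if $1/2<p\le 1$, and that $a_w<p-1$, $b_w>p-2$ if $p>1$. Then there exists a positive constant $c_{p,w}$ such that for every Blaschke product $B$ we have $$\|B'\|_{p,w}^p\le c_{p,w}\sum_{B(z)=0}(1-|z|)^{2-p}\,w(|z|).$$ If $1/2<p\le1$ and $a_w=2p-2$, $b_w>-1$, or if $p>1$, $a_w=p-1$, $b_w>p-2$, and $w$ satisfies condition ( * ), then there exists a positive constant $c_{p,w}$ such that for every Blaschke product $B$ we have $$\|B'\|_{p,w}^p\le c_{p,w}\sum_{B(z)=0}(1-|z|)^{2-p}\,w(|z|)\log\frac{1}{1-|z|}.$$ (ii) Suppose that the zero set of the Blaschke product $B$ is separated with separation constant $\delta>0$. Suppose that either $a_w<2p-2$, $b_w>-1$, when $1/2<p\le 1$, or $a_w<p-2$, $b_w>-1$, when $p>1$. Then, in both cases, there exists a positive constant $c_{p,w,\delta}$ (depending only on $p$, $w$, $\delta$) such that $$\sum_{B(z)=0}(1-|z|)^{2-p}\,w(|z|)\le c_{p,w,\delta}\,\|B'\|_{p,w}^p.$$ If either $1/2<p\le1$ and $a_w=2p-2$, $b_w>-1$, or $p>1$, $a_w=p-1$, $b_w>p-2$, and $w$ also satisfies condition ( * ), then there exists a positive constant $c_{p,w,\delta}$ such that for every such Blaschke product $B$ (with zero set separated with separation constant $\delta$) we have $$\sum_{B(z)=0}(1-|z|)^{2-p}\,w(|z|)\le c_{p,w,\delta}\int_{\mathb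b{D}}|B'(z)|^p\,w(|z|)\log\frac1{1-|z|}\,dA(z).$$
   Context: $\mathbb{D}$ is the open unit disk in $\mathbb{C}$ and $dA$ is area measure on $\mathbb{D}$. Sums over $B(z)=0$ run over the zeros of $B$ in $\mathbb{D}$, counted with multiplicity. Normal functions: a measurable function $w:[0,1)\to[0,\infty)$ is called normal if there exist real numbers $a$ and $b$ and $r_0\in(0,1)$ such that, for $r>r_0$, the function $w(r)/(1-r)^a$ increases to $\infty$ and the function $w(r)/(1-r)^b$ decreases to $0$ (as $r\to1^-$). It is extended to $\mathbb{D}$ radially by $w(z)=w(|z|)$. The number $a_w$ is the infimum of all real $a$ for which $w(r)/(1-r)^a$ increases to $\infty$ for $r>r_a$, for some $r_a\in(0,1)$; the number $b_w$ is the supremum of all real $b$ for which $w(r)/(1-r)^b$ decreases to $0$ for $r>r_b$, for some $r_b\in(0,1)$. Condition ( * ): there exists $\alpha$ with $0<\alpha<1$ such that the function $\frac{w(r)}{(1-r)^{a_w}}\log^\alpha\frac1{1-r}$ is increasing for $r>r_0$. For $f$ analytic in $\mathbb{D}$, $\|f\|_{p,w}^p=\int_{\mathbb{D}}|f|^p\,w\,dA$. A sequence $(a_n)$ in $\mathbb{D}$ is separated with separation constant $\delta$ if $\inf_n\prod_{k\ne n}\left|\frac{a_k-a_n}{1-\overline{a}_ka_n}\right|=\delta>0$.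
   Formalization: The weight w is also assumed bounded above and bounded below by a positive constant on each [0,r], r<1, and in the second inequality of (i) log(1/(1-|z|)) is replaced by 1+log(1/(1-|z|)); as stated, (i) fails for B(z)=z (if w(0)=0, and for the log version always). *)

(* Defs.v *)
(* MathComp and MathComp-Analysis; the complex numbers are R[i], R : realType. *)
From HB Require Import structures.
From mathcomp Require Import all_boot all_order all_algebra.
From mathcomp Require Import complex.
From mathcomp Require Import all_classical all_reals all_analysis.

Set Implicit Arguments.
Unset Strict Implicit.
Unset Printing Implicit Defensive.

Import Order.TTheory GRing.Theory Num.Theory.
Import numFieldNormedType.Exports.

Local Open Scope classical_set_scope.
Local Open Scope ring_scope.
Local Open Scope complex_scope.

(* The topology and normed-module structure of R[i] over itself, so that
   derive1 f for f : R[i] -> R[i] is the complex derivative. *)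
#[non_forgetful_inheritance]
HB.instance Definition _ (R : realType) := NormedModule.copy R[i] R[i]^o.

(* The modulus as an element of R (the library's `|z| lies in R[i]). *)
Notation cabs := ComplexField.Normc.normc.

Definition unit_disk (R : realType) : set R[i] := [set z | cabs z < 1].

Definition area_int (R : realType) (g : R[i] -> R) : \bar R :=
  (\int[(@lebesgue_measure R \x @lebesgue_measure R)%E]_(q in
      [set q | unit_disk (q.1 +i* q.2)%C])
    (g (q.1 +i* q.2)%C)%:E)%E.

(* The p-th power of the norm: int_D |f|^p w dA. *)
Definition wnorm_pow (R : realType) (p : R) (w : R -> R) (f : R[i] -> R[i]) :
    \bar R :=
  area_int (fun z => cabs (f z) `^ p * w (cabs z)).

(** Radial weights: only the values on [0, 1[ are relevant. *)

Definition incr_to_infty (R : realType) (w : R -> R) (a r0 : R) : Prop :=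
  {in `]r0, 1[ &, {homo (fun r => w r / (1 - r) `^ a) : x y / x <= y}} /\
  w r / (1 - r) `^ a @[r --> 1^'-] --> +oo.

Definition decr_to_zero (R : realType) (w : R -> R) (b r0 : R) : Prop :=
  {in `]r0, 1[ &, {homo (fun r => w r / (1 - r) `^ b) : x y /~ x <= y}} /\
  w r / (1 - r) `^ b @[r --> 1^'-] --> (0 : R).

Definition normal_weight (R : realType) (w : R -> R) : Prop :=
  [/\ measurable_fun (`[0, 1[ : set R) w,
      forall r, r \in `[0, 1[ -> 0 <= w r &
      exists a b r0 : R, [/\ r0 \in `]0, 1[,
        incr_to_infty w a r0 & decr_to_zero w b r0]].

Definition a_exp (R : realType) (w : R -> R) : R :=
  inf [set a | exists2 r, r \in `]0, 1[ & incr_to_infty w a r].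

Definition b_exp (R : realType) (w : R -> R) : R :=
  sup [set b | exists2 r, r \in `]0, 1[ & decr_to_zero w b r].

Definition log_condition (R : realType) (w : R -> R) : Prop :=
  exists alpha r0 : R, [/\ alpha \in `]0, 1[, r0 \in `]0, 1[ &
    {in `]r0, 1[ &, {homo (fun r =>
      w r / (1 - r) `^ a_exp w * ln ((1 - r)^-1) `^ alpha) : x y / x <= y}}].

(* Normality says nothing about w on [0, r0]; this is the usual assumption that
   w is comparable to a constant on each compact part of [0, 1[. It holds, for
   instance, when w is continuous and positive. *)
Definition bounded_on_compacts (R : realType) (w : R -> R) : Prop :=
  forall r, r \in `]0, 1[ -> exists m M : R, 0 < m /\
    forall x, x \in `[0, r] -> m <= w x <= M.

(** Blaschke products and their zeros *)

Definition blaschke_factor (R : realType) (a z : R[i]) : R[i] :=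
  if a == 0 then z else (cabs a)%:C / a * ((a - z) / (1 - a^* * z)).

(* The index set I : set nat allows finite (possibly empty) and infinite
   families of factors; repetitions in a account for multiplicities. *)
Definition blaschke_product (R : realType) (B : R[i] -> R[i]) : Prop :=
  exists (lambda : R[i]) (I : set nat) (a : nat -> R[i]),
    [/\ cabs lambda = 1,
        forall n, I n -> unit_disk (a n),
        (\esum_(n in I) (1 - cabs (a n))%:E < +oo)%E &
        forall z, unit_disk z ->
          lambda * \prod_(0 <= k < N | k \in I) blaschke_factor (a k) z
            @[N --> \oo] --> B z].

(* f has a zero of order m at z (for f continuous at z, order 0 means that
   f z != 0). *)
Definition zero_order (R : realType) (f : R[i] -> R[i]) (z : R[i]) (m : nat) :
    Prop :=
  exists2 c : R[i], c != 0 & f x / (x - z) ^+ m @[x --> z^'] --> c.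

Definition zero_mult (R : realType) (f : R[i] -> R[i]) (z : R[i]) : nat :=
  xget 0%N [set m | zero_order f z m].

(* The sum of g >= 0 over the zeros of f in the disk, with multiplicity. *)
Definition zero_sum (R : realType) (f : R[i] -> R[i]) (g : R[i] -> R) :
    \bar R :=
  (\esum_(z in [set z | unit_disk z /\ f z = 0%R])
     ((zero_mult f z)%:R * g z)%:E)%E.

Definition zero_enum (R : realType) (f : R[i] -> R[i]) (I : set nat)
    (a : nat -> R[i]) : Prop :=
  (forall n, I n -> unit_disk (a n)) /\
  (forall z, unit_disk z ->
     [set n | I n /\ a n = z] #= `I_(zero_mult f z))%card.

Definition pseudohyp (R : realType) (a b : R[i]) : R :=
  cabs ((a - b) / (1 - a^* * b)).

(* For an empty sequence the infimum is 0 by convention, so that it is not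
   separated with any positive constant. *)
Definition separated_seq (R : realType) (I : set nat) (a : nat -> R[i])
    (delta : R) : Prop :=
  0 < delta /\
  inf [set limn (fun N =>
         \prod_(0 <= k < N | (k \in I) && (k != n)) pseudohyp (a k) (a n))
      | n in I] = delta.

(* Multiple zeros are repeated in the sequence, so they exclude separation. *)
Definition separated_zeros (R : realType) (f : R[i] -> R[i])
    (delta : R) : Prop :=
  exists (I : set nat) (a : nat -> R[i]),
    zero_enum f I a /\ separated_seq I a delta.

(* Main.v *)
Require Import Defs.
From HB Require Import structures.
From mathcomp Require Import all_boot all_order all_algebra.
From mathcomp Require Import complex.
From mathcomp Require Import all_classical all_reals all_analysis.
From mathcomp Require Import measurable_realfun.
From mathcomp Require Import ring lra.
Import Order.TTheory GRing.Theory Num.Theory.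
Import numFieldNormedType.Exports.
Local Open Scope classical_set_scope.
Local Open Scope ring_scope.

Set Implicit Arguments.
Unset Strict Implicit.
Unset Printing Implicit Defensive.

(** For a finite Blaschke product with factors [b_n] vanishing at [a_n], the
    Leibniz rule gives [|B'| <= sum |b_n'|], where
    [|b_n'(z)| = (1 - |a_n|^2) / |1 - conj(a_n) z|^2], and Schwarz-Pick gives
    [|B'(z)| <= 1 / (1 - |z|)].  Both survive in the limit, because the
    second-order Taylor remainders of the partial products are bounded, on each
    smaller disk, by the total mass [sum (1 - |a_n|^2)] alone, so that the
    derivatives converge with the products ([cvg_dfblaschke]).  The same uniformity shows that the order
    of [B] at a point is the number of its factors vanishing there
    ([zero_order_count]), so sums over zeros are sums over the sequence.

    Upper estimate.  Put [q = min p 1].  Schwarz-Pick absorbs the excess power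
    [p - q] and subadditivity of [t^q] splits the sum, so that [|B'|^p w] is at
    most the sum of [|b_n'|^q W] with [W(r) = w(r) (1 - r)^(q-p)].  It remains to
    integrate [W(z) / |1 - conj(a) z|^(2q)] over the disk.  On the annulus
    [1 - |z| ~ 2^-k] the part where [|1 - conj(a) z| ~ 2^-j] has area
    [O(2^-k 2^-j)] ([area_annulus_cap_le]) and is empty unless [j <= min k m + 1],
    when [1 - |a| ~ 2^-m].  Summing over [j] leaves the series of the terms
    [W_k 2^-k 2^((2q-1) min k m)], in which monotonicity of the quotients
    [w(r) / (1 - r)^c] bounds [W_k] by [W_m] times [2^((m-k) A)] for [k <= m] and
    [2^((m-k) B)] for [k >= m].  The hypotheses on the two exponents of [w]
    make both halves geometric; at the critical exponent the first
    half is [sum (m / k)^al], which is [O(m)], that is [O(log (1 / (1 - |a|)))].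

    Lower estimate.  At a zero [a] separated from the others by [delta], the
    modulus [|B'|] is at least [delta / (1 - |a|)] up to a constant, and this
    persists on a set of size [c delta (1 - |a|)] around [a]
    ([cabs_dfblaschke_ge]).  Small rectangles near the zeros are disjoint by
    separation, [w] is comparable to a constant on each, and [|B'|^p w] has integral at least a multiple of
    [(1 - |a|)^(2-p) w(a)] there.  The rectangles are placed off the origin, so
    that a logarithmic factor in the integrand only costs a constant. *)

(** * The modulus, and the elementary geometry of the disk *)

Arguments ComplexField.Normc.normc : simpl never.

Section Modulus.
Variable R : realType.
Implicit Types (a x z w h u : R[i]).

Lemma cabs_normE z : `|z| = (cabs z)%:C%C.
Proof. by []. Qed.

Lemma cabs_ge0 z : 0 <= cabs z.
Proof. by rewrite -lecR -cabs_normE normr_ge0. Qed.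

Lemma cabsM z w : cabs (z * w) = cabs z * cabs w.
Proof. exact: ComplexField.Normc.normcM. Qed.

Lemma cabsV z : cabs z^-1 = (cabs z)^-1.
Proof. exact: ComplexField.Normc.normcV. Qed.

Lemma cabsD z w : cabs (z + w) <= cabs z + cabs w.
Proof. exact: le_normcD. Qed.

Lemma cabsN z : cabs (- z) = cabs z.
Proof. exact: normcN. Qed.

Lemma cabs1 : cabs (1 : R[i]) = 1.
Proof. exact: ComplexField.Normc.normc1. Qed.

Lemma cabs0 : cabs (0 : R[i]) = 0.
Proof. exact: ComplexField.Normc.normc0. Qed.

Lemma cabs_eq0 z : (cabs z == 0) = (z == 0).
Proof.
apply/eqP/eqP => [|->]; last exact: cabs0.
exact: ComplexField.Normc.eq0_normc.
Qed.

Lemma cabs_gt0 z : (0 < cabs z) = (z != 0).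
Proof. by rewrite lt_neqAle eq_sym cabs_eq0 cabs_ge0 andbT. Qed.

Lemma cabsB z w : cabs (z - w) <= cabs z + cabs w.
Proof. by rewrite -(cabsN w); exact: cabsD. Qed.

Lemma cabs_distrC z w : cabs (z - w) = cabs (w - z).
Proof. by rewrite -cabsN opprB. Qed.

Lemma cabs_lb z w : cabs z - cabs w <= cabs (z - w).
Proof. by rewrite lerBlDr; have := cabsD (z - w) w; rewrite subrK. Qed.

Lemma cabsX z n : cabs (z ^+ n) = cabs z ^+ n.
Proof. by elim: n => [|n IH]; rewrite ?expr0 ?cabs1// !exprS cabsM IH. Qed.

Lemma cabs_real (r : R) : cabs (r%:C%C) = `|r|.
Proof. by rewrite /ComplexField.Normc.normc /= expr0n addr0 sqrtr_sqr. Qed.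

Lemma cabs_conj z : cabs (z^*)%C = cabs z.
Proof. by case: z => x y; rewrite /ComplexField.Normc.normc /= sqrrN. Qed.

Lemma cabs_sqr (x y : R) : cabs (x +i* y)%C ^+ 2 = x ^+ 2 + y ^+ 2.
Proof. by rewrite /ComplexField.Normc.normc sqr_sqrtr// addr_ge0 ?sqr_ge0. Qed.

Lemma cabs_sqrE z : cabs z ^+ 2 = complex.Re z ^+ 2 + complex.Im z ^+ 2.
Proof. by case: z => x y; rewrite cabs_sqr. Qed.

Lemma cabs_sqrC z : (cabs z ^+ 2)%:C%C = z * (z^*)%C.
Proof. by rewrite rmorphXn; exact: (sqr_normc z). Qed.

Lemma cabs_Re_le z : `|complex.Re z| <= cabs z.
Proof.
by rewrite -ler_sqr ?nnegrE ?cabs_ge0// cabs_sqrE real_normK ?num_real// lerDl sqr_ge0.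
Qed.

Lemma cabs_Im_le z : `|complex.Im z| <= cabs z.
Proof.
by rewrite -ler_sqr ?nnegrE ?cabs_ge0// cabs_sqrE real_normK ?num_real// lerDr sqr_ge0.
Qed.

Lemma cabs_le_ReIm z : cabs z <= `|complex.Re z| + `|complex.Im z|.
Proof.
rewrite -ler_sqr ?nnegrE ?cabs_ge0 ?addr_ge0// cabs_sqrE sqrrD !real_normK ?num_real//.
rewrite lerD2r lerDl mulrn_wge0// mulr_ge0//.
Qed.

Lemma cabs_prod (T : Type) (s : seq T) (P : pred T) (F : T -> R[i]) :
  cabs (\prod_(i <- s | P i) F i) = \prod_(i <- s | P i) cabs (F i).
Proof.
elim: s => [|i s IH]; first by rewrite !big_nil cabs1.
by rewrite !big_cons; case: ifP; rewrite ?cabsM IH.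
Qed.

Lemma cabs_1Mconj_ge a z : 1 - cabs a * cabs z <= cabs (1 - (a^*)%C * z).
Proof. by rewrite -{1}(cabs1) -(cabs_conj a) -cabsM cabs_lb. Qed.

Lemma cabs_1Mconj_gel a z : cabs a < 1 -> cabs z < 1 ->
  1 - cabs z <= cabs (1 - (a^*)%C * z).
Proof.
move=> a1 z1; apply: le_trans (cabs_1Mconj_ge a z).
by rewrite lerD2l lerN2 ler_piMl ?cabs_ge0// ltW.
Qed.

Lemma cabs_1Mconj_ger a z : cabs a < 1 -> cabs z < 1 ->
  1 - cabs a <= cabs (1 - (a^*)%C * z).
Proof.
move=> a1 z1; apply: le_trans (cabs_1Mconj_ge a z).
by rewrite lerD2l lerN2 ler_piMr ?cabs_ge0// ltW.
Qed.

Lemma cabs_1Mconj_gt0 a z : cabs a < 1 -> cabs z < 1 ->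
  0 < cabs (1 - (a^*)%C * z).
Proof.
by move=> a1 z1; apply: lt_le_trans (cabs_1Mconj_gel a1 z1); rewrite subr_gt0.
Qed.

Lemma sub1Mconj_neq0 a z : cabs a < 1 -> cabs z < 1 -> 1 - (a^*)%C * z != 0.
Proof. by move=> a1 z1; rewrite -cabs_gt0 cabs_1Mconj_gt0. Qed.

(** The identity behind Schwarz-Pick for a single factor. *)
Lemma disk_identity a z :
  cabs (1 - (a^*)%C * z) ^+ 2 - cabs (a - z) ^+ 2 =
  (1 - cabs a ^+ 2) * (1 - cabs z ^+ 2).
Proof. by case: a => a1 a2; case: z => z1 z2; rewrite !cabs_sqrE /=; ring. Qed.

End Modulus.

(** * Blaschke factors *)

Section Factor.
Variable R : realType.
Implicit Types (a x z w h u : R[i]).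

(** The value [-1] at the origin makes the formula of [blaschke_factorE] uniform. *)
Definition blaschke_phase a : R[i] := if a == 0 then -1 else (cabs a)%:C%C / a.

Definition dblaschke a z : R[i] :=
  - blaschke_phase a * (1 - a * (a^*)%C) / (1 - (a^*)%C * z) ^+ 2.

Lemma cabs_phase a : cabs (blaschke_phase a) = 1.
Proof.
rewrite /blaschke_phase; case: ifPn => [_|a0]; first by rewrite cabsN cabs1.
by rewrite cabsM cabsV cabs_real ger0_norm ?cabs_ge0// divff// cabs_eq0.
Qed.

Lemma blaschke_factorE a z :
  blaschke_factor a z = blaschke_phase a * ((a - z) / (1 - (a^*)%C * z)).
Proof.
rewrite /blaschke_factor /blaschke_phase; case: ifPn => // /eqP ->.
by rewrite conjc0 mul0r subr0 divr1 sub0r mulN1r opprK.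
Qed.

Lemma cabs_blaschke a z : cabs (blaschke_factor a z) = pseudohyp a z.
Proof. by rewrite blaschke_factorE cabsM cabs_phase mul1r. Qed.

Lemma blaschke_factor_root a : blaschke_factor a a = 0.
Proof. by rewrite blaschke_factorE subrr mul0r mulr0. Qed.

Lemma cabs_1Mmulconj a : cabs (1 - a * (a^*)%C) = `|1 - cabs a ^+ 2|.
Proof. by rewrite -cabs_sqrC -(rmorph1 (@real_complex R)) -rmorphB cabs_real. Qed.

Lemma sqr_lt1 a : cabs a < 1 -> 0 < 1 - cabs a ^+ 2.
Proof. by move=> a1; rewrite subr_gt0 expr_lt1// cabs_ge0. Qed.

Lemma cabs_dblaschke a z : cabs a < 1 ->
  cabs (dblaschke a z) = (1 - cabs a ^+ 2) / cabs (1 - (a^*)%C * z) ^+ 2.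
Proof.
move=> a1; rewrite /dblaschke !cabsM cabsN cabs_phase mul1r cabsV cabsX.
by rewrite cabs_1Mmulconj gtr0_norm// sqr_lt1.
Qed.

(** Schwarz-Pick is an equality for an automorphism of the disk. *)
Lemma blaschke_schwarz_pick a z : cabs a < 1 -> cabs z < 1 ->
  cabs (dblaschke a z) * (1 - cabs z ^+ 2) = 1 - cabs (blaschke_factor a z) ^+ 2.
Proof.
move=> a1 z1; rewrite cabs_dblaschke// cabs_blaschke /pseudohyp cabsM cabsV.
have d0 := cabs_1Mconj_gt0 a1 z1.
rewrite mulrAC -disk_identity; field; exact: lt0r_neq0.
Qed.

Lemma cabs_blaschke_le1 a z : cabs a < 1 -> cabs z < 1 ->
  cabs (blaschke_factor a z) <= 1.
Proof.
move=> a1 z1; rewrite -[leRHS]ger0_norm// -[leLHS]ger0_norm ?cabs_ge0//.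
rewrite -ler_sqr ?nnegrE// ?cabs_ge0// !real_normK ?num_real// expr1n -subr_ge0.
by rewrite -blaschke_schwarz_pick// mulr_ge0 ?cabs_ge0// ltW// sqr_lt1.
Qed.

Lemma blaschke_diff a z w : cabs a < 1 -> cabs z < 1 -> cabs w < 1 ->
  blaschke_factor a w - blaschke_factor a z =
  - blaschke_phase a * (1 - a * (a^*)%C) * (w - z) /
    ((1 - (a^*)%C * z) * (1 - (a^*)%C * w)).
Proof.
move=> a1 z1 w1; rewrite !blaschke_factorE.
have := sub1Mconj_neq0 a1 z1; have := sub1Mconj_neq0 a1 w1.
by move=> ? ?; field; apply/andP.
Qed.

Lemma blaschke_remainder a z w : cabs a < 1 -> cabs z < 1 -> cabs w < 1 ->
  blaschke_factor a w - blaschke_factor a z - (w - z) * dblaschke a z =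
  - blaschke_phase a * (1 - a * (a^*)%C) * (a^*)%C * (w - z) ^+ 2 /
    ((1 - (a^*)%C * z) ^+ 2 * (1 - (a^*)%C * w)).
Proof.
move=> a1 z1 w1; rewrite !blaschke_factorE /dblaschke.
have := sub1Mconj_neq0 a1 z1; have := sub1Mconj_neq0 a1 w1.
by move=> ? ?; field; apply/andP.
Qed.

(** This bound and the next are uniform on [|z| <= r] and linear in
    [1 - |a|^2], hence can be summed over the zeros of a product. *)
Lemma cabs_blaschke_diff_le (r : R) a z w : r < 1 -> cabs a < 1 ->
  cabs z <= r -> cabs w <= r ->
  cabs (blaschke_factor a w - blaschke_factor a z) <=
  (1 - cabs a ^+ 2) * cabs (w - z) / (1 - r) ^+ 2.
Proof.
move=> r1 a1 zr wr; have z1 := le_lt_trans zr r1; have w1 := le_lt_trans wr r1.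
have r0 : 0 < 1 - r by rewrite subr_gt0.
rewrite blaschke_diff// !cabsM cabsV cabsM cabsN cabs_phase mul1r cabs_1Mmulconj.
rewrite gtr0_norm ?sqr_lt1// ler_wpM2l ?mulr_ge0 ?cabs_ge0 ?(ltW (sqr_lt1 a1))//.
rewrite lef_pV2 ?posrE ?exprn_gt0 ?mulr_gt0 ?cabs_1Mconj_gt0// expr2.
by apply: ler_pM; rewrite ?(ltW r0)//;
  [apply: le_trans (cabs_1Mconj_gel a1 z1)|apply: le_trans (cabs_1Mconj_gel a1 w1)];
  rewrite lerD2l lerN2.
Qed.

Lemma cabs_blaschke_remainder_le (r : R) a z w : r < 1 -> cabs a < 1 ->
  cabs z <= r -> cabs w <= r ->
  cabs (blaschke_factor a w - blaschke_factor a z - (w - z) * dblaschke a z) <=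
  (1 - cabs a ^+ 2) * cabs (w - z) ^+ 2 / (1 - r) ^+ 3.
Proof.
move=> r1 a1 zr wr; have z1 := le_lt_trans zr r1; have w1 := le_lt_trans wr r1.
have r0 : 0 < 1 - r by rewrite subr_gt0.
rewrite blaschke_remainder// !(cabsX, cabsM, cabsV) cabsN cabs_phase mul1r cabs_1Mmulconj.
rewrite gtr0_norm ?sqr_lt1// cabs_conj.
have A0 := ltW (sqr_lt1 a1).
apply: ler_pM.
- by rewrite !mulr_ge0 ?cabs_ge0 ?exprn_ge0 ?cabs_ge0.
- by rewrite invr_ge0 mulr_ge0 ?exprn_ge0 ?cabs_ge0.
- apply: ler_wpM2r; first by rewrite exprn_ge0 ?cabs_ge0.
  by apply: ler_piMr => //; exact: ltW.
rewrite lef_pV2 ?posrE ?exprn_gt0 ?mulr_gt0 ?exprn_gt0 ?cabs_1Mconj_gt0//.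
rewrite exprSr; apply: ler_pM; rewrite ?exprn_ge0 ?(ltW r0)//.
  rewrite lerXn2r ?nnegrE ?cabs_ge0 ?(ltW r0)//.
  by apply: le_trans (cabs_1Mconj_gel a1 z1); rewrite lerD2l lerN2.
by apply: le_trans (cabs_1Mconj_gel a1 w1); rewrite lerD2l lerN2.
Qed.

(** [1 - |b|] is at most [1 - |b|^2], which Schwarz-Pick makes comparable to
    [1 - |a|]: this is what keeps infinite products away from 0. *)
Lemma cabs_blaschke_ge a z : cabs a < 1 -> cabs z < 1 ->
  1 - 4 * (1 - cabs a) / (1 - cabs z) <= cabs (blaschke_factor a z).
Proof.
move=> a1 z1; have d0 := cabs_1Mconj_gt0 a1 z1.
have b1 := cabs_blaschke_le1 a1 z1; have b0 := cabs_ge0 (blaschke_factor a z).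
rewrite lerBlDr -lerBlDl.
apply: (@le_trans _ _ (1 - cabs (blaschke_factor a z) ^+ 2)).
  by rewrite lerD2l lerN2 expr2 ler_piMl.
rewrite -blaschke_schwarz_pick// cabs_dblaschke//.
have z0 : 0 < 1 - cabs z by rewrite subr_gt0.
have a0 : 0 < 1 - cabs a by rewrite subr_gt0.
have -> : 4 * (1 - cabs a) / (1 - cabs z) =
  (2 * (1 - cabs a)) / (1 - cabs z) ^+ 2 * (2 * (1 - cabs z)).
  by field; exact: lt0r_neq0.
have A0 := cabs_ge0 a; have Z0 := cabs_ge0 z.
apply: ler_pM.
- by rewrite divr_ge0 ?exprn_ge0 ?cabs_ge0// ltW// sqr_lt1.
- by rewrite ltW// sqr_lt1.
- apply: ler_pM.
  + by rewrite ltW// sqr_lt1.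
  + by rewrite invr_ge0 exprn_ge0// cabs_ge0.
  + by nra.
  rewrite lef_pV2 ?posrE ?exprn_gt0// lerXn2r ?nnegrE ?cabs_ge0 ?(ltW z0)//.
  exact: cabs_1Mconj_gel.
by nra.
Qed.

End Factor.

(** * Finite Blaschke products *)

Section FiniteProduct.
Variable R : realType.
Implicit Types (a x z w h u : R[i]) (s : seq R[i]).

Notation in_disk s := (all (fun x => cabs x < 1) s).

Definition fblaschke s z := \prod_(x <- s) blaschke_factor x z.

(** Recursion on the list spells out the Leibniz rule. *)
Fixpoint dfblaschke s z : R[i] :=
  if s is x :: s' then
    dblaschke x z * fblaschke s' z + blaschke_factor x z * dfblaschke s' z
  else 0.

Lemma fblaschke_cons x s z :
  fblaschke (x :: s) z = blaschke_factor x z * fblaschke s z.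
Proof. exact: big_cons. Qed.

Lemma fblaschke_cat s1 s2 z :
  fblaschke (s1 ++ s2) z = fblaschke s1 z * fblaschke s2 z.
Proof. exact: big_cat. Qed.

Lemma dfblaschke_cat s1 s2 z :
  dfblaschke (s1 ++ s2) z =
  dfblaschke s1 z * fblaschke s2 z + fblaschke s1 z * dfblaschke s2 z.
Proof.
elim: s1 => [|x s1 IH] /=; first by rewrite /fblaschke big_nil mul0r mul1r add0r.
by rewrite IH fblaschke_cat fblaschke_cons; ring.
Qed.

Lemma cabs_fblaschke s z :
  cabs (fblaschke s z) = \prod_(x <- s) pseudohyp x z.
Proof. by rewrite cabs_prod; apply: eq_bigr => x _; exact: cabs_blaschke. Qed.

Lemma cabs_fblaschke_le1 s z : in_disk s -> cabs z < 1 ->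
  cabs (fblaschke s z) <= 1.
Proof.
move=> + z1; elim: s => [_|x s IH /= /andP[x1 /IH s1]].
  by rewrite /fblaschke big_nil cabs1.
by rewrite fblaschke_cons cabsM mulr_ile1 ?cabs_ge0 ?cabs_blaschke_le1.
Qed.

Lemma cabs_dfblaschke_le_sum s z : in_disk s -> cabs z < 1 ->
  cabs (dfblaschke s z) <=
  \sum_(x <- s) (1 - cabs x ^+ 2) / cabs (1 - (x^*)%C * z) ^+ 2.
Proof.
move=> + z1; elim: s => [_|x s IH /= /andP[x1 s1]]; first by rewrite big_nil /= cabs0.
rewrite big_cons; apply: le_trans (cabsD _ _) _.
rewrite (cabsM (dblaschke _ _)) (cabsM (blaschke_factor _ _)).
apply: lerD; last first.
  apply: le_trans (IH s1); apply: ler_piMl; rewrite ?cabs_ge0//.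
  exact: cabs_blaschke_le1.
by rewrite -cabs_dblaschke//; apply: ler_piMr; rewrite ?cabs_ge0// cabs_fblaschke_le1.
Qed.

(** Schwarz-Pick is stable under products: with [t] and [P] the moduli of the
    two factors, the induction step is [(1 - t) * (1 - P) >= 0]. *)
Lemma fblaschke_schwarz_pick s z : in_disk s -> cabs z < 1 ->
  cabs (dfblaschke s z) * (1 - cabs z ^+ 2) <= 1 - cabs (fblaschke s z) ^+ 2.
Proof.
move=> + z1; elim: s => [_|x s IH /= /andP[x1 s1]].
  by rewrite /= cabs0 mul0r /fblaschke big_nil cabs1 expr1n subrr.
have {}IH := IH s1; have SP := blaschke_schwarz_pick x1 z1.
have z2 := ltW (sqr_lt1 z1).
apply: (@le_trans _ _ ((cabs (dblaschke x z) * cabs (fblaschke s z) +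
  cabs (blaschke_factor x z) * cabs (dfblaschke s z)) * (1 - cabs z ^+ 2))).
  by apply: ler_wpM2r => //; rewrite -!cabsM cabsD.
rewrite fblaschke_cons cabsM mulrDl mulrAC SP -mulrA.
have t0 := cabs_ge0 (blaschke_factor x z); have P0 := cabs_ge0 (fblaschke s z).
have t1 := cabs_blaschke_le1 x1 z1; have P1 := cabs_fblaschke_le1 s1 z1.
move: (cabs (blaschke_factor x z)) (cabs (fblaschke s z)) t0 P0 t1 P1 IH => t P t0 P0 t1 P1 IH.
apply: (@le_trans _ _ ((1 - t ^+ 2) * P + t * (1 - P ^+ 2))).
  by rewrite lerD2l; apply: ler_wpM2l.
rewrite -subr_ge0 (_ : _ - _ = (1 - t * P) * ((1 - t) * (1 - P))); last by ring.
by rewrite !mulr_ge0 ?subr_ge0// mulr_ile1.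
Qed.

Lemma cabs_dfblaschke_le s z : in_disk s -> cabs z < 1 ->
  cabs (dfblaschke s z) <= (1 - cabs z)^-1.
Proof.
move=> s1 z1; have := fblaschke_schwarz_pick s1 z1.
have z0 := cabs_ge0 z.
have d0 : 0 < 1 - cabs z by rewrite subr_gt0.
have D0 := cabs_ge0 (dfblaschke s z); have F0 := sqr_ge0 (cabs (fblaschke s z)).
move=> SP; rewrite -[leRHS]mul1r ler_pdivlMr//.
apply: le_trans (_ : 1 - cabs (fblaschke s z) ^+ 2 <= _); last by rewrite gerBl.
apply: le_trans SP; apply: ler_wpM2l => //; rewrite lerD2l lerN2 expr2.
by apply: ler_piMl => //; exact: ltW.
Qed.

Notation mass s := (\sum_(x <- s) (1 - cabs x ^+ 2)).

Lemma mass_ge0 s : in_disk s -> 0 <= mass s.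
Proof.
move=> /allP s1; rewrite big_seq; apply: sumr_ge0 => x /s1 x1.
by rewrite ltW// sqr_lt1.
Qed.

Lemma cabs_fblaschke_diff_le (r : R) s z w : r < 1 -> in_disk s ->
  cabs z <= r -> cabs w <= r ->
  cabs (fblaschke s w - fblaschke s z) <= mass s * cabs (w - z) / (1 - r) ^+ 2.
Proof.
move=> r1 + zr wr; have z1 := le_lt_trans zr r1; have w1 := le_lt_trans wr r1.
elim: s => [_|x s IH /= /andP[x1 s1]].
  by rewrite /fblaschke !big_nil subrr cabs0 !mul0r.
rewrite !fblaschke_cons big_cons.
set A := blaschke_factor x w; set A' := blaschke_factor x z.
set P := fblaschke s w; set P' := fblaschke s z.
have -> : A * P - A' * P' = (A - A') * P + A' * (P - P') by ring.
rewrite -[leRHS]mulrA [leRHS]mulrDl ![in leRHS]mulrA.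
apply: le_trans (cabsD _ _) _; rewrite (cabsM _ P) (cabsM A'); apply: lerD.
  apply: le_trans (cabs_blaschke_diff_le r1 x1 zr wr).
  by apply: ler_piMr; rewrite ?cabs_ge0// cabs_fblaschke_le1.
apply: le_trans (IH s1); apply: ler_piMl; rewrite ?cabs_ge0//.
exact: cabs_blaschke_le1.
Qed.

(** The second-order remainder is controlled by the total mass of the zeros
    only; this is what survives the passage to infinite products. *)
Lemma cabs_fblaschke_remainder_le (r : R) s z w : 0 <= r < 1 -> in_disk s ->
  cabs z <= r -> cabs w <= r ->
  cabs (fblaschke s w - fblaschke s z - (w - z) * dfblaschke s z) <=
  (mass s + mass s ^+ 2) / (1 - r) ^+ 4 * cabs (w - z) ^+ 2.
Proof.
move=> /andP[r0 r1] + zr wr; have z1 := le_lt_trans zr r1; have w1 := le_lt_trans wr r1.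
have d0 : 0 < 1 - r by rewrite subr_gt0.
elim: s => [_|x s IH /= /andP[x1 s1]].
  by rewrite /fblaschke !big_nil /= subrr mulr0 subr0 cabs0 expr0n addr0 !mul0r.
rewrite !fblaschke_cons big_cons.
have := IH s1; have S0 := mass_ge0 s1; have t0 := ltW (sqr_lt1 x1).
have := cabs_blaschke_remainder_le r1 x1 zr wr.
have := cabs_fblaschke_diff_le r1 s1 zr wr.
have D1 : cabs (dblaschke x z) <= (1 - cabs x ^+ 2) / (1 - r) ^+ 2.
  rewrite cabs_dblaschke//; apply: ler_wpM2l => //.
  rewrite lef_pV2 ?posrE ?exprn_gt0 ?cabs_1Mconj_gt0// lerXn2r ?nnegrE ?cabs_ge0 ?(ltW d0)//.
  by apply: le_trans (cabs_1Mconj_gel x1 z1); rewrite lerD2l lerN2.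
have A'1 := cabs_blaschke_le1 x1 z1; have P1 := cabs_fblaschke_le1 s1 w1.
move: (mass s) (1 - cabs x ^+ 2) S0 t0 D1 => S t S0 t0 D1.
set A := blaschke_factor x w; set A' := blaschke_factor x z.
set P := fblaschke s w; set P' := fblaschke s z.
set D := dblaschke x z; set E := dfblaschke s z.
rewrite -/A' -/P in A'1 P1.
have -> : A * P - A' * P' - (w - z) * (D * P' + A' * E) =
  (A - A' - (w - z) * D) * P + (w - z) * D * (P - P')
  + A' * (P - P' - (w - z) * E) by ring.
move=> HL HQ HS.
set H := cabs (w - z) in HL HQ HS *; have H0 : 0 <= H := cabs_ge0 _.
have T1 : (1 - r)^-1 >= 1 by rewrite invf_ge1// lerBlDr lerDl.
apply: (@le_trans _ _ (t * H ^+ 2 / (1 - r) ^+ 4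
   + H * (t / (1 - r) ^+ 2) * (S * H / (1 - r) ^+ 2)
   + (S + S ^+ 2) / (1 - r) ^+ 4 * H ^+ 2)).
  apply: le_trans (cabsD _ _) _; apply: lerD; last first.
    by rewrite cabsM; apply: le_trans HS; apply: ler_piMl; rewrite ?cabs_ge0.
  apply: le_trans (cabsD _ _) _; apply: lerD.
    rewrite cabsM; apply: le_trans (_ : t * H ^+ 2 / (1 - r) ^+ 3 <= _).
      by apply: le_trans HQ; apply: ler_piMr; rewrite ?cabs_ge0.
    apply: ler_wpM2l; first by rewrite mulr_ge0 ?exprn_ge0.
    rewrite lef_pV2 ?posrE ?exprn_gt0//.
    by rewrite exprS; apply: ler_piMl; rewrite ?exprn_ge0 ?(ltW d0)// gerBl.
  rewrite (cabsM _ (P - P')) (cabsM _ D); apply: ler_pM; rewrite ?mulr_ge0 ?cabs_ge0//.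
  by apply: ler_wpM2l.
have i0 : 0 < (1 - r)^-1 by rewrite invr_gt0.
rewrite -!exprVn; set T := (1 - r)^-1 in i0 T1 *.
rewrite -subr_ge0 (_ : _ - _ = (S * t + t ^+ 2) * T ^+ 4 * H ^+ 2); last by ring.
by rewrite mulr_ge0 ?sqr_ge0// mulr_ge0 ?exprn_ge0 ?(ltW i0)// addr_ge0 ?mulr_ge0 ?sqr_ge0.
Qed.

(** The segment is cut into [n] pieces on which the quadratic remainder is
    [O(n^-2)], so that the errors add up to [O(n^-1)]. *)
Lemma cabs_fblaschke_lip (r : R) s z w : 0 <= r < 1 -> in_disk s ->
  cabs z <= r -> cabs w <= r ->
  cabs (fblaschke s w - fblaschke s z) <= cabs (w - z) / (1 - r).
Proof.
move=> /[dup] r01 /andP[r0 r1] s1 zr wr.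
have d0 : 0 < 1 - r by rewrite subr_gt0.
set M := (mass s + mass s ^+ 2) / (1 - r) ^+ 4.
have M0 : 0 <= M.
  by rewrite divr_ge0 ?exprn_ge0 ?(ltW d0)// addr_ge0 ?sqr_ge0 ?mass_ge0.
set H := cabs (w - z).
have step z' w' : cabs z' <= r -> cabs w' <= r ->
    cabs (fblaschke s w' - fblaschke s z') <=
    cabs (w' - z') / (1 - r) + M * cabs (w' - z') ^+ 2.
  move=> z'r w'r; have z'1 := le_lt_trans z'r r1.
  have -> : fblaschke s w' - fblaschke s z' = (w' - z') * dfblaschke s z' +
    (fblaschke s w' - fblaschke s z' - (w' - z') * dfblaschke s z') by ring.
  apply: le_trans (cabsD _ _) _; apply: lerD; last exact: cabs_fblaschke_remainder_le.
  rewrite cabsM; apply: ler_wpM2l; rewrite ?cabs_ge0//.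
  apply: le_trans (cabs_dfblaschke_le s1 z'1) _.
  by rewrite lef_pV2 ?posrE ?subr_gt0// lerD2l lerN2.
apply/ler_addgt0Pr => e e0.
have [n [n0 nE]] : exists n : nat, (0 : R) < n%:R /\ M * H ^+ 2 / n%:R <= e.
  exists (Num.trunc (M * H ^+ 2 / e)).+1; rewrite ltr0n; split=> //.
  by rewrite ler_pdivrMr// [e * _]mulrC -ler_pdivrMr// ltW// truncnS_gt.
pose c k : R[i] := z + (k%:R / n%:R)%:C%C * (w - z).
have cr k : (k <= n)%N -> cabs (c k) <= r.
  move=> kn; pose t : R := k%:R / n%:R.
  have t0 : 0 <= t by rewrite divr_ge0.
  have t1 : t <= 1 by rewrite ler_pdivrMr// mul1r ler_nat.
  have -> : c k = (1 - t)%:C%C * z + t%:C%C * w.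
    by rewrite /c -/t rmorphB rmorph1; ring.
  apply: le_trans (cabsD _ _) _; rewrite !cabsM !cabs_real !ger0_norm ?subr_ge0//.
  nra.
have cS k : c k.+1 - c k = (n%:R^-1)%:C%C * (w - z).
  rewrite /c opprD addrACA subrr add0r -mulrBl -rmorphB -mulrBl.
  by rewrite -addn1 natrD addrAC subrr add0r mul1r.
have tel k : (k <= n)%N -> cabs (fblaschke s (c k) - fblaschke s (c 0)) <=
    k%:R * (H / n%:R / (1 - r) + M * (H / n%:R) ^+ 2).
  elim: k => [_|k IH kn]; first by rewrite subrr cabs0 mul0r.
  have -> : fblaschke s (c k.+1) - fblaschke s (c 0) =
    (fblaschke s (c k.+1) - fblaschke s (c k)) +
    (fblaschke s (c k) - fblaschke s (c 0)) by ring.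
  apply: le_trans (cabsD _ _) _; rewrite -addn1 natrD addrC mulrDl mul1r.
  apply: lerD; first by apply: IH; exact: ltnW.
  apply: le_trans (step _ _ (cr _ (ltnW kn)) _) _; first by rewrite addn1; exact: cr.
  rewrite addn1 cS cabsM cabs_real ger0_norm ?invr_ge0 ?ler0n//.
  by rewrite (mulrC (n%:R^-1)).
have := tel n (leqnn _).
have -> : c n = w by rewrite /c divff ?lt0r_neq0// rmorph1 mul1r addrC subrK.
have -> : c 0 = z by rewrite /c mul0r rmorph0 mul0r addr0.
move=> /le_trans; apply.
rewrite mulrDr; apply: lerD.
  rewrite (_ : _ * _ = H / (1 - r))//; field.
  by rewrite !lt0r_neq0.
apply: le_trans nE; rewrite (_ : n%:R * _ = M * H ^+ 2 / n%:R)//; field.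
exact: lt0r_neq0.
Qed.

(** Near a zero [x] that is separated from the others, the derivative of the
    factor of [x] dominates in the Leibniz rule.  In units of [1 / (1 - |x|)] it
    is at least [1 / 9], the other factors keep the modulus [d / 2], and the
    remaining term is at most [2 k]; with [k = d / 72] the difference is [d / 36]. *)
Lemma cabs_dfblaschke_ge (d k : R) l1 l2 x z : in_disk (l1 ++ x :: l2) ->
  0 < d -> k = d / 72 -> d <= cabs (fblaschke (l1 ++ l2) x) ->
  cabs (z - x) <= k * (1 - cabs x) ->
  d / 36 / (1 - cabs x) <= cabs (dfblaschke (l1 ++ x :: l2) z).
Proof.
rewrite all_cat /= => /and3P[s11 x1 s21] d0 kE dx zx.
have s1 : in_disk (l1 ++ l2) by rewrite all_cat s11.
have e0 : 0 < 1 - cabs x by rewrite subr_gt0.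
have d1 : d <= 1 := le_trans dx (cabs_fblaschke_le1 s1 x1).
have k0 : 0 < k by rewrite kE divr_gt0.
have k1 : k <= 72^-1 by rewrite kE ler_pdivrMr// mulVf.
have x0 := cabs_ge0 x.
pose r := cabs x + k * (1 - cabs x).
have r01 : 0 <= r < 1 by rewrite /r; apply/andP; split; nra.
have xr : cabs x <= r by rewrite lerDl mulr_ge0// ltW.
have zr : cabs z <= r.
  by rewrite -[z](subrK x) addrC; apply: le_trans (cabsD _ _) _; rewrite lerD2l.
have rE : 1 - r = (1 - k) * (1 - cabs x) by rewrite /r; ring.
have /andP[r0 r1] := r01.
have z1 : cabs z < 1 := le_lt_trans zr r1.
rewrite dfblaschke_cat /= fblaschke_cons.
rewrite (_ : _ + _ = dblaschke x z * fblaschke (l1 ++ l2) z +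
   blaschke_factor x z * dfblaschke (l1 ++ l2) z); last first.
  by rewrite fblaschke_cat dfblaschke_cat; ring.
have main : (1 - cabs x)^-1 / 9 * (d / 2) <=
    cabs (dblaschke x z * fblaschke (l1 ++ l2) z).
  rewrite cabsM; apply: ler_pM.
  - by rewrite divr_ge0// invr_ge0 ltW.
  - by rewrite divr_ge0// ltW.
  - rewrite cabs_dblaschke// ler_pdivlMr ?exprn_gt0 ?cabs_1Mconj_gt0//.
    have den : cabs (1 - (x^*)%C * z) <= 3 * (1 - cabs x).
      rewrite (_ : _ - _ = (1 - x * (x^*)%C) - (x^*)%C * (z - x)); last by ring.
      apply: le_trans (cabsB _ _) _; rewrite cabs_1Mmulconj gtr0_norm ?sqr_lt1//.
      rewrite cabsM cabs_conj; have := cabs_ge0 (z - x).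
      have : cabs x * cabs (z - x) <= 1 * cabs (z - x).
        by rewrite ler_wpM2r ?cabs_ge0 ?ltW.
      nra.
    apply: (@le_trans _ _ ((1 - cabs x)^-1 / 9 * (3 * (1 - cabs x)) ^+ 2)).
      apply: ler_wpM2l; first by rewrite divr_ge0// invr_ge0 ltW.
      by rewrite lerXn2r ?nnegrE ?cabs_ge0// mulr_ge0// ltW.
    rewrite [leLHS](_ : _ = 1 - cabs x); last by field; exact: lt0r_neq0.
    nra.
  - have := cabs_fblaschke_lip r01 s1 xr zr.
    have := cabs_lb (fblaschke (l1 ++ l2) x) (fblaschke (l1 ++ l2) x - fblaschke (l1 ++ l2) z).
    rewrite subKr (cabs_distrC (fblaschke _ x)) => h1 h2.
    have : cabs (z - x) / (1 - r) <= d / 4.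
      rewrite ler_pdivrMr ?subr_gt0// rE; apply: le_trans zx _.
      rewrite mulrA; apply: ler_wpM2r; first exact: ltW.
      by rewrite kE; nra.
    lra.
have small : cabs (blaschke_factor x z * dfblaschke (l1 ++ l2) z) <=
    2 * k / (1 - cabs x).
  rewrite cabsM (_ : 2 * k / _ = k * (2 / (1 - cabs x))); last by ring.
  apply: ler_pM; rewrite ?cabs_ge0//.
    rewrite cabs_blaschke /pseudohyp cabsM cabsV ler_pdivrMr ?cabs_1Mconj_gt0//.
    rewrite cabs_distrC; apply: le_trans zx _.
    by rewrite ler_wpM2l ?(ltW k0)// cabs_1Mconj_ger.
  apply: le_trans (cabs_dfblaschke_le s1 z1) _.
  rewrite ler_pdivlMr// mulrC ler_pdivrMr ?subr_gt0//.
  nra.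
have := cabs_lb (dblaschke x z * fblaschke (l1 ++ l2) z)
  (- (blaschke_factor x z * dfblaschke (l1 ++ l2) z)).
rewrite opprK cabsN; apply: le_trans.
apply: le_trans (lerB main small).
rewrite kE -subr_ge0 (_ : _ - _ = 0)//; field.
exact: lt0r_neq0.
Qed.

End FiniteProduct.

(** * Limits of complex sequences and functions, expressed by the modulus *)

Section Limits.
Variable R : realType.
Implicit Types (z w : R[i]).

Lemma cvg_cabsP {T : Type} {F : set_system T} {FF : Filter F} (f : T -> R[i]) (l : R[i]) :
  f @ F --> l <-> forall e : R, 0 < e -> \forall t \near F, cabs (f t - l) < e.
Proof.
split=> [/cvgrPdist_lt H e e0|H].
  have /H : 0 < e%:C%C by rewrite ltcR.
  by apply: filterS => t; rewrite distrC cabs_normE ltcR.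
apply/cvgrPdist_lt => -[e e'] /andP[/eqP /= -> e0].
by apply: filterS (H e e0) => t; rewrite distrC cabs_normE ltcR.
Qed.

Lemma cvgn_cabsP (u : nat -> R[i]) (l : R[i]) :
  u @ \oo --> l <->
  forall e : R, 0 < e -> exists N, forall n, (N <= n)%N -> cabs (u n - l) < e.
Proof.
split=> [/cvg_cabsP H e /H [N _ HN]|H]; first by exists N => n /HN.
by apply/cvg_cabsP => e /H [N HN]; exists N.
Qed.

Lemma cvgn_cabs_le (u : nat -> R[i]) (l : R[i]) (C : R) :
  u @ \oo --> l -> (exists N, forall n, (N <= n)%N -> cabs (u n) <= C) ->
  cabs l <= C.
Proof.
move=> /cvgn_cabsP ul [N uC]; apply/ler_addgt0Pr => e /ul [N' HN'].
have := cabsB (u (maxn N N')) (u (maxn N N') - l); rewrite subKr => /le_trans; apply.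
by apply: lerD; [apply: uC; exact: leq_maxl|apply/ltW/HN'; exact: leq_maxr].
Qed.

Lemma cvgn_cabs_ge (u : nat -> R[i]) (l : R[i]) (C : R) :
  u @ \oo --> l -> (exists N, forall n, (N <= n)%N -> C <= cabs (u n)) ->
  C <= cabs l.
Proof.
move=> /cvgn_cabsP ul [N uC]; apply/ler_addgt0Pr => e /ul [N' HN'].
apply: le_trans (uC (maxn N N') (leq_maxl _ _)) _.
rewrite -[u _](subrK l) addrC; apply: le_trans (cabsD _ _) _; rewrite lerD2l.
by apply/ltW/HN'; exact: leq_maxr.
Qed.

Lemma cvgn_cauchy (u : nat -> R[i]) :
  (forall e : R, 0 < e -> exists N, forall n m, (N <= n)%N -> (N <= m)%N ->
     cabs (u n - u m) < e) ->
  exists l : R[i], u @ \oo --> l.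
Proof.
move=> H.
have part (f : R[i] -> R) : (forall z w, `|f z - f w| <= cabs (z - w)) ->
    cvgn (f \o u).
  move=> fL; apply/cauchy_cvgP; apply: cauchy_exP => e /H [N HN].
  exists (f (u N)); exists N => // n /= Nn.
  by rewrite /ball /=; apply: le_lt_trans (fL _ _) (HN _ _ _ _).
have /cvg_ex[/= x ux] := part (@complex.Re R) (fun z w => ltac:(rewrite -raddfB; exact: cabs_Re_le)).
have /cvg_ex[/= y uy] := part (@complex.Im R) (fun z w => ltac:(rewrite -raddfB; exact: cabs_Im_le)).
exists (x +i* y)%C; apply/cvgn_cabsP => e e0.
have e2 : 0 < e / 2 by rewrite divr_gt0.
move/cvgrPdist_lt : ux => /(_ _ e2)[N1 _ HN1].
move/cvgrPdist_lt : uy => /(_ _ e2)[N2 _ HN2].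
exists (maxn N1 N2) => n; rewrite geq_max => /andP[/HN1 /= h1 /HN2 /= h2].
apply: le_lt_trans (cabs_le_ReIm _) _; rewrite !raddfB /= [ltRHS](splitr e).
by apply: ltrD; rewrite distrC.
Qed.

(** The difference quotients at a small step [h] differ from the derivatives
    by [O(h)] uniformly in [N] and converge with the functions, so that the
    derivatives form a Cauchy sequence; its limit inherits the remainder. *)
Lemma derive1_limit (F : nat -> R[i] -> R[i]) (D : nat -> R[i]) (B : R[i] -> R[i])
    (z : R[i]) (r M : R) : cabs z < r ->
  (forall N w, cabs w <= r ->
     cabs (F N w - F N z - (w - z) * D N) <= M * cabs (w - z) ^+ 2) ->
  (forall w, cabs w <= r -> F N w @[N --> \oo] --> B w) ->
  D @ \oo --> derive1 B z.
Proof.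
move=> zr quad FB.
have {M quad} [M [M1 quad]] : exists M, 0 < M /\ (forall N w, cabs w <= r ->
     cabs (F N w - F N z - (w - z) * D N) <= M * cabs (w - z) ^+ 2).
  exists (`|M| + 1); split; first by rewrite ltr_wpDl.
  move=> N w /(quad N)/le_trans; apply.
  by rewrite ler_wpM2r ?sqr_ge0// ler_wpDr// ler_norm.
have zr' := ltW zr.
have [l Dl] : exists l : R[i], D @ \oo --> l.
  apply: cvgn_cauchy => e e0.
  (* a step that stays in the disk of radius [r] with [M h^2] below [e h / 8] *)
  pose h := Num.min (r - cabs z) (e / (8 * M)).
  have h0 : 0 < h by rewrite lt_min subr_gt0 zr divr_gt0// mulr_gt0.
  have hM : M * h <= e / 8.
    have : h <= e / (8 * M) by rewrite ge_min lexx orbT.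
    rewrite ler_pdivlMr ?mulr_gt0//; lra.
  pose w := z + h%:C%C.
  have wz : w - z = h%:C%C by rewrite /w addrC addKr.
  have wr : cabs w <= r.
    apply: le_trans (cabsD _ _) _; rewrite cabs_real gtr0_norm// -lerBrDl.
    by rewrite ge_min lexx.
  have eh : 0 < e * h / 8 by rewrite divr_gt0// mulr_gt0.
  have /cvgn_cabsP/(_ _ eh)[N1 HN1] := FB w wr.
  have /cvgn_cabsP/(_ _ eh)[N2 HN2] := FB z zr'.
  exists (maxn N1 N2) => n m; rewrite !geq_max => /andP[n1 n2] /andP[m1 m2].
  have qn := quad n w wr; have qm := quad m w wr.
  have := HN1 n n1; have := HN1 m m1; have := HN2 n n2; have := HN2 m m2.
  move: qn qm; rewrite wz cabs_real gtr0_norm// => qn qm f1 f2 f3 f4.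
  rewrite -(ltr_pM2l h0) -[X in X * cabs _](gtr0_norm h0) -cabs_real -cabsM.
  have -> : h%:C%C * (D n - D m) =
     (F n w - B w) - (F m w - B w) - (F n z - B z) + (F m z - B z)
     - (F n w - F n z - h%:C%C * D n) + (F m w - F m z - h%:C%C * D m) by ring.
  apply: le_lt_trans (cabsD _ _) _; apply: le_lt_trans (lerD (cabsB _ _) qm) _.
  apply: le_lt_trans (lerD (lerD (cabsD _ _) qn) (lexx _)) _.
  apply: le_lt_trans (lerD (lerD (lerD (cabsB _ _) (lexx _)) (lexx _)) (lexx _)) _.
  apply: le_lt_trans
    (lerD (lerD (lerD (lerD (cabsB _ _) (lexx _)) (lexx _)) (lexx _)) (lexx _)) _.
  have hh : M * h ^+ 2 <= e * h / 8.
    by rewrite expr2 mulrA (_ : e * h / 8 = e / 8 * h); [rewrite ler_wpM2r// ltW|ring].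
  lra.
have quadB w : cabs w <= r -> cabs (B w - B z - (w - z) * l) <= M * cabs (w - z) ^+ 2.
  move=> wr; apply: (@cvgn_cabs_le (fun N => F N w - F N z - (w - z) * D N)).
    apply: cvgB; first by apply: cvgB; exact: FB.
    exact: (@cvgM R[i] nat \oo _ (fun=> w - z) D _ _ (cvg_cst _) Dl).
  by exists 0%N => n _; exact: quad.
suff -> : derive1 B z = l by [].
rewrite /derive1; apply: cvg_lim => //.
apply/cvg_cabsP => e e0.
pose d := Num.min (r - cabs z) (e / (2 * M)).
have d0 : 0 < d by rewrite lt_min subr_gt0 zr divr_gt0// mulr_gt0.
exists d%:C%C; first by rewrite /= ltcR.
move=> h /=; rewrite sub0r normrN cabs_normE ltcR => hd h0.
have h1 : 0 < cabs h by rewrite cabs_gt0.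
have wr : cabs (h + z) <= r.
  apply: le_trans (cabsD _ _) _; rewrite -lerBrDr; apply: le_trans (ltW hd) _.
  by rewrite ge_min lexx.
have := quadB _ wr; rewrite addrK => q.
have -> : h^-1 *: (B (h + z) - B z) - l = h^-1 * (B (h + z) - B z - h * l).
  by rewrite [RHS]mulrBr mulKf.
rewrite cabsM cabsV mulrC ltr_pdivrMr//; apply: le_lt_trans q _.
rewrite expr2 mulrA ltr_pM2r//.
have : d <= e / (2 * M) by rewrite ge_min lexx orbT.
move=> /(lt_le_trans hd); rewrite ltr_pdivlMr ?mulr_gt0//.
have := mulr_gt0 M1 h1; lra.
Qed.

End Limits.

(** * Infinite Blaschke products *)

Section InfiniteProduct.
Variable R : realType.
Implicit Types (x z w : R[i]) (s : seq R[i]) (I : set nat) (a : nat -> R[i]).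

Notation in_disk s := (all (fun x => cabs x < 1) s).
Notation mass s := (\sum_(x <- s) (1 - cabs x ^+ 2)).

Definition first_zeros I a N : seq R[i] :=
  [seq a k | k <- index_iota 0 N & k \in I].

Lemma prod_first_zeros I a N z :
  \prod_(0 <= k < N | k \in I) blaschke_factor (a k) z =
  fblaschke (first_zeros I a N) z.
Proof. by rewrite /fblaschke big_map big_filter. Qed.

Lemma first_zeros_disk I a N : (forall n, I n -> unit_disk (a n)) ->
  in_disk (first_zeros I a N).
Proof.
move=> aD; rewrite all_map; apply/allP => k /=.
by rewrite mem_filter => /andP[/set_mem /aD].
Qed.

Lemma first_zeros_cat I a N M : (N <= M)%N ->
  exists t, first_zeros I a M = first_zeros I a N ++ t.
Proof.
move=> NM; exists [seq a k | k <- index_iota N M & k \in I].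
rewrite -map_cat -filter_cat /first_zeros; congr [seq a k | k <- [seq k <- _ | _]].
by rewrite /index_iota !subn0 -{1}(subnKC NM) iotaD.
Qed.

Lemma esum_seq_le (T : choiceType) (A : set T) (f : T -> R) (r : seq T) :
  uniq r -> (forall t, t \in r -> A t) ->
  ((\sum_(t <- r) f t)%:E <= \esum_(t in A) (f t)%:E)%E.
Proof.
move=> ur rA; rewrite -sumEFin fsbig_seq//.
have fr : fsets A [set` r] by split=> [|t /= /rA//]; exact: finite_seq.
by apply: ereal_sup_ubound; exists [set` r].
Qed.

Lemma mass_bounded I a : (forall n, I n -> unit_disk (a n)) ->
  (\esum_(n in I) (1 - cabs (a n))%:E < +oo)%E ->
  exists S : R, forall N, mass (first_zeros I a N) <= S.
Proof.
move=> aD fin.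
have f0 n : I n -> (0 <= (1 - cabs (a n))%:E)%E.
  by move=> /aD an; rewrite lee_fin subr_ge0 ltW.
exists (2 * fine (\esum_(n in I) (1 - cabs (a n))%:E)%E) => N.
have h : \sum_(k <- [seq k <- index_iota 0 N | k \in I]) (1 - cabs (a k)) <=
    fine (\esum_(n in I) (1 - cabs (a n))%:E)%E.
  rewrite -lee_fin fineK; last first.
    by rewrite ge0_fin_numE// esum_ge0.
  apply: esum_seq_le; first by rewrite filter_uniq// iota_uniq.
  by move=> t; rewrite mem_filter => /andP[/set_mem].
apply: le_trans (_ : 2 * \sum_(k <- [seq k <- index_iota 0 N | k \in I]) (1 - cabs (a k)) <= _).
  rewrite big_map mulr_sumr big_seq [leRHS]big_seq; apply: ler_sum => k.
  rewrite mem_filter => /andP[/set_mem /aD ak _].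
  by have := cabs_ge0 (a k); rewrite /unit_disk /= in ak *; nra.
by rewrite ler_pM2l.
Qed.

Lemma mass_cat s t : mass (s ++ t) = mass s + mass t.
Proof. exact: big_cat. Qed.

Lemma mass_tail I a (S e : R) : (forall n, I n -> unit_disk (a n)) ->
  (forall N, mass (first_zeros I a N) <= S) -> 0 < e ->
  exists N, forall M t, first_zeros I a M = first_zeros I a N ++ t -> mass t <= e.
Proof.
move=> aD mS e0; pose A := range (fun N => mass (first_zeros I a N)).
have hA : has_sup A.
  split; first by exists (mass (first_zeros I a 0)), 0%N.
  by exists S => _ [N _ <-].
have [_ [N _ <-] HN] := sup_adherent e0 hA.
exists N => M t E.
have : mass (first_zeros I a M) <= sup A by apply: ub_le_sup; [exact: hA.2|exists M].
rewrite E mass_cat; move: HN; rewrite ltrBlDr => /ltW; lra.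
Qed.

Lemma fblaschke_tail_ge s z : in_disk s -> cabs z < 1 ->
  1 - 4 / (1 - cabs z) * mass s <= cabs (fblaschke s z).
Proof.
move=> + z1; elim: s => [_|x s IH /= /andP[x1 s1]].
  by rewrite /fblaschke !big_nil mulr0 subr0 cabs1.
rewrite fblaschke_cons big_cons cabsM; have {}IH := IH s1.
have t1 := cabs_blaschke_le1 x1 z1; have P1 := cabs_fblaschke_le1 s1 z1.
have P0 := cabs_ge0 (fblaschke s z).
have z0 : 0 < 1 - cabs z by rewrite subr_gt0.
have tx : 1 - 4 / (1 - cabs z) * (1 - cabs x ^+ 2) <= cabs (blaschke_factor x z).
  apply: le_trans (cabs_blaschke_ge x1 z1); rewrite lerD2l lerN2 mulrAC.
  apply: ler_wpM2l; first by rewrite divr_ge0// ltW.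
  by have := cabs_ge0 x; nra.
rewrite mulrDr opprD addrA.
set c := _ * (1 - _ ^+ 2) in tx *; set C := _ * mass s in IH *; nra.
Qed.

Lemma fblaschke_neq0 s z : in_disk s -> cabs z < 1 -> z \notin s ->
  fblaschke s z != 0.
Proof.
move=> + z1; elim: s => [|x s IH] /=; first by rewrite /fblaschke big_nil oner_neq0.
move=> /andP[x1 s1]; rewrite inE negb_or => /andP[zx zs].
rewrite fblaschke_cons mulf_neq0 ?IH// blaschke_factorE.
rewrite mulf_neq0 -?cabs_gt0 ?cabs_phase// cabsM cabsV mulr_gt0 ?invr_gt0 ?cabs_1Mconj_gt0//.
by rewrite cabs_gt0 subr_eq0 eq_sym.
Qed.

(** Away from its zeros an infinite product does not degenerate: a tail of
    small mass contributes a factor at least [1/2]. *)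
Lemma fblaschke_lower_bound I a (S : R) z : (forall n, I n -> unit_disk (a n)) ->
  (forall N, mass (first_zeros I a N) <= S) -> cabs z < 1 ->
  exists2 g : R, 0 < g &
    forall N, g <= cabs (fblaschke [seq x <- first_zeros I a N | x != z] z).
Proof.
move=> aD mS z1; have z0 : 0 < 1 - cabs z by rewrite subr_gt0.
have [|N0 HN0] := mass_tail (e := (1 - cabs z) / 8) aD mS; first by rewrite divr_gt0.
pose rest N := [seq x <- first_zeros I a N | x != z].
have restD N : in_disk (rest N).
  by apply/allP => x; rewrite mem_filter => /andP[_ xN]; exact: (allP (first_zeros_disk N aD)) xN.
have rest0 N : 0 < cabs (fblaschke (rest N) z).
  by rewrite cabs_gt0 fblaschke_neq0// mem_filter eqxx.
exists (cabs (fblaschke (rest N0) z) / 2); first by rewrite divr_gt0.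
move=> N; have [NN0|N0N] := leqP N0 N.
  have [t Et] := first_zeros_cat I a NN0.
  rewrite Et filter_cat fblaschke_cat cabsM -/(rest N0); apply: ler_wpM2l; first exact: ltW.
  have tD : in_disk t.
    by have := first_zeros_disk N aD; rewrite Et all_cat => /andP[].
  have t'D : in_disk [seq x <- t | x != z].
    by apply/allP => x; rewrite mem_filter => /andP[_ xt]; exact: (allP tD) xt.
  apply: le_trans (fblaschke_tail_ge t'D z1).
  have : mass [seq x <- t | x != z] <= (1 - cabs z) / 8.
    apply: le_trans (HN0 _ _ Et); rewrite big_filter [leRHS](bigID (fun x => x != z)) /=.
    rewrite lerDl big_seq_cond; apply: sumr_ge0 => x /andP[/(allP tD) x1 _].
    by rewrite ltW// sqr_lt1.
  rewrite mulrAC ler_pdivlMr//; set m := mass _ => hm.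
  rewrite lerBrDr -lerBrDl ler_pdivrMr//; lra.
have [t Et] := first_zeros_cat I a (ltnW N0N).
rewrite /rest Et filter_cat fblaschke_cat cabsM -/(rest N).
have := cabs_ge0 (fblaschke (rest N) z).
have t'D : in_disk [seq x <- t | x != z].
  have := restD N0; rewrite /rest Et filter_cat all_cat => /andP[_ //].
have := cabs_fblaschke_le1 t'D z1; have := cabs_ge0 (fblaschke [seq x <- t | x != z] z).
rewrite /rest; nra.
Qed.

Lemma nat_bounded_stationary (u : nat -> nat) (K : nat) :
  {homo u : m n / (m <= n)%N} -> (forall n, (u n <= K)%N) ->
  exists m N, forall n, (N <= n)%N -> u n = m.
Proof.
move=> um uK; have exP : exists k, `[< exists n, u n = k >].
  by exists (u 0%N); apply/asboolP; exists 0%N.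
have ub k : `[< exists n, u n = k >] -> (k <= K)%N by move=> /asboolP[n <-].
case: (ex_maxnP exP ub) => m /asboolP[N uN] mmax.
exists m, N => n Nn; apply/eqP; rewrite eqn_leq mmax/=; last by apply/asboolP; exists n.
by rewrite -uN um.
Qed.

(** Each occurrence of [z] carries the mass [1 - |z|^2], so the multiplicity is
    bounded by the total mass. *)
Lemma count_stationary I a (S : R) z : (forall n, I n -> unit_disk (a n)) ->
  (forall N, mass (first_zeros I a N) <= S) -> cabs z < 1 ->
  exists m N0, forall N, (N0 <= N)%N -> count_mem z (first_zeros I a N) = m.
Proof.
move=> aD mS z1; have c0 := sqr_lt1 z1.
apply: (@nat_bounded_stationary _ (Num.trunc (S / (1 - cabs z ^+ 2))).+1).
  by move=> m n /(first_zeros_cat I a)[t ->]; rewrite count_cat leq_addr.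
move=> N; rewrite -(ler_nat R); apply/ltW; apply: le_lt_trans (truncnS_gt _).
rewrite ler_pdivlMr//; apply: le_trans (mS N).
have := first_zeros_disk N aD; elim: (first_zeros I a N) => [|x s IH /= /andP[x1 s1]].
  by rewrite big_nil mul0r.
rewrite big_cons natrD mulrDl; apply: lerD; last exact: IH.
by case: eqP => [->|_]; rewrite ?mul1r// mul0r ltW// sqr_lt1.
Qed.

Lemma fblaschke_split_count s x z :
  fblaschke s x =
  blaschke_factor z x ^+ count_mem z s * fblaschke [seq y <- s | y != z] x.
Proof.
elim: s => [|y s IH] /=; first by rewrite expr0 mul1r.
rewrite fblaschke_cons IH; case: eqP => [->|_] /=.
  by rewrite exprS mulrA.
by rewrite fblaschke_cons mulrCA.
Qed.

Lemma zero_order_unique (f : R[i] -> R[i]) z m n :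
  zero_order f z m -> zero_order f z n -> m = n.
Proof.
have aux k l : (k < l)%N -> zero_order f z k -> ~ zero_order f z l.
  move=> kl [c c0 fc] [c' c'0 fc'].
  have sub0 : (x - z) ^+ (l - k) @[x --> z^'] --> (0 : R[i]).
    apply/cvg_cabsP => e e0.
    have m0 : 0 < Num.min 1 e by rewrite lt_min ltr01.
    exists (Num.min 1 e)%:C%C; first by rewrite /= ltcR.
    move=> x /=; rewrite distrC cabs_normE ltcR lt_min => /andP[h1 he] _.
    rewrite subr0 cabsX; apply: le_lt_trans he.
    rewrite -(prednK (n := l - k)) ?subn_gt0// exprS; apply: ler_piMr; first exact: cabs_ge0.
    by apply: exprn_ile1; [exact: cabs_ge0|exact: ltW].
  have h : f x / (x - z) ^+ l * (x - z) ^+ (l - k) @[x --> z^'] --> (c' * 0 : R[i]).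
    exact: (@cvgM R[i] _ _ _ _ _ _ _ fc' sub0).
  rewrite mulr0 in h.
  have : f x / (x - z) ^+ k @[x --> z^'] --> (0 : R[i]).
    apply: (cvg_trans _ h); apply: near_eq_cvg.
    exists 1 => //= x _ xz /=; rewrite -{1}(subnKC (ltnW kl)) exprD invfM -!mulrA.
    by rewrite mulVf ?mulr1// expf_neq0// subr_eq0.
  by move=> h0; move/eqP: c0; apply; exact: cvg_unique fc h0.
by move=> fm fn; apply/eqP; rewrite eqn_leq; apply/andP; split;
  rewrite leqNgt; apply/negP => h; [exact: aux h fn fm|exact: aux h fm fn].
Qed.

Section Product.
Variables (B : R[i] -> R[i]) (lambda : R[i]) (I : set nat) (a : nat -> R[i]) (S : R).
Hypothesis lambda1 : cabs lambda = 1.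
Hypothesis aD : forall n, I n -> unit_disk (a n).
Hypothesis mS : forall N, mass (first_zeros I a N) <= S.
Hypothesis BE : forall z, cabs z < 1 ->
  lambda * fblaschke (first_zeros I a N) z @[N --> \oo] --> B z.

Let sD N := first_zeros_disk N aD.

Let S0 : 0 <= S.
Proof. exact: le_trans (mass_ge0 (sD 0)) (mS 0). Qed.

Lemma cvg_dfblaschke z : cabs z < 1 ->
  lambda * dfblaschke (first_zeros I a N) z @[N --> \oo] --> derive1 B z.
Proof.
move=> z1; pose r := (1 + cabs z) / 2; have z0 := cabs_ge0 z.
have zr : cabs z < r by rewrite /r; lra.
have r01 : 0 <= r < 1 by rewrite /r; apply/andP; split; lra.
have r1 : r < 1 by case/andP: r01.
apply: (@derive1_limit _ (fun N w => lambda * fblaschke (first_zeros I a N) w)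
  _ B z r ((S + S ^+ 2) / (1 - r) ^+ 4)) => //.
  move=> N w wr.
  have -> : lambda * fblaschke (first_zeros I a N) w - lambda * fblaschke (first_zeros I a N) z
    - (w - z) * (lambda * dfblaschke (first_zeros I a N) z) =
    lambda * (fblaschke (first_zeros I a N) w - fblaschke (first_zeros I a N) z
    - (w - z) * dfblaschke (first_zeros I a N) z) by ring.
  rewrite cabsM lambda1 mul1r.
  apply: le_trans (cabs_fblaschke_remainder_le r01 (sD N) (ltW zr) wr) _.
  apply: ler_wpM2r; first exact: sqr_ge0.
  apply: ler_wpM2r; first by rewrite invr_ge0 exprn_ge0// subr_ge0 ltW.
  have m0 := mass_ge0 (sD N).
  by apply: lerD => //; rewrite lerXn2r ?nnegrE.
by move=> w wr; apply: BE; exact: le_lt_trans wr r1.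
Qed.

(** The product [G N] of the factors that do not vanish at [z] is Lipschitz
    uniformly in [N].  Its limit is known away from [z], where it is the
    quotient [g]; the Lipschitz bound extends the convergence to [z] and makes
    the limit [l] there, which is not 0, the limit of [g]. *)
Lemma zero_order_count z m N0 : cabs z < 1 ->
  (forall N, (N0 <= N)%N -> count_mem z (first_zeros I a N) = m) ->
  zero_order B z m.
Proof.
move=> z1 cm; pose r := (1 + cabs z) / 2; have z0 := cabs_ge0 z.
have zr : cabs z < r by rewrite /r; lra.
have r1 : r < 1 by rewrite /r; lra.
pose G N x := fblaschke [seq y <- first_zeros I a N | y != z] x.
have restD N : in_disk [seq y <- first_zeros I a N | y != z].
  by apply/allP => x; rewrite mem_filter => /andP[_ xN]; exact: (allP (sD N)) xN.
pose L := S / (1 - r) ^+ 2 + 1.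
have c0 : 0 < (1 - r) ^+ 2 by rewrite exprn_gt0// subr_gt0.
have L0 : 0 < L by rewrite ltr_wpDl// divr_ge0// ltW.
have GL N x : cabs x <= r -> cabs (G N x - G N z) <= L * cabs (x - z).
  move=> xr; apply: le_trans (cabs_fblaschke_diff_le r1 (restD N) (ltW zr) xr) _.
  rewrite mulrAC; apply: ler_wpM2r; first exact: cabs_ge0.
  rewrite ler_wpDr//; apply: ler_wpM2r; first by rewrite invr_ge0 ltW.
  apply: le_trans (mS N); rewrite big_filter [leRHS](bigID (fun x => x != z)) /=.
  rewrite lerDl big_seq_cond; apply: sumr_ge0 => y /andP[/(allP (sD N)) y1 _].
  by rewrite ltW// sqr_lt1.
pose u x := lambda * (- blaschke_phase z / (1 - (z^*)%C * x)) ^+ m.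
have phase0 : blaschke_phase z != 0 by rewrite -cabs_gt0 cabs_phase.
have u0 x : cabs x < 1 -> u x != 0.
  move=> x1; rewrite mulf_neq0 -?cabs_gt0 ?lambda1//.
  by rewrite cabs_gt0 expf_neq0// mulf_neq0 ?oppr_eq0// invr_neq0// sub1Mconj_neq0.
have fE N x : (N0 <= N)%N ->
    lambda * fblaschke (first_zeros I a N) x = u x * (x - z) ^+ m * G N x.
  move=> /cm cN; rewrite (fblaschke_split_count _ _ z) cN mulrA; congr (_ * _).
  rewrite /u -mulrA -exprMn; congr (_ * _ ^+ _).
  by rewrite blaschke_factorE; ring.
pose g x := B x / (u x * (x - z) ^+ m).
have Gg x : cabs x < 1 -> x != z -> G N x @[N --> \oo] --> g x.
  move=> x1 xz; have d0 : u x * (x - z) ^+ m != 0.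
    by rewrite mulf_neq0 ?u0// expf_neq0// subr_eq0.
  apply/cvgn_cabsP => e e0.
  have /cvgn_cabsP := BE x1; move=> /(_ (e * cabs (u x * (x - z) ^+ m))).
  case=> [|N1 HN1]; first by rewrite mulr_gt0// cabs_gt0.
  exists (maxn N0 N1) => N; rewrite geq_max => /andP[/(fE _ x) E /HN1].
  rewrite E -ltr_pdivrMr ?cabs_gt0// -cabsV -cabsM mulrBl.
  by rewrite (mulrC (u x * _)) mulfK.
have [l Gl] : exists l : R[i], G N z @[N --> \oo] --> l.
  apply: cvgn_cauchy => e e0.
  pose h := Num.min (r - cabs z) (e / (8 * L)).
  have h0 : 0 < h by rewrite lt_min subr_gt0 zr divr_gt0// mulr_gt0.
  have hL : L * h <= e / 8.
    have : h <= e / (8 * L) by rewrite ge_min lexx orbT.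
    rewrite ler_pdivlMr ?mulr_gt0//; lra.
  pose x := z + h%:C%C.
  have xz : x - z = h%:C%C by rewrite /x addrC addKr.
  have xr : cabs x <= r.
    apply: le_trans (cabsD _ _) _; rewrite cabs_real gtr0_norm// -lerBrDl.
    by rewrite ge_min lexx.
  have x1 : cabs x < 1 := le_lt_trans xr r1.
  have xNz : x != z by rewrite -subr_eq0 xz -cabs_gt0 cabs_real gtr0_norm.
  have e8 : 0 < e / 8 by rewrite divr_gt0.
  have /cvgn_cabsP/(_ _ e8)[N1 HN1] := Gg x x1 xNz.
  exists N1 => n k /HN1 hn /HN1 hk.
  have := GL n x xr; have := GL k x xr; rewrite xz cabs_real gtr0_norm// => qk qn.
  have -> : G n z - G k z = (G n x - g x) - (G k x - g x) - (G n x - G n z)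
     + (G k x - G k z) by ring.
  apply: le_lt_trans (cabsD _ _) _.
  apply: le_lt_trans (lerD (cabsB _ _) (lexx _)) _.
  apply: le_lt_trans (lerD (lerD (cabsB _ _) (lexx _)) (lexx _)) _.
  lra.
have l0 : l != 0.
  have [gm gm0 Hg] := fblaschke_lower_bound aD mS z1.
  rewrite -cabs_gt0; apply: lt_le_trans gm0 _; apply: (cvgn_cabs_ge Gl).
  by exists 0%N => N _; exact: Hg.
have gL x : cabs x <= r -> x != z -> cabs (g x - l) <= L * cabs (x - z).
  move=> xr xz; apply: (@cvgn_cabs_le _ (fun N => G N x - G N z)).
    exact: cvgB (Gg x (le_lt_trans xr r1) xz) Gl.
  by exists 0%N => N _; exact: GL.
exists (u z * l); first by rewrite mulf_neq0// u0.
have uc : u x @[x --> z^'] --> u z.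
  apply: cvg_within_filter; have FF : Filter (nbhs z) by typeclasses eauto.
  have cst (c : R[i]) : (fun=> c) @ z --> c by exact: (@cvg_cst _ _ _ _ FF).
  have mul (f1 f2 : R[i] -> R[i]) (l1 l2 : R[i]) : f1 @ z --> l1 -> f2 @ z --> l2 ->
    f1 x * f2 x @[x --> z] --> l1 * l2 by exact: (@cvgM R[i] _ _ FF).
  have mc : (z^*)%C * x @[x --> z] --> (z^*)%C * z by exact: mul (cst _) cvg_id.
  have dc : 1 - (z^*)%C * x @[x --> z] --> 1 - (z^*)%C * z.
    exact: (@cvgB _ _ _ _ FF _ _ _ _ (cst 1) mc).
  have ic : - blaschke_phase z / (1 - (z^*)%C * x) @[x --> z] --> - blaschke_phase z / (1 - (z^*)%C * z).
    exact: mul (cst _) (@cvgV R[i] _ _ FF _ _ (sub1Mconj_neq0 z1 z1) dc).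
  rewrite /u; apply: (mul (fun=> lambda)); first exact: cst.
  elim: m {cm u u0 fE g Gg gL} => [|m IH].
    by under eq_fun do rewrite expr0; rewrite expr0; exact: cst.
  by under eq_fun do rewrite exprS; rewrite exprS; exact: mul ic IH.
have gc : g x @[x --> z^'] --> l.
  apply/cvg_cabsP => e e0.
  pose d := Num.min (r - cabs z) (e / L).
  have d0 : 0 < d by rewrite lt_min subr_gt0 zr divr_gt0.
  exists d%:C%C; first by rewrite /= ltcR.
  move=> x /=; rewrite distrC cabs_normE ltcR lt_min => /andP[h1 h2] xz.
  apply: le_lt_trans (gL x _ xz) _; last by rewrite mulrC -ltr_pdivlMr.
  by rewrite -[x](subrK z); apply: le_trans (cabsD _ _) _; rewrite -lerBrDr ltW.
have h : u x * g x @[x --> z^'] --> u z * l := @cvgM R[i] _ _ (Proper_dnbhs_numFieldType z) _ _ _ _ uc gc.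
apply: (cvg_trans _ h); apply: near_eq_cvg.
exists (r - cabs z)%:C%C; first by rewrite /= ltcR subr_gt0.
move=> x /=; rewrite distrC cabs_normE ltcR => h1 xz.
have x1 : cabs x < 1.
  apply: lt_trans r1; rewrite -[x](subrK z); apply: le_lt_trans (cabsD _ _) _.
  by rewrite -ltrBrDr.
by rewrite /g invfM mulrCA mulVKf// u0.
Qed.

Lemma zero_multE z : cabs z < 1 -> exists N0, forall N, (N0 <= N)%N ->
  count_mem z (first_zeros I a N) = zero_mult B z.
Proof.
move=> z1; have [m [N0 HN0]] := count_stationary aD mS z1.
exists N0 => N /HN0 ->; have zm := zero_order_count z1 HN0.
rewrite /zero_mult; symmetry; apply: xget_unique => // n zn.
exact: zero_order_unique zn zm.
Qed.

Lemma first_zeros_root N z : z \in first_zeros I a N -> B z = 0.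
Proof.
move=> zN; have z1 := allP (sD N) _ zN.
have /cvgn_cabsP H := BE z1.
apply/eqP; rewrite -cabs_eq0 eq_le cabs_ge0 andbT; apply/ler_addgt0Pr => e /H[N1 HN1].
have := HN1 (maxn N N1) (leq_maxr _ _); have [t ->] := first_zeros_cat I a (leq_maxl N N1).
rewrite fblaschke_cat (_ : fblaschke (first_zeros I a N) z = 0).
  by rewrite mul0r mulr0 sub0r cabsN add0r => /ltW.
case/splitPr: zN => l1 l2.
by rewrite fblaschke_cat fblaschke_cons blaschke_factor_root mul0r mulr0.
Qed.

Lemma count_le_zero_mult N z : cabs z < 1 ->
  (count_mem z (first_zeros I a N) <= zero_mult B z)%N.
Proof.
move=> z1; have [N0 HN0] := zero_multE z1.
rewrite -(HN0 (maxn N N0) (leq_maxr _ _)).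
by have [t ->] := first_zeros_cat I a (leq_maxl N N0); rewrite count_cat leq_addr.
Qed.

Lemma sum_first_zeros_le (g : R[i] -> R) N : (forall z, cabs z < 1 -> 0 <= g z) ->
  ((\sum_(x <- first_zeros I a N) g x)%:E <= zero_sum B g)%E.
Proof.
move=> g0; rewrite -big_undup_iterop_count.
apply: (@le_trans _ _ (\sum_(x <- undup (first_zeros I a N)) (zero_mult B x)%:R * g x)%:E).
  rewrite lee_fin big_seq_cond [leRHS]big_seq_cond; apply: ler_sum => x.
  rewrite mem_undup andbT => /(allP (sD N)) x1; rewrite mulr_natl.
  by apply: ler_wpMn2l; [exact: g0|exact: count_le_zero_mult].
apply: esum_seq_le; first exact: undup_uniq.
by move=> x; rewrite mem_undup => xN; split; [exact: (allP (sD N))|exact: first_zeros_root xN].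
Qed.

End Product.

End InfiniteProduct.

(** * Separated zeros *)

Section Separated.
Variable R : realType.
Implicit Types (x y z w : R[i]) (s : seq R[i]) (I : set nat) (a : nat -> R[i]).

Lemma pseudohyp_ge0 x y : 0 <= pseudohyp x y.
Proof. exact: cabs_ge0. Qed.

Lemma pseudohyp_le1 x y : cabs x < 1 -> cabs y < 1 -> pseudohyp x y <= 1.
Proof. by move=> x1 y1; rewrite -cabs_blaschke cabs_blaschke_le1. Qed.

Lemma prod_subset_le (T : eqType) (f : T -> R) (r1 r2 : seq T) :
  uniq r1 -> uniq r2 -> {subset r1 <= r2} ->
  (forall t, t \in r2 -> 0 <= f t <= 1) ->
  \prod_(t <- r2) f t <= \prod_(t <- r1) f t.
Proof.
move=> u1 u2 sub f01; rewrite (bigID (fun t => t \in r1)) /=.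
have -> : \prod_(t <- r1) f t = \prod_(t <- r2 | t \in r1) f t.
  rewrite -[RHS]big_filter; apply: perm_big; apply: uniq_perm => //.
    exact: filter_uniq.
  by move=> t; rewrite mem_filter; have [/sub ->|] := boolP (t \in r1).
apply: ler_piMr.
  by rewrite big_seq_cond; apply: prodr_ge0 => t /andP[/f01 /andP[]].
rewrite big_seq_cond; apply: prodr_ile1 => t /andP[tr2 _].
exact: f01.
Qed.

(** The factors are at most 1, so that partial products decrease to the limit,
    which the infimum [delta] bounds from below. *)
Lemma separated_partial I a (delta : R) n N : (forall k, I k -> unit_disk (a k)) ->
  separated_seq I a delta -> I n ->
  delta <= \prod_(0 <= k < N | (k \in I) && (k != n)) pseudohyp (a k) (a n).
Proof.
move=> aD [_ <-] In.
pose u m := fun N => \prod_(0 <= k < N | (k \in I) && (k != m)) pseudohyp (a k) (a m).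
have u0 m M : 0 <= u m M by apply: prodr_ge0 => k _; exact: pseudohyp_ge0.
have u1 m : I m -> {homo u m : i j / (i <= j)%N >-> j <= i}.
  move=> Im i j ij; rewrite /u (big_cat_nat (n := i))//=; apply: ler_piMr; first exact: u0.
  apply: prodr_ile1 => k /andP[/set_mem Ik _].
  by rewrite pseudohyp_ge0 pseudohyp_le1//; [exact: aD Ik|exact: aD Im].
have cu m : I m -> cvgn (u m).
  move=> Im; apply: (cvgP (inf (range (u m)))); apply: nonincreasing_cvgn; first exact: u1.
  by exists 0 => _ [M _ <-].
apply: (@le_trans _ _ (limn (u n))); last by apply: nonincreasing_cvgn_ge; [exact: u1|exact: cu].
apply: ge_inf; last by exists n.
by exists 0 => _ [m Im <-]; apply: limr_ge; [exact: cu|apply: nearW => M; exact: u0].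
Qed.

Section Zeros.
Variables (B : R[i] -> R[i]) (lambda : R[i]) (I : set nat) (a : nat -> R[i]) (S : R).
Hypothesis lambda1 : cabs lambda = 1.
Hypothesis aD : forall n, I n -> unit_disk (a n).
Hypothesis mS : forall N, \sum_(x <- first_zeros I a N) (1 - cabs x ^+ 2) <= S.
Hypothesis BE : forall z, cabs z < 1 ->
  lambda * fblaschke (first_zeros I a N) z @[N --> \oo] --> B z.

Variables (J : set nat) (b : nat -> R[i]) (delta : R).
Hypothesis enum : zero_enum B J b.
Hypothesis sep : separated_seq J b delta.

Let bD n : J n -> unit_disk (b n). Proof. exact: enum.1. Qed.

(** A repeated zero would put a factor 0 in one of the separation products. *)
Lemma separated_zero_mult_le1 z : cabs z < 1 -> (zero_mult B z <= 1)%N.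
Proof.
move=> z1; rewrite leqNgt; apply/negP => m2.
have := enum.2 _ z1; rewrite card_eq_sym => /card_set_bijP[f [fS finj _]].
have [J0 b0] := fS 0%N (ltnW m2); have [J1 b1] := fS 1%N m2.
have f01 : f 1%N != f 0%N.
  apply/eqP => E; have := finj 1%N 0%N; rewrite !inE /= => /(_ m2 (ltnW m2) E) //.
have := separated_partial (f 1%N).+1 bD sep J0.
rewrite big_mkcond big_nat_recr//= ifT ?f01 ?andbT; last exact/mem_set.
rewrite b0 b1 /pseudohyp subrr mul0r cabs0 mulr0 leNgt => /negP; apply.
exact: sep.1.
Qed.

Lemma zero_enum_index z : cabs z < 1 -> (0 < zero_mult B z)%N ->
  exists n, J n /\ b n = z.
Proof.
move=> z1 m0; have := enum.2 _ z1; rewrite card_eq_sym => /card_set_bijP[f [fS _ _]].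
by exists (f 0%N); exact: (fS 0%N m0).
Qed.

Lemma separated_first_zeros_uniq N : uniq (first_zeros I a N).
Proof.
apply: count_mem_uniq => x; have [xN|/count_memPn//] := boolP (x \in first_zeros I a N).
have x1 := allP (first_zeros_disk N aD) _ xN.
apply/eqP; rewrite eqn_leq -has_count has_pred1 xN andbT.
by apply: leq_trans (separated_zero_mult_le1 x1); exact: count_le_zero_mult mS BE _ _ _.
Qed.

(** The separation product for the given enumeration bounds every finite
    product over other zeros, whatever the order in which they are listed. *)
Lemma separated_fblaschke N l1 x l2 : first_zeros I a N = l1 ++ x :: l2 ->
  delta <= cabs (fblaschke (l1 ++ l2) x).
Proof.
move=> E; rewrite cabs_fblaschke.
pose idx y := xget 0%N [set n | J n /\ b n = y].
have inz y : y \in first_zeros I a N -> J (idx y) /\ b (idx y) = y.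
  move=> yN; have y1 := allP (first_zeros_disk N aD) _ yN.
  apply: (xgetPex 0%N (P := [set n | J n /\ b n = y])); apply: zero_enum_index => //.
  apply: leq_trans (count_le_zero_mult lambda1 aD mS BE N y1).
  by rewrite -has_count has_pred1.
have := separated_first_zeros_uniq N; rewrite E.
rewrite uniq_catC /= mem_cat => /andP[]; rewrite negb_or => /andP[xl2 xl1].
rewrite uniq_catC => ul.
have sub y : y \in l1 ++ l2 -> y \in first_zeros I a N.
  by rewrite E !mem_cat inE => /orP[->//|->]; rewrite !orbT.
have [Jx bx] : J (idx x) /\ b (idx x) = x by apply: inz; rewrite E mem_cat inE eqxx orbT.
pose r := [seq idx y | y <- l1 ++ l2].
pose K := (\max_(k <- r) k).+1.
apply: le_trans (separated_partial K bD sep Jx) _.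
rewrite -big_filter bx (_ : \prod_(y <- l1 ++ l2) _ = \prod_(k <- r) pseudohyp (b k) x).
  apply: prod_subset_le.
  - rewrite map_inj_in_uniq// => y y' /sub/inz[_ {2}<-] /sub/inz[_ {2}<-] ->//.
  - by rewrite filter_uniq// iota_uniq.
  - move=> k kr; rewrite mem_filter; case/mapP: (kr) => y yl kE.
    have [Jy by_] := inz _ (sub _ yl).
    rewrite kE (mem_set Jy) /= mem_index_iota /= -kE ltnS leq_bigmax_seq// andbT.
    apply: contraTneq yl => E'; rewrite -by_ -kE E' bx mem_cat negb_or.
    by rewrite xl1.
  move=> k; rewrite mem_filter => /andP[/andP[/set_mem Jk _] _].
  by rewrite pseudohyp_ge0 pseudohyp_le1//; [exact: bD Jk|rewrite -bx; exact: bD Jx].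
rewrite big_map big_seq [RHS]big_seq; apply: eq_bigr => y /sub/inz[_ ->] //.
Qed.

Lemma separated_pseudohyp N x y : x \in first_zeros I a N -> y \in first_zeros I a N ->
  y != x -> delta <= pseudohyp y x.
Proof.
move=> xN yN yx; have x1 := allP (first_zeros_disk N aD) _ xN.
have [l1 [l2 E]] : exists l1 l2, first_zeros I a N = l1 ++ x :: l2.
  by case/splitPr: xN => l1 l2; exists l1, l2.
apply: le_trans (separated_fblaschke E) _; rewrite cabs_fblaschke.
have yl : y \in l1 ++ l2.
  by move: yN; rewrite E !mem_cat inE (negbTE yx).
apply: (@le_trans _ _ (\prod_(t <- [:: y]) pseudohyp t x)); last by rewrite big_seq1.
apply: prod_subset_le => //.
- by have := separated_first_zeros_uniq N; rewrite E uniq_catC /= uniq_catC => /andP[].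
- by move=> t; rewrite inE => /eqP ->.
move=> t tl; rewrite pseudohyp_ge0 pseudohyp_le1//; apply: (allP (first_zeros_disk N aD)).
by move: tl; rewrite E !mem_cat inE => /orP[->//|->]; rewrite !orbT.
Qed.

(** The lower bound holds for every partial product that contains the zero
    and therefore passes to the limit. *)
Lemma cabs_derive1_ge (d : R) x z : 0 < d -> d <= delta -> cabs x < 1 ->
  (0 < zero_mult B x)%N -> cabs (z - x) <= d / 72 * (1 - cabs x) ->
  d / 36 / (1 - cabs x) <= cabs (derive1 B z).
Proof.
move=> d0 dd x1 m0 zx.
have [N0 HN0] := zero_multE lambda1 aD mS BE x1.
have xN N : (N0 <= N)%N -> exists l1 l2, first_zeros I a N = l1 ++ x :: l2.
  move=> /HN0 c; have : x \in first_zeros I a N by rewrite -has_pred1 has_count c.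
  by case/splitPr => l1 l2; exists l1, l2.
have dN N : (N0 <= N)%N -> d / 36 / (1 - cabs x) <= cabs (dfblaschke (first_zeros I a N) z).
  move=> /xN[l1 [l2 E]]; rewrite E; apply: (@cabs_dfblaschke_ge _ d (d / 72)) => //.
    by rewrite -E; exact: first_zeros_disk.
  by apply: le_trans dd _; exact: separated_fblaschke E.
have z1 : cabs z < 1.
  have [l1 [l2 E]] := xN N0 (leqnn _).
  have := le_trans dd (separated_fblaschke E).
  have := first_zeros_disk N0 aD; rewrite E all_cat /= => /and3P[h1 _ h2].
  have := @cabs_fblaschke_le1 _ (l1 ++ l2) x; rewrite all_cat h1 h2 => /(_ isT x1) h3 h4.
  have := cabsD x (z - x); rewrite addrC subrK; have := cabs_ge0 x; nra.
apply: (cvgn_cabs_ge (cvg_dfblaschke lambda1 aD mS BE z1)).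
by exists N0 => N /dN; rewrite cabsM lambda1 mul1r.
Qed.

End Zeros.
End Separated.

(** * Area estimates in the disk *)

Section Area.
Variable R : realType.

Notation mu := (@lebesgue_measure R).
Notation plane := (measurableTypeR R * measurableTypeR R)%type.
Notation area := (mu \x mu)%E.

(** Monotonicity of the integral of non-negative functions holds without
    measurability, because that integral is a supremum over simple minorants. *)
Lemma ge0_le_integral_any d (T : measurableType d) (m : {measure set T -> \bar R})
    (D : set T) (f g : T -> \bar R) :
  (forall x, D x -> 0 <= f x)%E -> (forall x, D x -> f x <= g x)%E ->
  (\int[m]_(x in D) f x <= \int[m]_(x in D) g x)%E.
Proof.
move=> f0 fg.
have g0 x : D x -> (0 <= g x)%E by move=> Dx; exact: le_trans (f0 x Dx) (fg x Dx).
have pos (h : T -> \bar R) : (forall x, D x -> 0 <= h x)%E ->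
    ((h \_ D)^\+ = h \_ D)%E /\ ((h \_ D)^\- = cst 0)%E.
  move=> h0; have h1 x : (0 <= (h \_ D) x)%E by exact: erestrict_ge0.
  by split; apply/funext => x;
    [apply: (ge0_funeposE (D := setT))|apply: (ge0_funenegE (D := setT))] => //; rewrite inE.
rewrite /integral; have [-> ->] := pos f f0; have [-> ->] := pos g g0.
apply: leeB => //; apply: ereal_sup_le => _ [h /= hf <-].
by exists h => //= x; apply: le_trans (hf x) _; exact: lee_restrict.
Qed.

Section Sets.
Context d (T : measurableType d).
Implicit Types f g : T -> R.

Lemma measurable_set_lt f g : measurable_fun setT f -> measurable_fun setT g ->
  measurable [set t | f t < g t].
Proof.
move=> mf mg; have := measurable_fun_ltr mf mg.
by move=> /(_ measurableT [set true] I); rewrite setTI.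
Qed.

Lemma measurable_set_le f g : measurable_fun setT f -> measurable_fun setT g ->
  measurable [set t | f t <= g t].
Proof.
move=> mf mg; have := measurable_fun_ler mf mg.
by move=> /(_ measurableT [set true] I); rewrite setTI.
Qed.

Lemma measurable_cabs f g : measurable_fun setT f -> measurable_fun setT g ->
  measurable_fun setT (fun t => cabs (f t +i* g t)%C).
Proof.
move=> mf mg; rewrite /ComplexField.Normc.normc.
apply: (@measurableT_comp _ _ _ _ _ _ (@Num.sqrt R)).
  by apply: continuous_measurable_fun; exact: sqrt_continuous.
by apply: measurable_funD; exact: measurable_funX.
Qed.

End Sets.

Lemma measurable_re : measurable_fun setT (fun q : plane => q.1 : R).
Proof. exact: measurable_fst. Qed.

Lemma measurable_im : measurable_fun setT (fun q : plane => q.2 : R).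
Proof. exact: measurable_snd. Qed.

Lemma measurable_modulus : measurable_fun setT (fun q : plane => cabs (q.1 +i* q.2)%C).
Proof. by apply: measurable_cabs; [exact: measurable_re|exact: measurable_im]. Qed.

Lemma measurable_denominator (a : R[i]) :
  measurable_fun setT (fun q : plane => cabs (1 - (a^*)%C * (q.1 +i* q.2)%C)).
Proof.
have [mr mi] := (measurable_re, measurable_im).
rewrite (_ : (fun _ => _) = fun q : plane =>
  cabs ((1 - (complex.Re a * q.1 + complex.Im a * q.2))
    +i* (complex.Im a * q.1 - complex.Re a * q.2))%C); last first.
  apply/funext => q; congr (cabs _); case: a => x y /=.
  by apply/eqP; rewrite eq_complex /=; apply/andP; split; apply/eqP; ring.
apply: measurable_cabs; apply: measurable_funB => //.
- by apply: measurable_funD; apply: measurable_funM.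
- exact: measurable_funM.
- exact: measurable_funM.
Qed.

Lemma measurable_unit_disk : measurable [set q : plane | unit_disk (q.1 +i* q.2)%C].
Proof. by apply: measurable_set_lt => //; exact: measurable_modulus. Qed.

Lemma lebesgue_centered_itv (c e : R) : 0 <= e -> mu `[c - e, c + e] = (2 * e)%:E.
Proof.
move=> e0; rewrite lebesgue_measure_itv /= lte_fin.
have [h|h] := ltP (c - e) (c + e); first by rewrite -EFinB; congr (_%:E); ring.
by congr (_%:E); lra.
Qed.

Lemma lebesgue_diameter_le (S : set (measurableTypeR R)) (e : R) : measurable S -> 0 <= e ->
  (forall x y, S x -> S y -> 0 <= x -> 0 <= y -> x - y <= e) ->
  (forall x y, S x -> S y -> x <= 0 -> y <= 0 -> x - y <= e) ->
  (mu S <= (4 * e)%:E)%E.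
Proof.
move=> mS e0 Sp Sn.
have half (P : set R) : (forall x y, P x -> P y -> x - y <= e) ->
    exists2 c : R, P `<=` `[c - e, c + e] & True.
  move=> Pe; have [[c Pc]|P0] := pselect (exists c, P c); last first.
    by exists 0 => // x Px; exfalso; apply: P0; exists x.
  exists c => // x Px; rewrite /= in_itv /=.
  by have := Pe _ _ Px Pc; have := Pe _ _ Pc Px; lra.
have [c1 S1 _] := half [set x | S x /\ 0 <= x] (fun x y => fun '(conj a b) '(conj a' b') => Sp x y a a' b b').
have [c2 S2 _] := half [set x | S x /\ x <= 0] (fun x y => fun '(conj a b) '(conj a' b') => Sn x y a a' b b').
have mi c := lebesgue_centered_itv c e0.
apply: (@le_trans _ _ (mu (`[c1 - e, c1 + e] `|` `[c2 - e, c2 + e]))).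
  apply: le_measure; rewrite ?inE//; first exact: measurableU.
  move=> x Sx; have [x0|/ltW x0] := leP 0 x; [left; exact: S1|right; exact: S2].
apply: le_trans; first by apply: measureU2; exact: measurable_itv.
have -> : (4 * e)%:E = ((2 * e)%:E + (2 * e)%:E)%E by rewrite -EFinD; congr (_%:E); ring.
by apply: leeD; [have := mi c1|have := mi c2] => /= ->.
Qed.

(** [h] is the distance to the circle; the set of [x] is a pair of pieces of
    length [O(h)] since the circle of radius about 1 is transversal to the
    direction of [x] where [|y| <= |x|]. *)
Lemma annulus_section_le (S : set (measurableTypeR R)) (h y : R) : 0 < h <= 1 ->
  measurable S ->
  (forall x, S x -> (1 - h) ^+ 2 <= x ^+ 2 + y ^+ 2 < (1 - h / 2) ^+ 2) ->
  (forall x, S x -> y ^+ 2 <= x ^+ 2) ->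
  (mu S <= (8 * h)%:E)%E.
Proof.
move=> /andP[h0 h1] mS Sa Sy.
have key x x' : (1 - h) ^+ 2 <= x' ^+ 2 + y ^+ 2 -> x ^+ 2 + y ^+ 2 < (1 - h / 2) ^+ 2 ->
    y ^+ 2 <= x ^+ 2 -> y ^+ 2 <= x' ^+ 2 -> (1 - h) ^+ 2 <= x ^+ 2 + y ^+ 2 ->
    0 <= x -> 0 <= x' -> x - x' <= 2 * h.
  move=> A1 A2 A3 A4 A5 x0 x'0; rewrite leNgt; apply/negP => H.
  have [hl|hg] := leP h 2^-1; last first.
    have : x < 1 by rewrite ltNge; apply/negP => x1; nra.
    lra.
  have : 2^-1 <= x + x' by rewrite leNgt; apply/negP => x1; nra.
  nra.
rewrite (_ : 8 * h = 4 * (2 * h)); last by ring.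
apply: lebesgue_diameter_le => //.
- by rewrite mulr_ge0 ?ltW.
- move=> x x' Sx Sx' x0 x'0.
  have /andP[? ?] := Sa _ Sx; have /andP[? ?] := Sa _ Sx'; have ? := Sy _ Sx; have ? := Sy _ Sx'.
  exact: key.
move=> x x' Sx Sx' x0 x'0.
have /andP[? ?] := Sa _ Sx; have /andP[? ?] := Sa _ Sx'; have ? := Sy _ Sx; have ? := Sy _ Sx'.
rewrite (_ : x - x' = - x' - - x); last by ring.
by apply: key; rewrite ?sqrrN// oppr_ge0.
Qed.

Lemma integral_section_le (F : R -> \bar R) (c t K : R) : 0 <= t -> 0 <= K ->
  (forall x, 0 <= F x <= K%:E)%E -> (forall x, t < `|x - c| -> F x = 0%E) ->
  (\int[mu]_x F x <= (2 * t * K)%:E)%E.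
Proof.
move=> t0 K0 FK F0.
pose J : set R := `[c - t, c + t]%classic.
apply: (@le_trans _ _ (\int[mu]_x ((cst K%:E \_ J) x))%E).
  apply: ge0_le_integral_any; first by move=> x _; case/andP: (FK x).
  move=> x _; rewrite patchE; case: ifPn => [_|]; first by case/andP: (FK x).
  move=> /negP xn; rewrite F0// ltNge; apply/negP => xc; apply: xn.
  by apply/mem_set; rewrite /J /= in_itv /=; move: xc; rewrite ler_norml; lra.
rewrite -integral_mkcond integral_cst//; last exact: measurable_itv.
rewrite [X in (_ * X)%E](_ : _ = (2 * t)%:E); last exact: lebesgue_centered_itv.
by rewrite -EFinM lee_fin mulrC.
Qed.

Definition annulus (h : R) : set plane :=
  [set q | h / 2 < 1 - cabs (q.1 +i* q.2)%C <= h].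

Lemma measurable_annulus h : measurable (annulus h).
Proof.
rewrite (_ : annulus h = [set q : plane | h / 2 < 1 - cabs (q.1 +i* q.2)%C] `&`
  [set q : plane | 1 - cabs (q.1 +i* q.2)%C <= h]).
  by apply: measurableI; [apply: measurable_set_lt|apply: measurable_set_le] => //;
    apply: measurable_funB => //; exact: measurable_modulus.
by apply/seteqP; split=> q /=; rewrite /annulus /=; [case/andP|case=> -> ->].
Qed.

Lemma annulus_sqr h q : 0 < h <= 1 -> annulus h q ->
  (1 - h) ^+ 2 <= q.1 ^+ 2 + q.2 ^+ 2 < (1 - h / 2) ^+ 2.
Proof.
move=> /andP[h0 h1] /andP[A1 A2]; rewrite -cabs_sqr; have := cabs_ge0 (q.1 +i* q.2)%C.
by move=> c0; apply/andP; split; nra.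
Qed.

(** Where [|x| <= |y|], the sections in the direction of [y] are short; only
    those with [x] within [t] of [c] are not empty. *)
Lemma area_sector1_le (A : set plane) (h t c : R) : 0 < h <= 1 -> 0 <= t ->
  measurable A -> A `<=` annulus h ->
  (forall q, A q -> q.1 ^+ 2 <= q.2 ^+ 2 /\ `|q.1 - c| <= t) ->
  (area A <= (16 * h * t)%:E)%E.
Proof.
move=> /[dup] h01 /andP[h0 h1] t0 mA Ah At.
rewrite (_ : 16 * h * t = 2 * t * (8 * h)); last by ring.
have mS x := measurable_xsection x mA.
apply: (@integral_section_le _ c t) => //; first by rewrite mulr_ge0// ltW.
  move=> x; rewrite measure_ge0 /=; apply: (@annulus_section_le _ h x) => // y.
    by rewrite /xsection /= inE => /Ah/(annulus_sqr h01) /=; rewrite (addrC (y ^+ 2)).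
  by rewrite /xsection /= inE => /At[].
move=> x tx /=; rewrite (_ : xsection A x = set0) ?measure0//.
apply/seteqP; split=> // y; rewrite /xsection /= inE => /At[_ /=].
by rewrite leNgt tx.
Qed.

(** The symmetric half, by exchanging the order of integration. *)
Lemma area_sector2_le (A : set plane) (h t c : R) : 0 < h <= 1 -> 0 <= t ->
  measurable A -> A `<=` annulus h ->
  (forall q, A q -> q.2 ^+ 2 <= q.1 ^+ 2 /\ `|q.2 - c| <= t) ->
  (area A <= (16 * h * t)%:E)%E.
Proof.
move=> /[dup] h01 /andP[h0 h1] t0 mA Ah At.
rewrite (_ : 16 * h * t = 2 * t * (8 * h)); last by ring.
have -> : area A = (mu \x^ mu)%E A.
  by apply: product_measure_unique => //= ? ? ? ?; rewrite product_measure2E.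
have mS x := measurable_ysection x mA.
apply: (@integral_section_le _ c t) => //; first by rewrite mulr_ge0// ltW.
  move=> y; rewrite measure_ge0 /=; apply: (@annulus_section_le _ h y) => // x.
    by rewrite /ysection /= inE => /Ah/(annulus_sqr h01) /=.
  by rewrite /ysection /= inE => /At[].
move=> y ty /=; rewrite (_ : ysection A y = set0) ?measure0//.
apply/seteqP; split=> // x; rewrite /ysection /= inE => /At[_ /=].
by rewrite leNgt ty.
Qed.

Lemma area_annulus_ball_le (A : set plane) (h t : R) (u : R[i]) : 0 < h <= 1 -> 0 <= t ->
  measurable A -> A `<=` annulus h ->
  (forall q, A q -> cabs ((q.1 +i* q.2)%C - u) <= t) ->
  (area A <= (32 * h * t)%:E)%E.
Proof.
move=> h01 t0 mA Ah At.
have mr2 : measurable_fun setT (fun q : plane => (q.1 : R) ^+ 2).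
  by apply: measurable_funX; exact: measurable_re.
have mi2 : measurable_fun setT (fun q : plane => (q.2 : R) ^+ 2).
  by apply: measurable_funX; exact: measurable_im.
pose A1 := A `&` [set q : plane | q.1 ^+ 2 <= q.2 ^+ 2].
pose A2 := A `&` [set q : plane | q.2 ^+ 2 <= q.1 ^+ 2].
have mA1 : measurable A1 by apply: measurableI => //; exact: measurable_set_le.
have mA2 : measurable A2 by apply: measurableI => //; exact: measurable_set_le.
apply: (@le_trans _ _ (area (A1 `|` A2))).
  apply: le_measure; rewrite ?inE//; first exact: measurableU.
  by move=> q Aq; have [qle|/ltW qle] := leP (q.1 ^+ 2) (q.2 ^+ 2); [left|right].
apply: le_trans (measureU2 _ mA1 mA2) _.
rewrite (_ : 32 * h * t = 16 * h * t + 16 * h * t); last by ring.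
rewrite EFinD; apply: leeD.
- apply: (@area_sector1_le _ _ _ (complex.Re u)) => //; first by move=> q [/Ah].
  move=> q [/At qt q12]; split=> //; apply: le_trans qt.
  by apply: le_trans (cabs_Re_le _); rewrite raddfB.
- apply: (@area_sector2_le _ _ _ (complex.Im u)) => //; first by move=> q [/Ah].
  move=> q [/At qt q12]; split=> //; apply: le_trans qt.
  by apply: le_trans (cabs_Im_le _); rewrite raddfB.
Qed.

Definition annulus_cap (a : R[i]) (h t : R) : set plane :=
  annulus h `&` [set q : plane | cabs (1 - (a^*)%C * (q.1 +i* q.2)%C) < t].

Lemma measurable_annulus_cap a h t : measurable (annulus_cap a h t).
Proof.
apply: measurableI; first exact: measurable_annulus.
by apply: measurable_set_lt => //; exact: measurable_denominator.
Qed.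

(** [|1 - a^* z| < t] confines [z] to a disk of radius [O(t)] about the radial
    projection of [a] to the circle. *)
Lemma area_annulus_cap_le (a : R[i]) (h t : R) : 0 < h <= 1 -> 0 <= t -> cabs a < 1 ->
  (area (annulus_cap a h t) <= (64 * h * t)%:E)%E.
Proof.
move=> /[dup] h01 /andP[h0 h1] t0 a1.
have [u u1 au] : exists2 u : R[i], cabs u = 1 & a = (cabs a)%:C%C * u.
  have [->|a0] := eqVneq a 0; first by exists 1; rewrite ?cabs1// cabs0 mul0r.
  have c0 : (cabs a)%:C%C != 0 by rewrite -cabs_gt0 cabs_real normr_gt0 cabs_eq0.
  exists (a / (cabs a)%:C%C); last by rewrite mulrC divfK.
  by rewrite cabsM cabsV cabs_real ger0_norm ?cabs_ge0// divff// cabs_eq0.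
rewrite (_ : 64 * h * t = 32 * h * (2 * t)); last by ring.
apply: (@area_annulus_ball_le _ _ _ u) => //.
- by rewrite mulr_ge0.
- exact: measurable_annulus_cap.
- by move=> q [].
move=> [x y] [/andP[/= A1 _] /=]; set z := (x +i* y)%C in A1 *; set v := 1 - _ => vt.
have z1 : cabs z < 1 by rewrite -subr_gt0; apply: lt_trans A1; rewrite divr_gt0.
have E : z - u = - (u * v) + (1 - cabs a)%:C%C * z.
  have uu : u * (u^*)%C = 1 by rewrite -cabs_sqrC u1 expr1n.
  have ua : u * (a^*)%C = (cabs a)%:C%C.
    have -> : (a^*)%C = (cabs a)%:C%C * (u^*)%C.
      by rewrite {1}au rmorphM; congr (_ * _); exact: conjc_real.
    by rewrite mulrCA uu mulr1.
  by rewrite /v mulrBr mulr1 mulrA ua rmorphB rmorph1; ring.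
rewrite E; apply: le_trans (cabsD _ _) _; rewrite cabsN !cabsM u1 mul1r cabs_real.
have := cabs_1Mconj_ger a1 z1; rewrite -/v => av.
rewrite ger0_norm ?subr_ge0 ?ltW//.
have : (1 - cabs a) * cabs z <= 1 - cabs a by rewrite ler_piMr ?subr_ge0 ?ltW.
lra.
Qed.

End Area.

(** * The integral of the kernel against a radial weight *)

Section Kernel.
Variable R : realType.

Notation mu := (@lebesgue_measure R).
Notation plane := (measurableTypeR R * measurableTypeR R)%type.
Notation area := (mu \x mu)%E.

Definition dyad (k : nat) : R := 2^-1 ^+ k.

Lemma dyad_gt0 k : 0 < dyad k.
Proof. by rewrite exprn_gt0. Qed.

Lemma dyad_le1 k : dyad k <= 1.
Proof. by apply: exprn_ile1 => //; rewrite invf_le1// ler1n. Qed.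

Lemma dyadS k : dyad k.+1 = dyad k / 2.
Proof. by rewrite /dyad exprSr. Qed.

Lemma dyad_le k l : (k <= l)%N -> dyad l <= dyad k.
Proof.
move=> kl; rewrite -(subnKC kl) /dyad exprD ler_piMr// ?exprn_ge0//.
exact: dyad_le1.
Qed.

Lemma dyad_scale (v : R) n : dyad n < v < 2 -> exists2 j, (j <= n)%N & dyad j <= v < 2 * dyad j.
Proof.
move=> /andP[nv v2]; elim: n nv => [|n IH] nv.
  by exists 0%N => //; rewrite (ltW nv) /dyad expr0 mulr1.
have [/IH[j jn jv]|nv'] := ltP (dyad n) v; first by exists j => //; exact: leqW.
have [->|] := eqVneq v (dyad n).
  by exists n => //; rewrite lexx/= mulr_natl mulr2n ltrDl dyad_gt0.
move=> vn; exists n.+1 => //; rewrite (ltW nv) dyadS mulrC divfK//.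
by rewrite lt_neqAle vn.
Qed.

Lemma dyad_small (v : R) : 0 < v -> exists n, dyad n < v.
Proof.
move=> v0; exists (Num.trunc v^-1).+1.
rewrite /dyad exprVn -[ltRHS]invrK ltf_pV2 ?posrE ?invr_gt0 ?exprn_gt0//.
apply: lt_trans (truncnS_gt _) _; rewrite -natrX ltr_nat; exact: ltn_expl.
Qed.

Lemma dyad_annulus (v : R) : 0 < v <= 1 -> exists k, dyad k / 2 < v <= dyad k.
Proof.
move=> /andP[v0 v1]; have [n nv] := dyad_small v0.
have exk : exists k, dyad k.+1 < v.
  by exists n; apply: le_lt_trans nv; exact: dyad_le.
case: (ex_minnP exk) => k; rewrite dyadS => kv kmin; exists k; rewrite kv /=.
case: k kv kmin => [|k] kv kmin; first by rewrite /dyad expr0.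
by rewrite leNgt; apply/negP => /kmin; rewrite ltnn.
Qed.

(** The ratio of the geometric sum over the scales [j]: the kernel contributes
    [2^(2 q j)] and the area [2^-j]. *)
Definition kernel_ratio (q : R) : R := 2 `^ (2 * q - 1).

Variables (q : R) (a : R[i]) (m : nat).
Hypothesis q_gt : 2^-1 < q.
Hypothesis a1 : cabs a < 1.

Notation X := (kernel_ratio q).
Notation Y := (2 `^ (2 * q)).

Lemma kernel_ratio_gt1 : 1 < X.
Proof.
rewrite /kernel_ratio /powR pnatr_eq0 /= expR_gt1 mulr_gt0 ?ln_gt0 ?ltr1n//.
by move: q_gt; lra.
Qed.

Let YE : Y = 2 * X.
Proof. by rewrite /kernel_ratio powRB ?pnatr_eq0 ?implybT// powRr1// [RHS]mulrC divfK// pnatr_eq0. Qed.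

Let Y0 : 0 < Y. Proof. exact: powR_gt0. Qed.

(** Layer-cake majorant of the kernel: on the [k]-th annulus only the scales
    [j <= min k m + 1] occur, as [1 - |a^* z|] is at least [max (1 - |a|) (1 - |z|)]. *)
Definition kernel_layer (c : nat -> R) k (z : plane) : R :=
  \sum_(j < (minn k m).+2) c k * Y ^+ j * \1_(annulus_cap a (dyad k) (2 * dyad j)) z.

Definition kernel_majorant (c : nat -> R) (z : plane) : \bar R :=
  (\sum_(k <oo) (kernel_layer c k z)%:E)%E.

Section Majorant.
Variable c : nat -> R.
Hypothesis c0 : forall k, 0 <= c k.

Let term_ge0 k j z : 0 <= c k * Y ^+ j * \1_(annulus_cap a (dyad k) (2 * dyad j)) z.
Proof. by rewrite !mulr_ge0 ?exprn_ge0 ?(ltW Y0)// indicE. Qed.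

Lemma kernel_layer_ge0 k z : 0 <= kernel_layer c k z.
Proof. by apply: sumr_ge0 => j _; exact: term_ge0. Qed.

Lemma kernel_majorant_ge0 z : (0 <= kernel_majorant c z)%E.
Proof. by apply: nneseries_ge0 => k _ _; rewrite lee_fin kernel_layer_ge0. Qed.

Let measurable_term k j (D : set plane) :
  measurable_fun D (fun z => c k * Y ^+ j * \1_(annulus_cap a (dyad k) (2 * dyad j)) z).
Proof.
by apply: measurable_funM => //; apply: measurable_indic; exact: measurable_annulus_cap.
Qed.

Lemma measurable_kernel_layer k (D : set plane) : measurable_fun D (kernel_layer c k).
Proof. by apply: measurable_sum => j; exact: measurable_term. Qed.

Lemma measurable_kernel_majorant (D : set plane) : measurable_fun D (kernel_majorant c).
Proof.
apply: ge0_emeasurable_sum => k; first by move=> z _ _; rewrite lee_fin kernel_layer_ge0.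
by move=> _; apply/measurable_EFinP; exact: measurable_kernel_layer.
Qed.

Lemma kernel_majorant_ge k z : dyad m / 2 < 1 - cabs a -> annulus (dyad k) z ->
  ((c k * (cabs (1 - (a^*)%C * (z.1 +i* z.2)%C))^-1 `^ (2 * q))%:E <= kernel_majorant c z)%E.
Proof.
move=> ma zk; case/andP: (zk) => zk1 zk2.
set v := cabs _.
have z1 : cabs (z.1 +i* z.2)%C < 1.
  by rewrite -subr_gt0; apply: lt_trans zk1; rewrite divr_gt0// dyad_gt0.
have v0 : 0 < v by exact: cabs_1Mconj_gt0.
have [j jn /andP[jv vj]] : exists2 j, (j <= (minn k m).+1)%N & dyad j <= v < 2 * dyad j.
  apply: dyad_scale; apply/andP; split; last first.
    apply: le_lt_trans (cabsB _ _) _; rewrite cabs1 cabsM cabs_conj.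
    by rewrite ltrD2l; apply: mulr_ilt1; rewrite ?cabs_ge0.
  rewrite dyadS; have [km|mk] := leqP k m.
    exact: lt_le_trans zk1 (cabs_1Mconj_gel a1 z1).
  exact: lt_le_trans ma (cabs_1Mconj_ger a1 z1).
apply: (@le_trans _ _ (kernel_layer c k z)%:E); last first.
  apply: le_trans (nneseries_lim_ge (m := 0) k.+1 _); last first.
    by move=> n _ _; rewrite lee_fin kernel_layer_ge0.
  rewrite big_nat_recr//= leeDr//; apply: sume_ge0 => i _.
  by rewrite lee_fin kernel_layer_ge0.
rewrite lee_fin /kernel_layer.
rewrite (bigD1 (Ordinal (jn : (j < (minn k m).+2)%N)))//= ler_wpDr//.
  by apply: sumr_ge0 => i _; exact: term_ge0.
rewrite indicE mem_set ?mulr1; last by split.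
apply: ler_wpM2l => //.
have -> : Y ^+ j = (2 ^+ j) `^ (2 * q).
  by rewrite -(powR_mulrn j (powR_ge0 _ _)) -(powR_mulrn j (ler0n R 2)) -!powRrM [in RHS]mulrC.
apply: ge0_ler_powR; rewrite ?nnegrE ?invr_ge0 ?exprn_ge0 ?(ltW v0)//.
  by rewrite mulr_ge0//; apply: le_trans (ltW q_gt).
by rewrite -[leRHS]invrK lef_pV2 ?posrE ?invr_gt0 ?exprn_gt0// -exprVn.
Qed.

(** As the ratio exceeds 1, the sum over the scales is dominated by its last
    term, [j = min k m + 1]. *)
Lemma integral_kernel_layer_le k (D : set plane) : measurable D ->
  (\int[area]_(z in D) (kernel_layer c k z)%:E <=
   (128 * X ^+ 2 / (X - 1) * (c k * dyad k * X ^+ minn k m))%:E)%E.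
Proof.
move=> mD; have X1 := kernel_ratio_gt1.
under eq_integral do rewrite /kernel_layer -sumEFin.
rewrite ge0_integral_sum//; last 2 first.
- by move=> j; apply/measurable_EFinP; exact: measurable_term.
- by move=> j z _; rewrite lee_fin term_ge0.
apply: (@le_trans _ _ (\sum_(j < (minn k m).+2) (128 * c k * dyad k * X ^+ j)%:E)%E).
  apply: lee_sum => j _.
  rewrite (@integralZl_indic _ _ _ _ _ mD (fun=> annulus_cap a (dyad k) (2 * dyad j))); last 2 first.
  - by rewrite ltNge mulr_ge0// exprn_ge0// ltW.
  - exact: measurable_annulus_cap.
  rewrite integral_indic//; last exact: measurable_annulus_cap.
  have cY : 0 <= c k * Y ^+ j by rewrite mulr_ge0// exprn_ge0// ltW.
  apply: (@le_trans _ _ ((c k * Y ^+ j)%:E * (64 * dyad k * (2 * dyad j))%:E)%E).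
    apply: lee_wpmul2l; first by rewrite lee_fin.
    apply: le_trans (area_annulus_cap_le _ _ a1); rewrite ?dyad_gt0 ?dyad_le1//.
      apply: le_measure; rewrite ?inE//; last exact: measurable_annulus_cap.
      by apply: measurableI => //; exact: measurable_annulus_cap.
    by rewrite mulr_ge0// ltW// dyad_gt0.
  rewrite -EFinM lee_fin le_eqVlt; apply/orP; left; apply/eqP.
  have e : 2 ^+ j * dyad j = 1 by rewrite /dyad -exprMn divff ?pnatr_eq0// expr1n.
  rewrite YE exprMn; transitivity (128 * c k * dyad k * X ^+ j * (2 ^+ j * dyad j)); first ring.
  by rewrite e mulr1.
rewrite sumEFin lee_fin -mulr_sumr.
have -> : \sum_(j < (minn k m).+2) X ^+ j = (X ^+ (minn k m).+2 - 1) / (X - 1).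
  by rewrite subrX1 mulrAC divff ?mul1r// subr_eq0 gt_eqF.
have P0 : 0 <= 128 * c k * dyad k by rewrite !mulr_ge0// ltW// dyad_gt0.
have i0 : 0 <= (X - 1)^-1 by rewrite invr_ge0 subr_ge0 ltW.
rewrite (_ : 128 * X ^+ 2 / (X - 1) * _ = 128 * c k * dyad k * (X ^+ (minn k m).+2 / (X - 1))).
  apply: ler_wpM2l => //; apply: ler_wpM2r => //; by rewrite gerBl.
rewrite [X ^+ (minn k m).+2]exprS [X ^+ (minn k m).+1]exprS; ring.
Qed.

Lemma integral_kernel_majorant_le (D : set plane) : measurable D ->
  (\int[area]_(z in D) kernel_majorant c z <=
   \sum_(k <oo) (128 * X ^+ 2 / (X - 1) * (c k * dyad k * X ^+ minn k m))%:E)%E.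
Proof.
move=> mD; rewrite integral_nneseries//; last 2 first.
- by move=> k; apply/measurable_EFinP; exact: measurable_kernel_layer.
- by move=> k z _; rewrite lee_fin kernel_layer_ge0.
apply: lee_nneseries => k *; first by apply: integral_ge0 => z _; rewrite lee_fin kernel_layer_ge0.
exact: integral_kernel_layer_le.
Qed.

End Majorant.
End Kernel.

(** * Normal weights *)

Section Weights.
Variable R : realType.
Implicit Types (w F : R -> R) (a b x y r : R).

Notation L x := (ln ((1 - x)^-1)).

(** Points on different sides of [r] are compared through the value at [r],
    and points below [r] through the bounds [m] and [M]. *)
Lemma quasi_nondecreasing F r (k m M : R) : 1 <= k -> 0 < m ->
  0 <= r -> (forall x, 0 <= x <= r -> m <= F x <= M) ->
  (forall x y, r <= x -> x <= y -> y < 1 -> F x <= k * F y) -> r < 1 ->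
  exists2 C, 0 < C & forall x y, 0 <= x -> x <= y -> y < 1 -> F x <= C * F y.
Proof.
move=> k1 m0 r0 Fb Fk r1.
have /andP[mr rM] : m <= F r <= M by apply: Fb; rewrite r0 lexx.
have mM := le_trans mr rM; have M0 := lt_le_trans m0 mM.
have k0 : 0 < k := lt_le_trans ltr01 k1.
have Mm : 1 <= M / m by rewrite ler_pdivlMr// mul1r.
have kMm : k <= k * (M / m) by rewrite ler_peMr// ltW.
have Fpos y : r <= y -> y < 1 -> 0 <= F y.
  move=> ry y1; have := le_trans mr (Fk r y (lexx _) ry y1).
  by move=> /(lt_le_trans m0); rewrite pmulr_rgt0// => /ltW.
have low x y : 0 <= x -> x <= r -> m <= F y -> F x <= M / m * F y.
  move=> x0 xr my; apply: (@le_trans _ _ M); first by case/andP: (Fb x (introT andP (conj x0 xr))).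
  by rewrite mulrAC ler_pdivlMr// ler_wpM2l// ltW.
exists (k * (M / m)); first by rewrite mulr_gt0// divr_gt0.
move=> x y x0 xy y1; have [yr|ry] := leP y r.
  have /andP[my _] := Fb y (introT andP (conj (le_trans x0 xy) yr)).
  apply: le_trans (low x y x0 (le_trans xy yr) my) _.
  by rewrite ler_wpM2r ?(le_trans (ltW m0) my)// ler_peMl// divr_ge0// ltW.
have Fy := Fpos y (ltW ry) y1; have [xr|rx] := leP x r.
  apply: le_trans (low x r x0 xr mr) _.
  rewrite [leRHS](_ : _ = M / m * (k * F y)); last by ring.
  apply: ler_wpM2l; first by rewrite divr_ge0// ltW.
  by apply: Fk => //; exact: ltW.
apply: le_trans (Fk x y (ltW rx) xy y1) _; exact: ler_wpM2r.
Qed.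

Lemma quasi_nonincreasing F r (m M : R) : 0 < m ->
  0 <= r -> (forall x, 0 <= x <= r -> m <= F x <= M) ->
  (forall x y, r <= x -> x <= y -> y < 1 -> F y <= F x) ->
  (forall x, 0 <= x < 1 -> 0 <= F x) -> r < 1 ->
  exists2 C, 0 < C & forall x y, 0 <= x -> x <= y -> y < 1 -> F y <= C * F x.
Proof.
move=> m0 r0 Fb Fk Fpos r1.
have /andP[mr rM] : m <= F r <= M by apply: Fb; rewrite r0 lexx.
have mM := le_trans mr rM; have M0 := lt_le_trans m0 mM.
have Mm : 1 <= M / m by rewrite ler_pdivlMr// mul1r.
have low x y : F y <= M -> m <= F x -> F y <= M / m * F x.
  move=> yM mx; apply: le_trans yM _.
  by rewrite mulrAC ler_pdivlMr// ler_wpM2l// ltW.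
exists (M / m); first by rewrite divr_gt0.
move=> x y x0 xy y1; have [yr|ry] := leP y r.
  have /andP[mx _] := Fb x (introT andP (conj x0 (le_trans xy yr))).
  have /andP[_ yM] := Fb y (introT andP (conj (le_trans x0 xy) yr)).
  exact: low.
have [xr|rx] := leP x r.
  have /andP[mx _] := Fb x (introT andP (conj x0 xr)).
  by apply: low => //; apply: le_trans rM; apply: Fk => //; exact: ltW.
apply: le_trans (Fk x y (ltW rx) xy y1) _; apply: ler_peMl => //.
by apply: Fpos; rewrite x0 (le_lt_trans xy y1).
Qed.

Lemma one_powR a : 1 `^ a = 1 :> R.
Proof. by rewrite powR1. Qed.

Lemma powR_bounds a (e : R) : 0 < e <= 1 ->
  exists lo hi : R, 0 < lo /\ forall t, e <= t <= 1 -> lo <= t `^ a <= hi.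
Proof.
move=> /andP[e0 e1].
exists (Num.min 1 (e `^ a)), (Num.max 1 (e `^ a)); split.
  by rewrite lt_min ltr01 powR_gt0.
move=> t /andP[et t1]; have t0 := lt_le_trans e0 et.
rewrite ge_min le_max; have [a0|a0] := leP 0 a.
  apply/andP; split; apply/orP; [right|left].
    by apply: ge0_ler_powR; rewrite ?nnegrE// ltW.
  by rewrite -[leRHS](one_powR a); apply: ge0_ler_powR; rewrite ?nnegrE// ltW.
have inv s : s `^ a = (s `^ (- a))^-1 by rewrite powRN invrK.
have a0' : 0 <= - a by rewrite oppr_ge0 ltW.
rewrite !inv; apply/andP; split; apply/orP; [left|right].
  rewrite invf_ge1 ?powR_gt0// -[leRHS](one_powR (- a)).
  by apply: ge0_ler_powR; rewrite ?nnegrE// ltW.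
rewrite lef_pV2 ?posrE ?powR_gt0//.
by apply: ge0_ler_powR; rewrite ?nnegrE// ltW.
Qed.

Lemma L_ge0 x : 0 <= x < 1 -> 0 <= L x.
Proof.
move=> /andP[x0 x1]; apply: ln_ge0; rewrite invf_ge1 ?subr_gt0//.
by rewrite lerBlDr lerDl.
Qed.

Lemma L_le x y : x <= y -> y < 1 -> L x <= L y.
Proof.
move=> xy y1; have x1 := le_lt_trans xy y1.
rewrite ler_ln ?posrE ?invr_gt0 ?subr_gt0// lef_pV2 ?posrE ?subr_gt0//.
by rewrite lerD2l lerN2.
Qed.

Section Weight.
Variable w : R -> R.
Hypothesis w_bounded : bounded_on_compacts w.
Hypothesis w_ge0 : forall r, r \in `[0, 1[ -> 0 <= w r.

Lemma weight_quotient_bounds a r : 0 < r < 1 ->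
  exists m M : R, 0 < m /\ forall x, 0 <= x <= r -> m <= w x / (1 - x) `^ a <= M.
Proof.
move=> /andP[r0 r1]; have [|m [M [m0 wb]]] := w_bounded (r := r); first by rewrite in_itv /= r0.
have [|lo [hi [lo0 pb]]] := @powR_bounds a (1 - r); first by rewrite subr_gt0 r1 gerBl ltW.
have hi0 : 0 < hi.
  by have /andP[h1 h2] := pb 1 ltac:(by rewrite lexx gerBl ltW); apply: lt_le_trans lo0 (le_trans h1 h2).
exists (m / hi), (M / lo); split; first by rewrite divr_gt0.
move=> x /andP[x0 xr].
have /andP[wm wM] : m <= w x <= M by apply: wb; rewrite in_itv /= x0.
have /andP[p1 p2] : lo <= (1 - x) `^ a <= hi by apply: pb; rewrite lerD2l lerN2 xr gerBl.
have p0 := lt_le_trans lo0 p1; have w0 := lt_le_trans m0 wm.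
apply/andP; split; apply: ler_pM; rewrite ?invr_ge0 ?(ltW m0) ?(ltW w0) ?(ltW hi0) ?(ltW p0)//;
  by rewrite lef_pV2.
Qed.

Lemma weight_up a r0 : r0 \in `]0, 1[ -> incr_to_infty w a r0 ->
  exists2 C, 0 < C & forall x y, 0 <= x -> x <= y -> y < 1 ->
    w x / (1 - x) `^ a <= C * (w y / (1 - y) `^ a).
Proof.
rewrite in_itv /= => /andP[r00 r01] [inc _]; pose r := (r0 + 1) / 2.
have r1 : 0 < r < 1 by rewrite /r; apply/andP; split; lra.
have rr : r0 < r by rewrite /r; lra.
have [m [M [m0 mM]]] := weight_quotient_bounds a r1; case/andP: r1 => r0' r1.
apply: (@quasi_nondecreasing (fun x => w x / (1 - x) `^ a) r 1 m M) => //; first exact: ltW.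
move=> x y rx xy y1; rewrite mul1r; apply: inc => //; rewrite in_itv /=; lra.
Qed.

Lemma weight_down b r0 : r0 \in `]0, 1[ -> decr_to_zero w b r0 ->
  exists2 C, 0 < C & forall x y, 0 <= x -> x <= y -> y < 1 ->
    w y / (1 - y) `^ b <= C * (w x / (1 - x) `^ b).
Proof.
rewrite in_itv /= => /andP[r00 r01] [dec _]; pose r := (r0 + 1) / 2.
have r1 : 0 < r < 1 by rewrite /r; apply/andP; split; lra.
have rr : r0 < r by rewrite /r; lra.
have [m [M [m0 mM]]] := weight_quotient_bounds b r1; case/andP: r1 => r0' r1.
apply: (@quasi_nonincreasing (fun x => w x / (1 - x) `^ b) r m M) => //; first exact: ltW.
  move=> x y rx xy y1; apply: dec => //; rewrite in_itv /=; lra.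
by move=> x x01; rewrite divr_ge0 ?powR_ge0// w_ge0// in_itv.
Qed.

(** Replacing [L] by [1 + L] changes nothing near 1 and makes the logarithmic
    factor bounded below near 0. *)
Lemma weight_log_up a al r0 : 0 < al -> r0 \in `]0, 1[ ->
  {in `]r0, 1[ &, {homo (fun r => w r / (1 - r) `^ a * L r `^ al) : x y / x <= y}} ->
  exists2 C, 0 < C & forall x y, 0 <= x -> x <= y -> y < 1 ->
    w x / (1 - x) `^ a * (1 + L x) `^ al <= C * (w y / (1 - y) `^ a * (1 + L y) `^ al).
Proof.
rewrite in_itv /= => al0 /andP[r00 r01] inc; pose r := (r0 + 1) / 2.
have r1 : 0 < r < 1 by rewrite /r; apply/andP; split; lra.
have rr : r0 < r by rewrite /r; lra.
have [m [M [m0 mM]]] := weight_quotient_bounds a r1; case/andP: r1 => r0' r1.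
have Lr : 0 < L r by apply: ln_gt0; rewrite invf_gt1 ?subr_gt0// gtrBl.
pose k := ((1 + L r) / L r) `^ al.
have k1 : 1 <= k.
  rewrite -[leLHS](one_powR al); apply: ge0_ler_powR; rewrite ?nnegrE ?(ltW al0)//.
    by rewrite divr_ge0// ?addr_ge0// ltW.
  by rewrite ler_pdivlMr// mul1r lerDr.
apply: (@quasi_nondecreasing _ r k m (M * (1 + L r) `^ al)) => //; first exact: ltW.
  move=> x /andP[x0 xr]; have /andP[h1 h2] := mM x (introT andP (conj x0 xr)).
  have x1 := le_lt_trans xr r1.
  have Lx : 0 <= L x by apply: L_ge0; rewrite x0.
  have g1 : 1 <= (1 + L x) `^ al.
    rewrite -[leLHS](one_powR al); apply: ge0_ler_powR; rewrite ?nnegrE ?(ltW al0)// ?addr_ge0//.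
    by rewrite lerDl.
  have h0 := lt_le_trans m0 h1.
  apply/andP; split; first by apply: le_trans h1 _; rewrite ler_peMr// ltW.
  apply: ler_pM; rewrite ?(ltW h0) ?powR_ge0//.
  apply: ge0_ler_powR; rewrite ?nnegrE ?(ltW al0)// ?addr_ge0// ?(ltW Lr)//.
  by rewrite lerD2l L_le.
move=> x y rx xy y1; have x1 := le_lt_trans xy y1.
have Lx : 0 < L x := lt_le_trans Lr (L_le rx x1).
have Ly : 0 < L y := lt_le_trans Lx (L_le xy y1).
have w0 z : r <= z -> z < 1 -> 0 <= w z / (1 - z) `^ a.
  by move=> rz z1; rewrite divr_ge0 ?powR_ge0// w_ge0// in_itv /=; lra.
apply: (@le_trans _ _ (k * (w x / (1 - x) `^ a * L x `^ al))).
  rewrite mulrCA; apply: ler_wpM2l; first exact: w0.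
  rewrite /k -powRM; [|by rewrite divr_ge0 ?addr_ge0 ?ltW|exact: ltW].
  apply: ge0_ler_powR; rewrite ?nnegrE ?(ltW al0)// ?addr_ge0// ?(ltW Lx)//.
    by rewrite mulr_ge0 ?divr_ge0 ?addr_ge0 ?ltW.
  have rL := L_le rx x1; rewrite mulrAC ler_pdivlMr//; nra.
apply: ler_wpM2l; first exact: le_trans ler01 k1.
apply: (@le_trans _ _ (w y / (1 - y) `^ a * L y `^ al)).
  by apply: inc => //; rewrite in_itv /=; lra.
apply: ler_wpM2l; first by apply: w0 => //; lra.
apply: ge0_ler_powR; rewrite ?nnegrE ?(ltW al0)// ?addr_ge0// ?(ltW Ly)//.
by rewrite lerDr.
Qed.

End Weight.
End Weights.

(** * Dyadic values of a weight, and their sums *)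

Section Dyadic.
Variable R : realType.
Implicit Types (x y t d A B q : R) (k m n : nat).

Notation L x := (ln ((1 - x)^-1)).

Lemma ln2_bounds : 2^-1 <= ln (2 : R) <= 1.
Proof.
have h1 := @le_ln1Dx R 1; have h2 := @le_ln1Dx R (- 2^-1).
have {}h2 : ln (2^-1 : R) <= - 2^-1.
  rewrite [leLHS](_ : _ = ln (1 + - 2^-1)); last by congr ln; field.
  by apply: h2; rewrite ltrN2 invf_lt1 ?ltr1n.
move: h2; rewrite lnV ?posrE// lerN2 => ->.
by rewrite (_ : 2 = 1 + 1 :> R)// h1// (lt_le_trans (_ : -1 < 0))// ltrN10.
Qed.

Lemma log_dyad_bounds k x : dyad R k / 2 < 1 - x <= dyad R k ->
  k.+1%:R / 2 <= 1 + L x <= 2 * k.+1%:R.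
Proof.
move=> /andP[xk kx]; have /andP[l1 l2] := ln2_bounds.
have d0 : 0 < 1 - x by apply: lt_trans xk; rewrite divr_gt0// dyad_gt0.
have ln_dyad j : ln ((dyad R j)^-1) = j%:R * ln 2.
  by rewrite /dyad -exprVn invrK lnXn// mulr_natl.
have lo : k%:R * ln 2 <= L x.
  by rewrite -ln_dyad ler_ln ?posrE ?invr_gt0 ?dyad_gt0// lef_pV2 ?posrE// dyad_gt0.
have hi : L x <= k.+1%:R * ln 2.
  rewrite -ln_dyad ler_ln ?posrE ?invr_gt0 ?dyad_gt0// lef_pV2 ?posrE ?dyad_gt0//.
  by rewrite dyadS ltW.
have h1 : k%:R * 2^-1 <= k%:R * ln 2 :> R by rewrite ler_wpM2l.
have h2 : k.+1%:R * ln 2 <= k.+1%:R * 1 :> R by rewrite ler_wpM2l.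
have k0 : (0 : R) <= k%:R by [].
by move: h1 h2 lo hi; rewrite -[k.+1%:R]natr1 => *; apply/andP; split; lra.
Qed.

Lemma powR_nat_base A n : (2 ^+ n) `^ A = (2 `^ A) ^+ n :> R.
Proof. by rewrite -(powR_mulrn n (powR_ge0 _ _)) -(powR_mulrn n (ler0n R 2)) -!powRrM mulrC. Qed.

Lemma powR_half_two A (s : R) : 2^-1 <= s <= 2 -> s `^ A <= 2 `^ `|A|.
Proof.
move=> /andP[s1 s2]; have s0 : 0 < s by apply: lt_le_trans s1; rewrite invr_gt0.
have [A0|A0] := leP 0 A.
  by rewrite ger0_norm//; apply: ge0_ler_powR; rewrite ?nnegrE// ltW.
rewrite ltr0_norm// -[s]invrK -powR_inv1 ?invr_ge0 ?(ltW s0)// -powRrM mulN1r.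
apply: ge0_ler_powR; rewrite ?nnegrE ?invr_ge0 ?(ltW s0)//; first by rewrite oppr_ge0 ltW.
by rewrite -[leRHS]invrK lef_pV2 ?posrE ?invr_gt0.
Qed.

Lemma powR_dyadic_ratio A n t d : 0 < d -> d * 2 ^+ n / 2 <= t <= 2 * (d * 2 ^+ n) ->
  t `^ A <= 2 `^ `|A| * (2 `^ A) ^+ n * d `^ A.
Proof.
move=> d0 /andP[t1 t2]; have n0 : (0 : R) < 2 ^+ n by rewrite exprn_gt0.
have dn := mulr_gt0 d0 n0.
have t0 : 0 < t by apply: lt_le_trans t1; rewrite divr_gt0.
rewrite (_ : t = t / (d * 2 ^+ n) * 2 ^+ n * d); last by field; rewrite !lt0r_neq0.
rewrite powRM ?(ltW d0)//; last by rewrite mulr_ge0 ?divr_ge0// ltW.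
rewrite powRM ?(ltW n0)//; last by rewrite divr_ge0// ltW.
rewrite powR_nat_base; apply: ler_wpM2r; first exact: powR_ge0.
apply: ler_wpM2r; first by rewrite exprn_ge0// powR_ge0.
apply: powR_half_two; rewrite ler_pdivlMr// ler_pdivrMr// t2 andbT.
by rewrite mulrC.
Qed.

Lemma dyad_sub k m : (k <= m)%N -> dyad R k = dyad R m * 2 ^+ (m - k).
Proof.
move=> km; rewrite -{1}(subnKC km) /dyad exprD -mulrA -exprMn mulVf ?expr1n ?mulr1//.
Qed.

(** The size of the weight on the [k]-th annulus, relative to the [m]-th. *)
Definition dyadic_factor A B (al : R) k m : R :=
  if (k <= m)%N then (2 `^ A) ^+ (m - k) * (m.+1%:R / k.+1%:R) `^ al
  else (2 `^ (- B)) ^+ (k - m).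

Lemma dyadic_factor_ge0 A B al k m : 0 <= dyadic_factor A B al k m.
Proof.
by rewrite /dyadic_factor; case: ifP => _; rewrite ?mulr_ge0 ?exprn_ge0 ?powR_ge0.
Qed.

(** On the [k]-th annulus [1 - x] is [2^-k] and [1 + L x] is [k + 1] up to
    constants, so that monotonicity of the two quotients becomes geometric growth. *)
Lemma dyadic_weight (W : R -> R) A B al C : 0 < C -> 0 <= al <= 1 ->
  (forall x, 0 <= x < 1 -> 0 <= W x) ->
  (forall x y, 0 <= x -> x <= y -> y < 1 ->
    W x / (1 - x) `^ A * (1 + L x) `^ al <= C * (W y / (1 - y) `^ A * (1 + L y) `^ al)) ->
  (forall x y, 0 <= x -> x <= y -> y < 1 -> W y / (1 - y) `^ B <= C * (W x / (1 - x) `^ B)) ->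
  exists2 D, 0 < D & forall k m x y, 0 <= x -> 0 <= y ->
    dyad R k / 2 < 1 - x <= dyad R k -> dyad R m / 2 < 1 - y <= dyad R m ->
    W x <= D * W y * dyadic_factor A B al k m.
Proof.
move=> C0 /andP[al0 al1] W0 up down.
pose D := C * (2 `^ `|A| * 4 + 2 `^ `|B|).
have D0 : 0 < D by rewrite mulr_gt0// addr_gt0 ?mulr_gt0 ?powR_gt0.
exists D => // k m x y x0 y0 xk ym; have /andP[xk1 xk2] := xk; have /andP[ym1 ym2] := ym.
have t0 : 0 < 1 - x by apply: lt_trans xk1; rewrite divr_gt0// dyad_gt0.
have d0 : 0 < 1 - y by apply: lt_trans ym1; rewrite divr_gt0// dyad_gt0.
have x1 : x < 1 by rewrite -subr_gt0.
have y1 : y < 1 by rewrite -subr_gt0.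
have Wx := W0 x (introT andP (conj x0 x1)); have Wy := W0 y (introT andP (conj y0 y1)).
have dm := dyad_gt0 R m; have dk := dyad_gt0 R k.
have powN (s E : R) : 0 < s -> s `^ E = (s^-1) `^ (- E).
  by move=> s0; rewrite -powR_inv1 ?(ltW s0)// -powRrM mulrNN mul1r.
have [xy|yx] := leP x y.
  have km : (k <= m)%N.
    rewrite leqNgt; apply/negP => mk; have := dyad_le R mk; rewrite dyadS; lra.
  rewrite /dyadic_factor km; have e := dyad_sub km.
  have /andP[lx1 lx2] := log_dyad_bounds xk; have /andP[ly1 ly2] := log_dyad_bounds ym.
  have lx0 : 0 < 1 + L x by apply: lt_le_trans lx1; rewrite divr_gt0.
  have ly0 : 0 < 1 + L y by apply: lt_le_trans ly1; rewrite divr_gt0.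
  have tA := powR_gt0 A t0; have dA := powR_gt0 A d0; have lal := powR_gt0 al lx0.
  have n0 : (0 : R) < 2 ^+ (m - k) by rewrite exprn_gt0.
  have := up x y x0 xy y1; rewrite -ler_pdivlMr// ler_pdivrMr// => /le_trans; apply.
  have h1 : (1 - x) `^ A <= 2 `^ `|A| * (2 `^ A) ^+ (m - k) * (1 - y) `^ A.
    apply: powR_dyadic_ratio => //; apply/andP; split; nra.
  have h2 : ((1 + L y) / (1 + L x)) `^ al <= 4 * (m.+1%:R / k.+1%:R) `^ al.
    apply: (@le_trans _ _ ((4 * (m.+1%:R / k.+1%:R)) `^ al)).
      apply: ge0_ler_powR; rewrite ?nnegrE ?divr_ge0 ?mulr_ge0 ?(ltW lx0) ?(ltW ly0)//.
      rewrite ler_pdivrMr//; apply: le_trans ly2 _.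
      have k0 : (0 : R) < k.+1%:R by [].
      rewrite (_ : 2 * m.+1%:R = 4 * (m.+1%:R / k.+1%:R) * (k.+1%:R / 2)); last first.
        by field; rewrite lt0r_neq0.
      by apply: ler_wpM2l => //; rewrite mulr_ge0// divr_ge0.
    rewrite powRM ?divr_ge0//; apply: ler_wpM2r; first exact: powR_ge0.
    rewrite -[leRHS]powRr1//; apply: ler_powR => //; by rewrite ler1n.
  rewrite (_ : C * _ / _ * _ = C * W y / (1 - y) `^ A * (1 - x) `^ A *
      ((1 + L y) `^ al / (1 + L x) `^ al)); last by ring.
  have -> : (1 + L y) `^ al / (1 + L x) `^ al = ((1 + L y) / (1 + L x)) `^ al.
    by rewrite powRM ?invr_ge0 ?(ltW lx0) ?(ltW ly0)// -powRN (powN _ (- al)) ?opprK.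
  apply: (@le_trans _ _ (C * W y / (1 - y) `^ A *
     (2 `^ `|A| * (2 `^ A) ^+ (m - k) * (1 - y) `^ A) * (4 * (m.+1%:R / k.+1%:R) `^ al))).
    apply: ler_pM => //; rewrite ?powR_ge0 ?mulr_ge0 ?invr_ge0 ?powR_ge0 ?(ltW C0)//.
    by apply: ler_wpM2l => //; rewrite !mulr_ge0 ?invr_ge0 ?powR_ge0 ?(ltW C0).
  have P0 : 0 <= C * W y * ((2 `^ A) ^+ (m - k) * (m.+1%:R / k.+1%:R) `^ al).
    by rewrite !mulr_ge0 ?exprn_ge0 ?powR_ge0 ?(ltW C0).
  rewrite (_ : _ * (4 * _) = C * W y * ((2 `^ A) ^+ (m - k) * (m.+1%:R / k.+1%:R) `^ al)
     * (2 `^ `|A| * 4)); last by field; rewrite lt0r_neq0.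
  rewrite (_ : D * _ * _ = C * W y * ((2 `^ A) ^+ (m - k) * (m.+1%:R / k.+1%:R) `^ al)
     * (2 `^ `|A| * 4 + 2 `^ `|B|)); last by rewrite /D; ring.
  by apply: ler_wpM2l => //; rewrite lerDl powR_ge0.
have mk : (m <= k)%N.
  rewrite leqNgt; apply/negP => km; have := dyad_le R km; rewrite dyadS; lra.
have e := dyad_sub mk; have n0 : (0 : R) < 2 ^+ (k - m) by rewrite exprn_gt0.
have tB := powR_gt0 B t0; have dB := powR_gt0 B d0.
have base : W x <= D * W y * (2 `^ (- B)) ^+ (k - m).
  have := down y x y0 (ltW yx) x1; rewrite ler_pdivrMr// => /le_trans; apply.
  have h1 : (1 - x) `^ B <= 2 `^ `|B| * (2 `^ (- B)) ^+ (k - m) * (1 - y) `^ B.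
    rewrite !(powN _ B)// -(normrN B); apply: powR_dyadic_ratio; first by rewrite invr_gt0.
    have u1 : 2 ^+ (k - m) * (1 - x) <= 2 * (1 - y) by nra.
    have u2 : 1 - y <= 2 * (2 ^+ (k - m) * (1 - x)) by nra.
    apply/andP; split.
      rewrite -[(1 - x)^-1]mul1r ler_pdivlMr//.
      rewrite (_ : _ / 2 * _ = 2 ^+ (k - m) * (1 - x) / (2 * (1 - y))); last first.
        by field; rewrite lt0r_neq0.
      by rewrite ler_pdivrMr ?mul1r// mulr_gt0.
    rewrite (_ : 2 * _ = 2 * (2 ^+ (k - m) * (1 - x)) / (1 - y) / (1 - x)); last first.
      by field; rewrite !lt0r_neq0.
    by rewrite ler_pdivlMr// mulVf ?lt0r_neq0// ler_pdivlMr// mul1r.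
  apply: (@le_trans _ _ (C * (W y / (1 - y) `^ B) *
     (2 `^ `|B| * (2 `^ (- B)) ^+ (k - m) * (1 - y) `^ B))).
    by apply: ler_wpM2l => //; rewrite !mulr_ge0 ?invr_ge0 ?powR_ge0 ?(ltW C0).
  have P0 : 0 <= C * W y * (2 `^ (- B)) ^+ (k - m).
    by rewrite !mulr_ge0 ?exprn_ge0 ?powR_ge0 ?(ltW C0).
  rewrite (_ : C * _ * _ = C * W y * (2 `^ (- B)) ^+ (k - m) * 2 `^ `|B|); last first.
    by field; rewrite lt0r_neq0.
  rewrite (_ : D * _ * _ = C * W y * (2 `^ (- B)) ^+ (k - m) * (2 `^ `|A| * 4 + 2 `^ `|B|)).
    by apply: ler_wpM2l => //; rewrite lerDr mulr_ge0// powR_ge0.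
  by rewrite /D; ring.
rewrite /dyadic_factor; case: ifPn => // km.
have Ek : k = m by apply/eqP; rewrite eqn_leq km mk.
move: base; rewrite Ek subnn !expr0 divff// ?one_powR ?mul1r//.
Qed.

End Dyadic.

Section Series.
Variable R : realType.
Implicit Types (A B q : R) (k m n N : nat).

Lemma nneseries_le_bound (u : nat -> R) (M : R) : (forall k, 0 <= u k) ->
  (forall N, \sum_(0 <= k < N) u k <= M) -> (\sum_(k <oo) (u k)%:E <= M%:E)%E.
Proof.
move=> u0 uM; apply: lime_le; first by apply: is_cvg_nneseries => k _ _; rewrite lee_fin.
by apply: nearW => N; rewrite sumEFin lee_fin.
Qed.

Lemma geometric_sum_le (v : R) N : 0 <= v < 1 -> \sum_(0 <= k < N) v ^+ k <= (1 - v)^-1.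
Proof.
move=> /andP[v0 v1]; have d0 : 0 < 1 - v by rewrite subr_gt0.
rewrite -[leRHS]mul1r ler_pdivlMr// mulrC big_mkord.
rewrite (_ : _ * _ = 1 - v ^+ N); last by rewrite -opprB -[RHS]opprB subrX1 mulNr.
by rewrite gerBl exprn_ge0.
Qed.

(** Bernoulli: the graph of [expR] lies above its tangent at [b * u]. *)
Lemma powR_bernoulli (x b : R) : 0 <= x -> 0 < b < 1 -> x `^ b <= b * x + (1 - b).
Proof.
move=> x0 /andP[b0 b1]; have [->|xN] := eqVneq x 0.
  by rewrite powR0 ?lt0r_neq0// mulr0 add0r subr_ge0 ltW.
have xp : 0 < x by rewrite lt_neqAle eq_sym xN.
have -> : x `^ b = expR (b * ln x) by rewrite /powR (negbTE xN).
rewrite -{2}(lnK (xp : x \is Num.pos)); set u := ln x; set y := b * u.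
have e0 := expR_gt0 y.
have h1 : expR u = expR y * expR (u - y) by rewrite -expRD addrC subrK.
have h2 : 1 = expR y * expR (- y) by rewrite -expRD subrr expR0.
have h3 := expR_ge1Dx (u - y); have h4 := expR_ge1Dx (- y).
have h5 : expR y * (1 + (u - y)) <= expR u by rewrite h1 ler_wpM2l// ltW.
have h6 : expR y * (1 - y) <= 1 by rewrite {2}h2 ler_wpM2l// ltW.
have h7 : b * (expR y * (1 + (u - y))) <= b * expR u by rewrite ler_wpM2l// ltW.
have h8 : (1 - b) * (expR y * (1 - y)) <= (1 - b) * 1 by rewrite ler_wpM2l// subr_ge0 ltW.
have h9 : b * (expR y * (1 + (u - y))) + (1 - b) * (expR y * (1 - y)) = expR y.
  by rewrite /y; ring.
lra.
Qed.

(** By induction: Bernoulli at [n / (n + 1)] says that the increments of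
    [n^(1-al) / (1-al)] are at least [(n+1)^-al]. *)
Lemma sum_inv_powR_le (al : R) n : 0 < al < 1 ->
  \sum_(0 <= k < n) (k.+1%:R)^-1 `^ al <= n%:R `^ (1 - al) / (1 - al).
Proof.
move=> /andP[a0 a1]; have b0 : 0 < 1 - al by rewrite subr_gt0.
elim: n => [|n IH]; first by rewrite big_geq// divr_ge0 ?powR_ge0// ltW.
rewrite big_nat_recr//=; apply: le_trans (lerD IH (lexx _)) _.
rewrite -lerBrDl -mulrBl ler_pdivlMr//.
have n0 : (0 : R) < n.+1%:R by [].
have h : (n%:R / n.+1%:R) `^ (1 - al) <= (1 - al) * (n%:R / n.+1%:R) + al.
  apply: le_trans (@powR_bernoulli _ (1 - al) _ _) _; first by rewrite divr_ge0.
    by rewrite b0 gtrBl.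
  by rewrite lerD2l opprB addrCA subrr addr0.
rewrite powRM ?invr_ge0// in h.
have p0 := powR_gt0 (1 - al) n0.
have hV b : (n.+1%:R^-1 : R) `^ b = (n.+1%:R `^ b)^-1.
  by rewrite -powR_inv1// -powRrM mulN1r powRN.
rewrite hV ler_pdivrMr// in h.
have e : n.+1%:R^-1 `^ al = n.+1%:R `^ (1 - al) / n.+1%:R :> R.
  rewrite hV powRB ?lt0r_neq0 ?implybT// powRr1//; field.
  by rewrite !lt0r_neq0// powR_gt0.
rewrite e.
have nE : (n%:R / n.+1%:R : R) = 1 - n.+1%:R^-1.
  by rewrite -[X in X - _](divff (lt0r_neq0 n0)) -[X in _ - X]mul1r -mulrBl -natr1 addrK.
rewrite nE in h.
rewrite [leLHS](_ : _ = n.+1%:R `^ (1 - al) - ((1 - al) * (1 - n.+1%:R^-1) + al) * n.+1%:R `^ (1 - al)).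
  by rewrite lerD2l lerN2.
ring.
Qed.

Section Sum.
Variables (q A B al : R).
Hypothesis B_gt : -1 < B.

Notation X := (kernel_ratio q).

Let X0 : 0 < X. Proof. exact: powR_gt0. Qed.

Lemma partial_sum_le (u : nat -> R) (s1 s2 : R) m : (forall k, 0 <= u k) ->
  \sum_(0 <= k < m.+1) u k <= s1 -> (forall N, \sum_(0 <= i < N) u (i + m.+1)%N <= s2) ->
  forall N, \sum_(0 <= k < N) u k <= s1 + s2.
Proof.
move=> u0 h1 h2 N; apply: (@le_trans _ _ (\sum_(0 <= k < N + m.+1) u k)).
  rewrite (big_cat_nat (n := N) (p := (N + m.+1)%N)) ?leq_addr//= lerDl.
  by apply: sumr_ge0 => k _.
rewrite (big_cat_nat (n := m.+1)) ?leq_addl//=; apply: lerD => //.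
by rewrite -{1}[m.+1]add0n big_addn addnK.
Qed.

Let lowE k m : (k <= m)%N ->
  dyadic_factor A B al k m * dyad R k * X ^+ minn k m =
  (X / 2) ^+ m * ((2 `^ (A - (2 * q - 2))) ^+ (m - k) * (m.+1%:R / k.+1%:R) `^ al).
Proof.
move=> km; rewrite /dyadic_factor km (minn_idPl km).
have eA : 2 `^ A = 2 `^ (A - (2 * q - 2)) * (X / 2) :> R.
  rewrite [in LHS](_ : A = (A - (2 * q - 2)) + (2 * q - 1 - 1)); last by ring.
  rewrite powRD ?pnatr_eq0 ?implybT//; congr (_ * _).
  by rewrite powRB ?pnatr_eq0 ?implybT// powRr1.
have ek : dyad R k * X ^+ k = (X / 2) ^+ k by rewrite /dyad -exprMn mulrC.
have em : (X / 2) ^+ m = (X / 2) ^+ (m - k) * (X / 2) ^+ k by rewrite -exprD subnK.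
by rewrite eA exprMn em -ek; set Z := (X / 2) ^+ (m - k); ring.
Qed.

Let highE i m : dyadic_factor A B al (i + m.+1) m * dyad R (i + m.+1) * X ^+ minn (i + m.+1) m =
  (X / 2) ^+ m * (2 `^ (- B - 1)) ^+ i.+1.
Proof.
have mi : (m < i + m.+1)%N by rewrite addnS ltnS leq_addl.
rewrite /dyadic_factor leqNgt mi /= (minn_idPr (ltnW mi)).
have -> : (i + m.+1 - m = i.+1)%N by rewrite addnS -addSn addnK.
have -> : 2 `^ (- B - 1) = 2 `^ (- B) / 2 :> R by rewrite powRB ?pnatr_eq0 ?implybT// powRr1.
have -> : (i + m.+1 = i.+1 + m)%N by rewrite addnS addSn.
rewrite /dyad exprD !exprMn; ring.
Qed.

(** The series splits at [m]; the half beyond [m] is geometric with ratio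
    [2^(-B-1)], and [s1] bounds the half up to [m]. *)
Lemma kernel_series_le (s1 : nat -> R) : (forall m,
    \sum_(0 <= k < m.+1) (2 `^ (A - (2 * q - 2))) ^+ (m - k) * (m.+1%:R / k.+1%:R) `^ al <= s1 m) ->
  forall m, (\sum_(k <oo) (dyadic_factor A B al k m * dyad R k * X ^+ minn k m)%:E <=
   ((X / 2) ^+ m * (s1 m + (1 - 2 `^ (- B - 1))^-1))%:E)%E.
Proof.
move=> h1 m; have t0 k : 0 <= dyadic_factor A B al k m * dyad R k * X ^+ minn k m.
  by rewrite !mulr_ge0 ?dyadic_factor_ge0 ?exprn_ge0 ?(ltW X0)// ltW// dyad_gt0.
have P0 : 0 <= (X / 2) ^+ m by rewrite exprn_ge0// divr_ge0// ltW.
apply: nneseries_le_bound => //; rewrite mulrDr; apply: (partial_sum_le (m := m)) => //.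
  rewrite (eq_big_nat _ _ (F2 := fun k => (X / 2) ^+ m *
     ((2 `^ (A - (2 * q - 2))) ^+ (m - k) * (m.+1%:R / k.+1%:R) `^ al))); last first.
    by move=> k /andP[_ km]; exact: lowE.
  by rewrite -mulr_sumr; apply: ler_wpM2l.
move=> N; under eq_bigr do rewrite highE.
rewrite -mulr_sumr; apply: ler_wpM2l => //.
have v01 : 0 <= (2 : R) `^ (- B - 1) < 1.
  rewrite powR_ge0 /= /powR pnatr_eq0 /= -[ltRHS]expR0 ltr_expR.
  by rewrite nmulr_rlt0 ?ln_gt0 ?ltr1n//; move: B_gt; lra.
apply: le_trans (geometric_sum_le N v01); apply: ler_sum => i _.
by case/andP: v01 => v0 v1; rewrite exprS ler_piMl ?exprn_ge0// ltW.
Qed.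

Lemma low_sum_subcritical m : al = 0 -> A < 2 * q - 2 ->
  \sum_(0 <= k < m.+1) (2 `^ (A - (2 * q - 2))) ^+ (m - k) * (m.+1%:R / k.+1%:R) `^ al <=
  (1 - 2 `^ (A - (2 * q - 2)))^-1 :> R.
Proof.
move=> -> Aq; under eq_bigr do rewrite powRr0 mulr1.
have u01 : 0 <= (2 : R) `^ (A - (2 * q - 2)) < 1.
  rewrite powR_ge0 /= /powR pnatr_eq0 /= -[ltRHS]expR0 ltr_expR.
  by rewrite nmulr_rlt0 ?ln_gt0 ?ltr1n//; lra.
apply: le_trans (geometric_sum_le m.+1 u01).
rewrite [leLHS]big_nat_rev /= add0n le_eqVlt; apply/orP; left; apply/eqP.
by apply: eq_big_nat => k /andP[_ km]; rewrite subSS subKn.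
Qed.

(** At the critical exponent the terms no longer decay and only the power of
    the logarithm is left. *)
Lemma low_sum_critical m : 0 < al < 1 -> A = 2 * q - 2 ->
  \sum_(0 <= k < m.+1) (2 `^ (A - (2 * q - 2))) ^+ (m - k) * (m.+1%:R / k.+1%:R) `^ al <=
  m.+1%:R / (1 - al) :> R.
Proof.
move=> /[dup] al01 /andP[a0 a1] ->; rewrite subrr powRr0.
under eq_bigr do rewrite expr1n mul1r powRM ?invr_ge0//.
rewrite -mulr_sumr; apply: le_trans (ler_wpM2l (powR_ge0 _ _) (sum_inv_powR_le m.+1 al01)) _.
rewrite mulrA -powRD; last by rewrite pnatr_eq0 implybT.
by rewrite addrCA subrr addr0 powRr1.
Qed.

End Sum.
End Series.

(** * The upper estimate *)

Section Upper.
Variable R : realType.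
Implicit Types (a : R[i]) (s : seq R[i]).

Notation mu := (@lebesgue_measure R).
Notation plane := (measurableTypeR R * measurableTypeR R)%type.
Notation area := (mu \x mu)%E.
Notation L x := (ln ((1 - x)^-1)).
Notation in_disk s := (all (fun x => cabs x < 1) s).
Notation disk := [set q : plane | unit_disk (q.1 +i* q.2)%C].
Notation kernel a z := ((1 - cabs a ^+ 2) / cabs (1 - (a^*)%C * z) ^+ 2).

Section OneZero.
Variables (q A B al D S : R) (W Lam : R -> R) (s1 : nat -> R).
Hypothesis q_gt : 2^-1 < q.
Hypothesis q_le : q <= 1.
Hypothesis B_gt : -1 < B.
Hypothesis D_gt0 : 0 < D.
Hypothesis S_gt0 : 0 < S.
Hypothesis W_ge0 : forall x : R, 0 <= x < 1 -> 0 <= W x.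
Hypothesis W_dyadic : forall k m (x y : R), 0 <= x -> 0 <= y ->
  dyad R k / 2 < 1 - x <= dyad R k -> dyad R m / 2 < 1 - y <= dyad R m ->
  W x <= D * W y * dyadic_factor A B al k m.
Hypothesis s1_ge : forall m,
  \sum_(0 <= k < m.+1) (2 `^ (A - (2 * q - 2))) ^+ (m - k) * (m.+1%:R / k.+1%:R) `^ al <= s1 m.
Hypothesis s1_le : forall m (y : R), dyad R m / 2 < 1 - y <= dyad R m ->
  s1 m + (1 - 2 `^ (- B - 1))^-1 <= S * Lam y.

Notation X := (kernel_ratio q).
Notation K := (128 * X ^+ 2 / (X - 1)).

Let K0 : 0 < K.
Proof.
have X1 := kernel_ratio_gt1 q_gt; have X0 : 0 < X := lt_trans ltr01 X1.
by rewrite divr_gt0 ?mulr_gt0 ?exprn_gt0// subr_gt0.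
Qed.

Lemma kernel_ratio_half_le m (d : R) : dyad R m / 2 < d -> (X / 2) ^+ m <= (2 * d) `^ (2 - 2 * q).
Proof.
move=> md; have m0 := dyad_gt0 R m.
have -> : X / 2 = (2^-1) `^ (2 - 2 * q).
  rewrite [in RHS](_ : 2^-1 = 2 `^ (-1)); last by rewrite powR_inv1.
  rewrite -powRrM mulN1r opprB (_ : 2 * q - 2 = 2 * q - 1 - 1); last by ring.
  by rewrite powRB ?pnatr_eq0 ?implybT// powRr1.
have -> : ((2^-1 : R) `^ (2 - 2 * q)) ^+ m = dyad R m `^ (2 - 2 * q).
  by rewrite -powR_mulrn ?powR_ge0// -powRrM (mulrC _ m%:R) powRrM powR_mulrn// invr_ge0.
apply: ge0_ler_powR; rewrite ?nnegrE ?(ltW m0)//; [move: q_le; lra|lra|lra].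
Qed.

(** The contribution of one zero.  Besides the integral bound the majorant is
    measurable, which allows termwise integration over all zeros whatever the
    weight is. *)
Lemma zero_majorant : exists2 E, 0 < E & forall a, cabs a < 1 -> exists H : plane -> \bar R,
  [/\ measurable_fun disk H, (forall z, disk z -> 0 <= H z)%E,
    (forall z, disk z -> ((kernel a (z.1 +i* z.2)%C `^ q * W (cabs (z.1 +i* z.2)%C))%:E <= H z)%E) &
    (\int[area]_(z in disk) H z <=
      (E * ((1 - cabs a) `^ (2 - q) * W (cabs a) * Lam (cabs a)))%:E)%E].
Proof.
exists (K * D * 2 `^ (2 - q) * S); first exact: (mulr_gt0 (mulr_gt0 (mulr_gt0 K0 D_gt0) (powR_gt0 _ (ltr0Sn R 1))) S_gt0).
move=> a a1; pose d := 1 - cabs a; have d0 : 0 < d by rewrite subr_gt0.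
have d1 : d <= 1 by rewrite gerBl cabs_ge0.
have [m md] : exists m, dyad R m / 2 < d <= dyad R m by apply: dyad_annulus; rewrite d0.
have /andP[md1 md2] := md.
have Wa : 0 <= W (cabs a) by apply: W_ge0; rewrite cabs_ge0.
pose c k := (2 * d) `^ q * (D * W (cabs a) * dyadic_factor A B al k m).
have c0 k : 0 <= c k.
  by rewrite !mulr_ge0 ?powR_ge0 ?dyadic_factor_ge0 ?(ltW D_gt0).
have mdisk := @measurable_unit_disk R.
exists (kernel_majorant q a m c); split.
- exact: measurable_kernel_majorant.
- by move=> z _; exact: kernel_majorant_ge0.
- move=> [x y] /=; set z := (x +i* y)%C => z1; rewrite /unit_disk /= in z1.
  have [k zk] : exists k, dyad R k / 2 < 1 - cabs z <= dyad R k.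
    by apply: dyad_annulus; rewrite subr_gt0 z1 gerBl cabs_ge0.
  have zA : annulus (dyad R k) (x, y) by [].
  apply: le_trans (kernel_majorant_ge q_gt a1 c0 md1 zA); rewrite /= -/z lee_fin.
  have v0 := cabs_1Mconj_gt0 a1 z1; set v := cabs (1 - _) in v0 *.
  have Wz := W_dyadic (cabs_ge0 z) (cabs_ge0 a) zk md.
  have Wz0 : 0 <= W (cabs z) by apply: W_ge0; rewrite cabs_ge0.
  rewrite [leRHS](_ : _ = D * W (cabs a) * dyadic_factor A B al k m *
     ((2 * d) `^ q * v^-1 `^ (2 * q))); last by rewrite /c; ring.
  rewrite mulrC; apply: ler_pM => //; first exact: powR_ge0.
  rewrite powRrM -powRM ?mulr_ge0 ?powR_ge0 ?(ltW d0)//.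
  apply: ge0_ler_powR; rewrite ?nnegrE.
  + by apply: le_trans (ltW q_gt).
  + by rewrite divr_ge0 ?exprn_ge0 ?(ltW v0)// ltW// sqr_lt1.
  + by rewrite !mulr_ge0 ?powR_ge0 ?(ltW d0).
  rewrite (powR_mulrn 2) ?invr_ge0 ?(ltW v0)// exprVn.
  apply: ler_wpM2r; first by rewrite invr_ge0 exprn_ge0// ltW.
  by rewrite /d; have := cabs_ge0 a; nra.
apply: le_trans (integral_kernel_majorant_le m q_gt a1 c0 mdisk) _.
pose G := K * ((2 * d) `^ q * (D * W (cabs a))).
have G0 : 0 <= G.
  by apply: mulr_ge0 (ltW K0) _; rewrite !mulr_ge0 ?powR_ge0 ?(ltW D_gt0).
rewrite (_ : (fun n => _) = fun n => (\sum_(0 <= k < n) (G%:E *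
   (dyadic_factor A B al k m * dyad R k * X ^+ minn k m)%:E))%E); last first.
  apply/funext => n; apply: eq_bigr => k _; rewrite -EFinM; congr (_%:E).
  by rewrite /c /G; ring.
rewrite nneseriesZl; last first.
  move=> k _; have X0 := ltW (lt_trans ltr01 (kernel_ratio_gt1 q_gt)).
  by rewrite lee_fin !mulr_ge0 ?dyadic_factor_ge0 ?(exprn_ge0 _ X0) ?(ltW (dyad_gt0 R k)).
apply: le_trans (lee_wpmul2l _ (kernel_series_le B_gt s1_ge m)) _; first by rewrite lee_fin.
rewrite -EFinM lee_fin.
apply: (@le_trans _ _ (G * ((2 * d) `^ (2 - 2 * q) * (S * Lam (cabs a))))).
  apply: ler_wpM2l => //; apply: ler_pM.
  - by rewrite exprn_ge0// divr_ge0// powR_ge0.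
  - rewrite addr_ge0//; last first.
      rewrite invr_ge0 subr_ge0 -[leRHS](powRr0 2); apply: ler_powR; first by rewrite ler1n.
      by move: B_gt; lra.
    by apply: le_trans (s1_ge m); apply: sumr_ge0 => k _; rewrite mulr_ge0 ?exprn_ge0 ?powR_ge0.
  - exact: kernel_ratio_half_le.
  - exact: s1_le.
rewrite /G (_ : _ * _ = K * D * S * W (cabs a) * Lam (cabs a) *
   ((2 * d) `^ q * (2 * d) `^ (2 - 2 * q))); last by ring.
have dd : 2 * d != 0 by rewrite gt_eqF// mulr_gt0.
rewrite -powRD; last by rewrite dd implybT.
rewrite (_ : q + (2 - 2 * q) = 2 - q); last by ring.
rewrite powRM ?(ltW d0)// le_eqVlt; apply/orP; left; apply/eqP.
by rewrite /d; ring.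
Qed.

End OneZero.

Lemma powR_subadditive (q x y : R) : 0 < q <= 1 -> 0 <= x -> 0 <= y ->
  (x + y) `^ q <= x `^ q + y `^ q.
Proof.
move=> /andP[q0 q1] x0 y0; have [s0|] := ltP 0 (x + y); last first.
  move=> s0; have -> : x + y = 0 by apply/le_anti; rewrite s0 addr_ge0.
  by rewrite powR0 ?lt0r_neq0// addr_ge0 ?powR_ge0.
have part t : 0 <= t -> t <= x + y -> t / (x + y) * (x + y) `^ q <= t `^ q.
  move=> t0 ts; have [->|tN] := eqVneq t 0; first by rewrite !mul0r powR_ge0.
  have tp : 0 < t by rewrite lt_neqAle eq_sym tN.
  have -> : t `^ q = (t / (x + y)) `^ q * (x + y) `^ q.
    rewrite -powRM ?divfK ?divr_ge0 ?(ltW s0)//; exact: lt0r_neq0.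
  apply: ler_wpM2r; first exact: powR_ge0.
  rewrite -[leLHS]powRr1 ?divr_ge0 ?(ltW s0)//; apply: ger_powR => //.
  by rewrite divr_gt0// ler_pdivrMr// mul1r.
apply: le_trans (lerD (part x x0 _) (part y y0 _)); rewrite ?lerDl ?lerDr//.
by rewrite -mulrDl -mulrDl divff ?mul1r// lt0r_neq0.
Qed.

Lemma powR_sum_le (T : Type) (q : R) (s : seq T) (f : T -> R) : 0 < q <= 1 ->
  (forall t, 0 <= f t) -> (\sum_(t <- s) f t) `^ q <= \sum_(t <- s) f t `^ q.
Proof.
move=> q01 f0; elim: s => [|t s IH].
  by rewrite !big_nil powR0// lt0r_neq0//; case/andP: q01.
rewrite !big_cons; apply: le_trans (powR_subadditive q01 (f0 t) _) _.
  by apply: sumr_ge0.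
by rewrite lerD2l.
Qed.

Lemma kernel_ge0 a z : cabs a < 1 -> 0 <= kernel a z.
Proof. by move=> a1; rewrite divr_ge0 ?exprn_ge0 ?cabs_ge0// ltW// sqr_lt1. Qed.

(** For [p > 1] the excess power [p - 1] is absorbed by Schwarz-Pick, which
    reduces the estimate to the exponent [q = 1] for another weight. *)
Lemma dfblaschke_powR_le (p q : R) s z : 0 < q <= 1 -> q <= p -> in_disk s -> cabs z < 1 ->
  cabs (dfblaschke s z) `^ p <=
  \sum_(x <- s) kernel x z `^ q * (1 - cabs z) `^ (q - p).
Proof.
move=> /[dup] q01 /andP[q0 q1] qp s1 z1; set v := cabs _.
have z0 : 0 < 1 - cabs z by rewrite subr_gt0.
have v0 : 0 <= v by exact: cabs_ge0.
have rhs0 : 0 <= \sum_(x <- s) kernel x z `^ q * (1 - cabs z) `^ (q - p).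
  by apply: sumr_ge0 => x _; rewrite mulr_ge0 ?powR_ge0.
have [vE|vN] := eqVneq v 0.
  by rewrite vE powR0// gt_eqF// (lt_le_trans q0).
have -> : v `^ p = v `^ q * v `^ (p - q).
  by rewrite -powRD ?vN ?implybT// addrC subrK.
rewrite -mulr_suml; apply: ler_pM; rewrite ?powR_ge0//.
  apply: (@le_trans _ _ ((\sum_(x <- s) `|kernel x z|) `^ q)).
    apply: ge0_ler_powR; rewrite ?nnegrE ?(ltW q0)//; first by apply: sumr_ge0.
    apply: le_trans (cabs_dfblaschke_le_sum s1 z1) _.
    by apply: ler_sum => x _; exact: ler_norm.
  apply: le_trans (powR_sum_le _ q01 (fun x => normr_ge0 _)) _.
  rewrite big_seq [leRHS]big_seq; apply: ler_sum => x /(allP s1) x1.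
  by rewrite ger0_norm ?kernel_ge0.
rewrite (_ : (1 - cabs z) `^ (q - p) = ((1 - cabs z)^-1) `^ (p - q)); last first.
  by rewrite -powR_inv1 ?(ltW z0)// -powRrM mulN1r opprB.
apply: ge0_ler_powR; rewrite ?nnegrE ?invr_ge0 ?(ltW z0) ?subr_ge0//.
exact: cabs_dfblaschke_le.
Qed.

Section AllZeros.
Variables (p q E : R) (w Lam : R -> R).
Hypothesis q01 : 0 < q <= 1.
Hypothesis qp : q <= p.
Hypothesis w_ge0 : forall r, 0 <= r < 1 -> 0 <= w r.
Hypothesis Lam_ge0 : forall r, 0 <= r < 1 -> 0 <= Lam r.
Hypothesis E_gt0 : 0 < E.
Hypothesis majorant : forall a, cabs a < 1 -> exists H : plane -> \bar R,
  [/\ measurable_fun disk H, (forall z, disk z -> 0 <= H z)%E,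
    (forall z, disk z -> ((kernel a (z.1 +i* z.2)%C `^ q *
        (w (cabs (z.1 +i* z.2)%C) * (1 - cabs (z.1 +i* z.2)%C) `^ (q - p)))%:E <= H z)%E) &
    (\int[area]_(z in disk) H z <=
      (E * ((1 - cabs a) `^ (2 - p) * w (cabs a) * Lam (cabs a)))%:E)%E].

(** Each partial product satisfies the pointwise bound by the series of
    majorants, hence so does the limit, and the series is integrated termwise. *)
Lemma upper_estimate B : blaschke_product B ->
  (wnorm_pow p w (derive1 B) <= E%:E * zero_sum B (fun z =>
     ((1 - cabs z) `^ (2 - p) * w (cabs z) * Lam (cabs z))%R))%E.
Proof.
move=> [lambda [I [a [l1 aD fin BE]]]].
have [S mS] := mass_bounded aD fin.
have BE' z : cabs z < 1 -> lambda * fblaschke (first_zeros I a N) z @[N --> \oo] --> B z.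
  by move=> /BE; under eq_fun do rewrite prod_first_zeros.
have p0 : 0 < p by case/andP: q01 => q0 _; exact: lt_le_trans qp.
have mdisk := @measurable_unit_disk R.
have /choice[H HP] : forall a, exists H : plane -> \bar R, cabs a < 1 ->
  [/\ measurable_fun disk H, (forall z, disk z -> 0 <= H z)%E,
    (forall z, disk z -> ((kernel a (z.1 +i* z.2)%C `^ q *
        (w (cabs (z.1 +i* z.2)%C) * (1 - cabs (z.1 +i* z.2)%C) `^ (q - p)))%:E <= H z)%E) &
    (\int[area]_(z in disk) H z <=
      (E * ((1 - cabs a) `^ (2 - p) * w (cabs a) * Lam (cabs a)))%:E)%E].
  move=> b; have [/majorant[H HP]|b1] := ltP (cabs b) 1; first by exists H.
  by exists (cst 0%E).
pose G n z := if n \in I then H (a n) z else 0%E.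
have aD' n : n \in I -> cabs (a n) < 1 by move=> /set_mem/aD.
have G0 n z : disk z -> (0 <= G n z)%E.
  by rewrite /G; case: ifPn => // nI zD; have [_ h _ _] := HP _ (aD' _ nI); exact: h.
have mG n : measurable_fun disk (G n).
  rewrite /G; case: (boolP (n \in I)) => nI; last exact: measurable_cst.
  by have [h _ _ _] := HP _ (aD' _ nI).
apply: (@le_trans _ _ (\int[area]_(z in disk) (\sum_(n <oo) G n z))%E).
  apply: ge0_le_integral_any => z zD.
    rewrite lee_fin mulr_ge0 ?powR_ge0// w_ge0// cabs_ge0.
    exact: zD.
  case: z zD => x y /= zD; set z := (x +i* y)%C in zD *.
  have z1 : cabs z < 1 by exact: zD.
  have wz : 0 <= w (cabs z) by apply: w_ge0; rewrite cabs_ge0.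
  have part N : ((cabs (dfblaschke (first_zeros I a N) z) `^ p * w (cabs z))%:E <=
      \sum_(n <oo) G n (x, y))%E.
    apply: le_trans (nneseries_lim_ge (m := 0) N _); last by move=> n _ _; exact: G0.
    have sD := first_zeros_disk N aD.
    apply: (@le_trans _ _ (\sum_(b <- first_zeros I a N)
       kernel b z `^ q * (w (cabs z) * (1 - cabs z) `^ (q - p)))%:E).
      rewrite lee_fin; apply: le_trans (ler_wpM2r wz (dfblaschke_powR_le q01 qp sD z1)) _.
      by rewrite mulr_suml le_eqVlt; apply/orP; left; apply/eqP; apply: eq_bigr => b _; ring.
    rewrite big_map big_filter -sumEFin [leLHS]big_mkcond /=; apply: lee_sum => n _.
    by rewrite /G; case: ifPn => // nI; have [_ _ h _] := HP _ (aD' _ nI); exact: (h (x, y)).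
  have [[t tE]|tE] : (exists t : R, (\sum_(n <oo) G n (x, y) = t%:E)%E) \/
      (\sum_(n <oo) G n (x, y) = +oo)%E.
  - have : (0 <= \sum_(n <oo) G n (x, y))%E by apply: nneseries_ge0 => n _ _; exact: G0.
    by case: (limn _) => [t _||//]; [left; exists t|right].
  - rewrite tE lee_fin.
    have [w0|wN] := eqVneq (w (cabs z)) 0.
      by rewrite w0 mulr0 -lee_fin -tE; apply: nneseries_ge0 => n _ _; exact: G0.
    have wp : 0 < w (cabs z) by rewrite lt_neqAle eq_sym wN.
    have t0 : 0 <= t / w (cabs z).
      rewrite divr_ge0// -lee_fin -tE; apply: nneseries_ge0 => n _ _; exact: G0.
    rewrite -ler_pdivlMr//.
    have tp : ((t / w (cabs z)) `^ p^-1) `^ p = t / w (cabs z).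
      by rewrite -powRrM mulVf ?powRr1// gt_eqF.
    rewrite -tp; apply: ge0_ler_powR; rewrite ?nnegrE ?cabs_ge0 ?powR_ge0 ?(ltW p0)//.
    apply: (cvgn_cabs_le (cvg_dfblaschke l1 aD mS BE' z1)); exists 0%N => N _.
    rewrite cabsM l1 mul1r.
    have -> : cabs (dfblaschke (first_zeros I a N) z) =
       (cabs (dfblaschke (first_zeros I a N) z) `^ p) `^ p^-1.
      by rewrite -powRrM divff ?gt_eqF// powRr1// cabs_ge0.
    apply: ge0_ler_powR; rewrite ?nnegrE ?powR_ge0 ?invr_ge0 ?(ltW p0)//.
    by rewrite ler_pdivlMr// -lee_fin -tE.
  by rewrite tE leey.
rewrite integral_nneseries//.
pose g z := (1 - cabs z) `^ (2 - p) * w (cabs z) * Lam (cabs z).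
have g0 z : cabs z < 1 -> 0 <= g z.
  by move=> z1; rewrite !mulr_ge0 ?powR_ge0 ?w_ge0 ?Lam_ge0 ?cabs_ge0.
apply: lime_le.
  by apply: is_cvg_nneseries => n _ _; apply: integral_ge0 => z zD; exact: G0.
apply: nearW => N.
apply: (@le_trans _ _ (E%:E * (\sum_(b <- first_zeros I a N) g b)%:E)%E).
  rewrite -EFinM mulr_sumr big_map big_filter -sumEFin [leRHS]big_mkcond /=.
  apply: lee_sum => n _; rewrite /G; case: (boolP (n \in I)) => nI; last by rewrite integral0.
  by have [_ _ _ h] := HP _ (aD' _ nI).
apply: lee_wpmul2l; first by rewrite lee_fin ltW.
exact: (sum_first_zeros_le l1 aD mS BE' N g0).
Qed.

End AllZeros.
End Upper.

Section UpperWeights.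
Variable R : realType.
Implicit Types (w : R -> R) (p q : R).

Notation L x := (ln ((1 - x)^-1)).

Lemma shift_quotient (c t p q : R) : 0 < t ->
  t `^ (q - p) / t `^ (c + (q - p)) = (t `^ c)^-1.
Proof.
move=> t0; have tN : t != 0 by rewrite gt_eqF.
rewrite (@powRD _ t c (q - p)) ?tN ?implybT// invfM mulrCA divff ?mulr1//.
by rewrite gt_eqF// powR_gt0.
Qed.

Section Fixed.
Variables (w : R -> R) (p q : R).
Hypothesis w_bounded : bounded_on_compacts w.
Hypothesis w_ge0 : forall r, r \in `[0, 1[ -> 0 <= w r.
Hypothesis q_gt : 2^-1 < q.
Hypothesis q_le : q <= 1.
Hypothesis qp : q <= p.

(** Schwarz-Pick trades [|B'|^(p-q)] for this change of the weight [w]. *)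
Definition shifted_weight r : R := w r * (1 - r) `^ (q - p).

Let w_ge0' r : 0 <= r < 1 -> 0 <= w r.
Proof. by move=> r01; apply: w_ge0; rewrite in_itv. Qed.

Lemma shifted_weight_ge0 r : 0 <= r < 1 -> 0 <= shifted_weight r.
Proof. by move=> r01; rewrite mulr_ge0 ?powR_ge0// w_ge0'. Qed.

Lemma shifted_weightE c r : r < 1 ->
  shifted_weight r / (1 - r) `^ (c + (q - p)) = w r / (1 - r) `^ c.
Proof.
by move=> r1; rewrite /shifted_weight -mulrA shift_quotient// subr_gt0.
Qed.

Lemma upper_from_dyadic (A B al D S : R) (Lam : R -> R) (s1 : nat -> R) :
  -1 < B -> 0 < D -> 0 < S -> (forall r, 0 <= r < 1 -> 0 <= Lam r) ->
  (forall k m (x y : R), 0 <= x -> 0 <= y ->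
    dyad R k / 2 < 1 - x <= dyad R k -> dyad R m / 2 < 1 - y <= dyad R m ->
    shifted_weight x <= D * shifted_weight y * dyadic_factor A B al k m) ->
  (forall m, \sum_(0 <= k < m.+1) (2 `^ (A - (2 * q - 2))) ^+ (m - k) *
     (m.+1%:R / k.+1%:R) `^ al <= s1 m) ->
  (forall m (y : R), dyad R m / 2 < 1 - y <= dyad R m ->
     s1 m + (1 - 2 `^ (- B - 1))^-1 <= S * Lam y) ->
  exists c : R, 0 < c /\ forall f : R[i] -> R[i], blaschke_product f ->
    (wnorm_pow p w (derive1 f) <= c%:E * zero_sum f (fun z =>
       ((1 - cabs z) `^ (2 - p) * w (cabs z) * Lam (cabs z))%R))%E.
Proof.
move=> B_gt D0 S0 Lam0 Wd s1ge s1le.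
have [E E0 HE] := zero_majorant q_gt q_le B_gt D0 S0 shifted_weight_ge0 Wd s1ge s1le.
exists E; split=> // f; have q0 : 0 < q by apply: lt_trans q_gt; rewrite invr_gt0.
apply: (@upper_estimate _ p q) => //; first by rewrite q0.
move=> a a1; have [H [h1 h2 h3 h4]] := HE a a1; exists H; split=> //.
apply: le_trans h4 _; rewrite lee_fin le_eqVlt; apply/orP; left; apply/eqP.
congr (_ * (_ * _)); rewrite /shifted_weight mulrCA -powRD.
  by rewrite mulrC; congr (_ `^ _ * _); ring.
by rewrite subr_eq0 (gt_eqF a1) implybT.
Qed.

Lemma upper_subcritical a b ra rb : ra \in `]0, 1[ -> rb \in `]0, 1[ ->
  incr_to_infty w a ra -> decr_to_zero w b rb ->
  a + (q - p) < 2 * q - 2 -> -1 < b + (q - p) ->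
  exists c : R, 0 < c /\ forall f : R[i] -> R[i], blaschke_product f ->
    (wnorm_pow p w (derive1 f) <= c%:E * zero_sum f (fun z =>
       ((1 - cabs z) `^ (2 - p) * w (cabs z))%R))%E.
Proof.
move=> ra01 rb01 inc dec Aq Bq.
have [Ca Ca0 up] := weight_up w_bounded ra01 inc.
have [Cb Cb0 down] := weight_down w_bounded w_ge0 rb01 dec.
have wq0 c x : 0 <= x -> x < 1 -> 0 <= w x / (1 - x) `^ c.
  by move=> x0 x1; rewrite divr_ge0 ?powR_ge0// w_ge0' ?x0.
have [D D0 HD] := @dyadic_weight R shifted_weight (a + (q - p)) (b + (q - p)) 0 (Ca + Cb)
  (addr_gt0 Ca0 Cb0) ltac:(by rewrite lexx ler01) shifted_weight_ge0
  ltac:(move=> x y x0 xy y1; rewrite !powRr0 !mulr1 !shifted_weightE ?(le_lt_trans xy y1)//;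
    apply: le_trans (up x y x0 xy y1) _; rewrite ler_wpM2r ?lerDl ?(ltW Cb0)//;
    exact: wq0 (le_trans x0 xy) y1)
  ltac:(move=> x y x0 xy y1; rewrite !shifted_weightE ?(le_lt_trans xy y1)//;
    apply: le_trans (down x y x0 xy y1) _; rewrite ler_wpM2r ?lerDr ?(ltW Ca0)//;
    exact: wq0 x0 (le_lt_trans xy y1)).
pose u := (1 - 2 `^ (a + (q - p) - (2 * q - 2)))^-1 : R.
pose v := (1 - 2 `^ (- (b + (q - p)) - 1))^-1 : R.
have pow_lt1 (e : R) : e < 0 -> 0 < (1 - 2 `^ e)^-1 :> R.
  move=> e0; rewrite invr_gt0 subr_gt0 /powR pnatr_eq0 /= -[ltRHS]expR0 ltr_expR.
  by rewrite nmulr_rlt0// ln_gt0 ?ltr1n.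
have u0 : 0 < u by apply: pow_lt1; rewrite subr_lt0.
have v0 : 0 < v by apply: pow_lt1; move: Bq; lra.
have [c [c0 Hc]] := @upper_from_dyadic (a + (q - p)) (b + (q - p)) 0 D (u + v) (fun=> 1)
  (fun=> u) Bq D0 (addr_gt0 u0 v0) (fun _ _ => ler01) HD
  (fun m => low_sum_subcritical m erefl Aq)
  ltac:(by move=> m y _; rewrite mulr1).
exists c; split=> // f fB; apply: le_trans (Hc f fB) _.
rewrite (_ : (fun z : R[i] => _ * 1) = fun z => (1 - cabs z) `^ (2 - p) * w (cabs z))//.
by apply/funext => z; rewrite mulr1.
Qed.

Lemma upper_critical b rb : rb \in `]0, 1[ -> decr_to_zero w b rb ->
  log_condition w -> a_exp w + (q - p) = 2 * q - 2 -> -1 < b + (q - p) ->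
  exists c : R, 0 < c /\ forall f : R[i] -> R[i], blaschke_product f ->
    (wnorm_pow p w (derive1 f) <= c%:E * zero_sum f (fun z =>
       ((1 - cabs z) `^ (2 - p) * w (cabs z) * (1 + ln ((1 - cabs z)^-1)))%R))%E.
Proof.
move=> rb01 dec [al [ra [al01 ra01 inc]]] Aq Bq; set a := a_exp w in inc Aq.
move: al01; rewrite in_itv /= => /[dup] al01 /andP[al0 al1].
have [Ca Ca0 up] := weight_log_up w_bounded w_ge0 al0 ra01 inc.
have [Cb Cb0 down] := weight_down w_bounded w_ge0 rb01 dec.
have wq0 c x : 0 <= x -> x < 1 -> 0 <= w x / (1 - x) `^ c.
  by move=> x0 x1; rewrite divr_ge0 ?powR_ge0// w_ge0' ?x0.
have [D D0 HD] := @dyadic_weight R shifted_weight (a + (q - p)) (b + (q - p)) al (Ca + Cb)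
  (addr_gt0 Ca0 Cb0) ltac:(by rewrite !ltW) shifted_weight_ge0
  ltac:(move=> x y x0 xy y1; rewrite !shifted_weightE ?(le_lt_trans xy y1)//;
    apply: le_trans (up x y x0 xy y1) _; rewrite ler_wpM2r ?lerDl ?(ltW Cb0)//;
    rewrite mulr_ge0 ?powR_ge0//; exact: wq0 (le_trans x0 xy) y1)
  ltac:(move=> x y x0 xy y1; rewrite !shifted_weightE ?(le_lt_trans xy y1)//;
    apply: le_trans (down x y x0 xy y1) _; rewrite ler_wpM2r ?lerDr ?(ltW Ca0)//;
    exact: wq0 x0 (le_lt_trans xy y1)).
pose v := (1 - 2 `^ (- (b + (q - p)) - 1))^-1 : R.
have v0 : 0 < v.
  rewrite invr_gt0 subr_gt0 /powR pnatr_eq0 /= -[ltRHS]expR0 ltr_expR.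
  by rewrite nmulr_rlt0 ?ln_gt0 ?ltr1n//; move: Bq; lra.
have u0 : 0 < (1 - al)^-1 by rewrite invr_gt0 subr_gt0.
apply: (@upper_from_dyadic (a + (q - p)) (b + (q - p)) al D (2 * ((1 - al)^-1 + v))
  (fun r => 1 + L r) (fun m => m.+1%:R / (1 - al))) => //.
- by rewrite mulr_gt0// addr_gt0.
- by move=> r r01; rewrite addr_ge0// L_ge0.
- by move=> m; exact: low_sum_critical.
move=> m y ym; have /andP[l1 _] := log_dyad_bounds ym.
have m1 : (1 : R) <= m.+1%:R by rewrite ler1n.
rewrite -/v; set i := (1 - al)^-1 in u0 *.
have h : (i + v) * m.+1%:R <= (i + v) * (2 * (1 + L y)).
  by apply: ler_wpM2l; [rewrite addr_ge0// ltW|lra].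
nra.
Qed.

End Fixed.
End UpperWeights.

(** * The lower estimate *)

Section Lower.
Variable R : realType.

Notation mu := (@lebesgue_measure R).
Notation plane := (measurableTypeR R * measurableTypeR R)%type.
Notation area := (mu \x mu)%E.
Notation disk := [set q : plane | unit_disk (q.1 +i* q.2)%C].

(** The increasing quotient serves when [y >= x] and the decreasing one when
    [y <= x]; the powers of [1 - x] and [1 - y] are comparable. *)
Lemma weight_comparable (w : R -> R) : normal_weight w -> bounded_on_compacts w ->
  exists2 c, 0 < c & forall x y, 0 <= x < 1 -> 0 <= y < 1 ->
    (1 - x) / 2 <= 1 - y <= 2 * (1 - x) -> c * w x <= w y.
Proof.
move=> [_ w0 [a [b [r0 [r01 inc dec]]]]] wb.
have [Ca Ca0 up] := weight_up wb r01 inc; have [Cb Cb0 down] := weight_down wb w0 r01 dec.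
have ratio (e t d : R) : 0 < t -> 0 < d -> d / 2 <= t <= 2 * d -> d `^ e <= 2 `^ `|e| * t `^ e.
  move=> t0 d0 /andP[h1 h2]; have -> : d = d / t * t by rewrite divfK// gt_eqF.
  rewrite powRM ?divr_ge0 ?(ltW t0) ?(ltW d0)//; apply: ler_wpM2r; first exact: powR_ge0.
  by apply: powR_half_two; rewrite ler_pdivlMr// ler_pdivrMr//; apply/andP; split; lra.
have pa : 0 < 2 `^ `|a| :> R by rewrite powR_gt0.
have pb : 0 < 2 `^ `|b| :> R by rewrite powR_gt0.
exists (Ca * 2 `^ `|a| + Cb * 2 `^ `|b|)^-1; first by rewrite invr_gt0 addr_gt0// mulr_gt0.
move=> x y /andP[x0 x1] /andP[y0 y1] xy.
rewrite mulrC ler_pdivrMr ?addr_gt0 ?mulr_gt0//.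
have dx : 0 < 1 - x by rewrite subr_gt0.
have dy : 0 < 1 - y by rewrite subr_gt0.
have wy : 0 <= w y by apply: w0; rewrite in_itv /= y0.
have fin (C e : R) : 0 < C -> w x / (1 - x) `^ e <= C * (w y / (1 - y) `^ e) ->
    w x <= w y * (C * 2 `^ `|e|).
  move=> C0; rewrite ler_pdivrMr ?powR_gt0// => /le_trans; apply.
  rewrite [leRHS](_ : _ = C * w y * 2 `^ `|e|); last by ring.
  rewrite [leLHS](_ : _ = C * w y * ((1 - x) `^ e / (1 - y) `^ e)); last by ring.
  apply: ler_wpM2l; first by rewrite mulr_ge0// ltW.
  by rewrite ler_pdivrMr ?powR_gt0// ratio.
rewrite mulrDr; have [le|/ltW le] := leP x y.
  apply: le_trans (fin Ca a Ca0 (up x y x0 le y1)) _.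
  by rewrite lerDl !mulr_ge0 ?(ltW Cb0) ?(ltW pb).
apply: le_trans (fin Cb b Cb0 (down y x y0 le x1)) _.
by rewrite lerDr !mulr_ge0 ?(ltW Ca0) ?(ltW pa).
Qed.

(** A rectangle at [a], of size proportional to the distance to the circle and
    shifted horizontally so as to avoid a neighbourhood of the origin, where
    the logarithmic weight vanishes. *)
Definition zero_box (k : R) (a : R[i]) : set plane :=
  let s := k * (1 - cabs a) / 2 in
  let x := if 0 <= complex.Re a then complex.Re a + s / 2 else complex.Re a - s in
  `[x, x + s / 2] `*` `[complex.Im a, complex.Im a + s].

Lemma measurable_zero_box k a : measurable (zero_box k a).
Proof. by apply: measurableX; exact: measurable_itv. Qed.

Lemma area_zero_box k a : 0 < k -> cabs a < 1 ->
  area (zero_box k a) = (k ^+ 2 * (1 - cabs a) ^+ 2 / 8)%:E.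
Proof.
move=> k0 a1; rewrite /zero_box; set s := k * _ / 2.
have s0 : 0 < s by rewrite divr_gt0// mulr_gt0// subr_gt0.
set x := if _ then _ else _.
rewrite product_measure1E; [|exact: measurable_itv..].
have itv (u e : R) : 0 < e -> mu `[u, u + e] = e%:E.
  move=> e0; rewrite lebesgue_measure_itv /= lte_fin ltrDl e0 -EFinB.
  by congr (_%:E); ring.
have i1 := itv x (s / 2) (divr_gt0 s0 (ltr0Sn R 1)); have i2 := itv (complex.Im a) s s0.
move: i1 i2 => /= -> ->; rewrite -EFinM; congr (_%:E).
by rewrite /s; field.
Qed.

Lemma zero_box_near k a u : 0 < k -> cabs a < 1 -> zero_box k a u ->
  cabs ((u.1 +i* u.2)%C - a) <= k * (1 - cabs a).
Proof.
move=> k0 a1; have d0 : 0 < 1 - cabs a by rewrite subr_gt0.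
rewrite /zero_box; set s := k * _ / 2; have s0 : 0 < s by rewrite divr_gt0// mulr_gt0.
have -> : k * (1 - cabs a) = s + s by rewrite /s; field.
case: u => x y [] /=; rewrite !in_itv /= => hx /andP[hy1 hy2].
apply: le_trans (cabs_le_ReIm _) _; rewrite !raddfB /=; apply: lerD; last first.
  by rewrite ler_norml; apply/andP; split; lra.
by move: hx; case: ifP => _ /andP[hx1 hx2]; rewrite ler_norml; apply/andP; split; lra.
Qed.

Lemma zero_box_off_origin k a u : 0 < k -> k <= 1 / 72 -> cabs a < 1 -> zero_box k a u ->
  k / 8 <= cabs (u.1 +i* u.2)%C.
Proof.
move=> k0 k1 a1 ua; have near := zero_box_near k0 a1 ua.
have d0 : 0 < 1 - cabs a by rewrite subr_gt0.
have [ah|ah] := leP (cabs a) (1 / 2).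
  apply: (@le_trans _ _ (k * (1 - cabs a) / 4)); first by nra.
  apply: le_trans (cabs_Re_le _); move: ua; rewrite /zero_box; set s := k * _ / 2.
  have s0 : 0 < s by rewrite divr_gt0// mulr_gt0.
  have -> : k * (1 - cabs a) / 4 = s / 2 by rewrite /s; field.
  case: u {near} => x y [] /=; rewrite !in_itv /= => hx _.
  move: hx; case: ifPn => [a0|]; first by move=> /andP[h1 _]; apply: le_trans (ler_norm _); lra.
  rewrite -ltNge => a0 /andP[_ h2]; rewrite -normrN; apply: le_trans (ler_norm _); lra.
have := cabs_lb a (a - (u.1 +i* u.2)%C); rewrite subKr cabs_distrC; nra.
Qed.

Lemma zero_box_radius k a u : 0 < k -> k <= 1 / 72 -> cabs a < 1 -> zero_box k a u ->
  (1 - cabs a) / 2 <= 1 - cabs (u.1 +i* u.2)%C <= 2 * (1 - cabs a).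
Proof.
move=> k0 k1 a1 ua; have near := zero_box_near k0 a1 ua; set z := (_ +i* _)%C in near *.
have d0 : 0 < 1 - cabs a by rewrite subr_gt0.
have h1 := cabs_lb a (a - z); rewrite subKr cabs_distrC in h1.
have h2 := cabsD a (z - a); rewrite addrC subrK in h2.
by apply/andP; split; nra.
Qed.

(** Separation makes the boxes disjoint: a common point would be within
    pseudohyperbolic distance [2 k] of both zeros. *)
Lemma zero_box_disjoint k x y u : 0 < k -> cabs x < 1 -> cabs y < 1 ->
  zero_box k x u -> zero_box k y u -> pseudohyp y x <= 2 * k.
Proof.
move=> k0 x1 y1 /(zero_box_near k0 x1) ux /(zero_box_near k0 y1) uy.
rewrite /pseudohyp cabsM cabsV ler_pdivrMr ?cabs_1Mconj_gt0//.
have := cabs_1Mconj_gel y1 x1; have := cabs_1Mconj_ger y1 x1.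
set v := cabs (1 - _); set z := (_ +i* _)%C in ux uy.
have -> : y - x = (z - x) - (z - y) by ring.
move=> h1 h2; apply: le_trans (cabsB _ _) _; nra.
Qed.

Lemma sum_disjoint_le (T : Type) (I : eqType) (r : seq I) (Q : I -> set T) (K : I -> R)
    (F : T -> R) (t : T) : uniq r ->
  (forall i j, i \in r -> j \in r -> Q i t -> Q j t -> i = j) ->
  (forall i, i \in r -> Q i t -> K i <= F t) -> 0 <= F t ->
  \sum_(i <- r) K i * \1_(Q i) t <= F t.
Proof.
move=> ur disj KF F0; have [[i ir Qi]|none] := pselect (exists2 i, i \in r & Q i t).
  rewrite (bigD1_seq i)//= indicE mem_set// mulr1 big_seq_cond big1 ?addr0; first exact: KF.
  move=> j /andP[jr ji]; rewrite indicE memNset ?mulr0// => Qj.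
  by move: ji; rewrite (disj j i jr ir Qj Qi) eqxx.
rewrite big_seq big1// => i ir; rewrite indicE memNset ?mulr0// => Qi.
by apply: none; exists i.
Qed.

Lemma integral_sum_indic_ge (I : eqType) (r : seq I) (Q : I -> set plane) (K : I -> R)
    (F : plane -> R) : uniq r -> (forall i, measurable (Q i)) ->
  (forall i, 0 <= K i) -> (forall i, i \in r -> Q i `<=` disk) ->
  (forall i j t, i \in r -> j \in r -> Q i t -> Q j t -> i = j) ->
  (forall i t, i \in r -> Q i t -> K i <= F t) -> (forall t, disk t -> 0 <= F t) ->
  (\sum_(i <- r) (K i)%:E * area (Q i) <= \int[area]_(t in disk) (F t)%:E)%E.
Proof.
move=> ur mQ K0 QD disj KF F0; have mdisk := @measurable_unit_disk R.
apply: (@le_trans _ _ (\int[area]_(t in disk) (\sum_(i <- r) (K i * \1_(Q i) t)%:E))%E); last first.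
  apply: ge0_le_integral_any => t tD.
    by apply: sume_ge0 => i _; rewrite lee_fin mulr_ge0// indicE.
  rewrite sumEFin lee_fin; apply: sum_disjoint_le => //; last exact: F0.
    by move=> i j ir jr; exact: disj.
  by move=> i ir; exact: KF.
rewrite ge0_integral_sum//; last 2 first.
- move=> i; apply/measurable_EFinP; apply: measurable_funM => //; exact: measurable_indic.
- by move=> i t _; rewrite lee_fin mulr_ge0// indicE.
rewrite big_seq [leRHS]big_seq; apply: lee_sum => i ir.
rewrite (@integralZl_indic _ _ _ _ _ mdisk (fun=> Q i))//; last by rewrite ltNge K0.
by rewrite integral_indic// setIidl//; exact: QD.
Qed.

End Lower.

Section LowerEstimate.
Variable R : realType.

Notation mu := (@lebesgue_measure R).
Notation plane := (measurableTypeR R * measurableTypeR R)%type.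
Notation area := (mu \x mu)%E.
Notation disk := [set q : plane | unit_disk (q.1 +i* q.2)%C].

(** On the box of a zero [z], [|B'|^p w Phi] is at least [K z], and [K z] times
    the area of the box is a fixed multiple of the term of [z].  As [Phi] only
    has to be bounded below away from the origin, it may be a logarithm. *)
Lemma lower_estimate (w Phi : R -> R) (p delta : R) :
  normal_weight w -> bounded_on_compacts w -> 0 < p -> 0 < delta ->
  (forall r, 0 <= r < 1 -> 0 <= Phi r) ->
  (forall r0, 0 < r0 -> exists2 m, 0 < m & forall r, r0 <= r < 1 -> m <= Phi r) ->
  exists c : R, 0 < c /\ forall B : R[i] -> R[i],
    blaschke_product B -> separated_zeros B delta ->
    (zero_sum B (fun z => ((1 - cabs z) `^ (2 - p) * w (cabs z))%R) <=
     c%:E * area_int (fun z => (cabs (derive1 B z) `^ p * w (cabs z) * Phi (cabs z))%R))%E.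
Proof.
move=> wn wb p0 delta0 Phi0 Philow.
have w0 r : 0 <= r < 1 -> 0 <= w r by case: wn => _ h _ r01; apply: h; rewrite in_itv.
have [cw cw0 wcmp] := weight_comparable wn wb.
pose d := Num.min delta 1; pose k := d / 72.
have d0 : 0 < d by rewrite lt_min delta0 ltr01.
have d1 : d <= 1 by rewrite ge_min lexx orbT.
have dd : d <= delta by rewrite ge_min lexx.
have k0 : 0 < k by rewrite divr_gt0.
have k1 : k <= 1 / 72 by rewrite ler_wpM2r.
have [m m0 Phim] := Philow (k / 8) ltac:(by rewrite divr_gt0).
pose c0 := (d / 36) `^ p * cw * m * k ^+ 2 / 8.
have c00 : 0 < c0 by rewrite !mulr_gt0 ?powR_gt0 ?exprn_gt0// divr_gt0.
exists c0^-1; split; first by rewrite invr_gt0.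
move=> B [lambda [I [a [l1 aD fin BE]]]] [J [b [enum sep]]].
have [S mS] := mass_bounded aD fin.
have BE' z : cabs z < 1 -> lambda * fblaschke (first_zeros I a N) z @[N --> \oo] --> B z.
  by move=> /BE; under eq_fun do rewrite prod_first_zeros.
set F := fun z => (cabs (derive1 B z) `^ p * w (cabs z) * Phi (cabs z))%R.
pose g z := (1 - cabs z) `^ (2 - p) * w (cabs z).
apply: ge_ereal_sup => _ [Z [Zfin ZB] <-].
have [l ZE] : exists l : seq R[i], Z = [set` l] by apply/finite_seqP.
pose r := undup l; have {}ZE : Z = [set` r].
  by rewrite ZE; apply/seteqP; split=> z /=; rewrite mem_undup.
rewrite ZE -fsbig_seq ?undup_uniq//=.
have rZ z : z \in r -> cabs z < 1 by move=> zr; have /ZB[] : Z z by rewrite ZE.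
pose r' := [seq z <- r | (0 < zero_mult B z)%N].
have ur' : uniq r' by rewrite filter_uniq// undup_uniq.
have r'1 z : z \in r' -> cabs z < 1 /\ (0 < zero_mult B z)%N.
  by rewrite mem_filter => /andP[mz /rZ].
pose K z := if cabs z < 1 then (d / 36 / (1 - cabs z)) `^ p * (cw * w (cabs z)) * m else 0.
have K0 z : 0 <= K z.
  rewrite /K; case: ifPn => // z1.
  by rewrite !mulr_ge0 ?powR_ge0 ?(ltW cw0) ?(ltW m0)// w0// cabs_ge0.
have disjoint i j t : i \in r' -> j \in r' -> zero_box k i t -> zero_box k j t -> i = j.
  move=> /r'1[i1 mi] /r'1[j1 mj] ti tj; apply/eqP/negPn/negP => ij.
  have h := zero_box_disjoint k0 i1 j1 ti tj.
  have [Ni Hi] := zero_multE l1 aD mS BE' i1; have [Nj Hj] := zero_multE l1 aD mS BE' j1.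
  have iN : i \in first_zeros I a (maxn Ni Nj).
    by rewrite -has_pred1 has_count Hi// leq_maxl.
  have jN : j \in first_zeros I a (maxn Ni Nj).
    by rewrite -has_pred1 has_count Hj// leq_maxr.
  have := separated_pseudohyp l1 aD mS BE' enum sep iN jN; rewrite eq_sym => /(_ ij) h'.
  have : 2 * k < d by rewrite /k; lra.
  lra.
have boxD i : i \in r' -> zero_box k i `<=` disk.
  move=> /r'1[i1 _] t /(zero_box_radius k0 k1 i1) /andP[h _]; rewrite /= /unit_disk /=.
  by rewrite -subr_gt0; apply: lt_le_trans h; rewrite divr_gt0// subr_gt0.
have KF i t : i \in r' -> zero_box k i t -> K i <= F (t.1 +i* t.2)%C.
  move=> ir ti; have [i1 mi] := r'1 _ ir; rewrite /K i1 /F.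
  have t1 : cabs (t.1 +i* t.2)%C < 1 := boxD i ir t ti.
  have wi : 0 <= w (cabs i) by apply: w0; rewrite cabs_ge0.
  apply: ler_pM; rewrite ?(ltW m0) ?mulr_ge0 ?powR_ge0 ?(ltW cw0)//.
    apply: ler_pM; rewrite ?powR_ge0 ?mulr_ge0 ?(ltW cw0)//.
      apply: ge0_ler_powR; rewrite ?nnegrE ?cabs_ge0 ?(ltW p0)//.
        by rewrite !divr_ge0 ?(ltW d0)// subr_ge0 ltW.
      apply: (cabs_derive1_ge l1 aD mS BE' enum sep) => //.
      exact: zero_box_near.
    by apply: wcmp; rewrite ?cabs_ge0//; exact: (zero_box_radius k0 k1 i1 ti).
  by apply: Phim; rewrite (zero_box_off_origin k0 k1 i1 ti).
have low : (\sum_(z <- r') (K z)%:E * area (zero_box k z) <= area_int F)%E.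
  apply: (@integral_sum_indic_ge _ _ r' (zero_box k) K (fun t => F (t.1 +i* t.2)%C)) => //.
    by move=> i; exact: measurable_zero_box.
  by move=> t tD; rewrite !mulr_ge0 ?powR_ge0 ?w0 ?Phi0 ?cabs_ge0.
rewrite -(@lee_pmul2l _ c0%:E) ?lte_fin//.
rewrite muleA -EFinM divff ?gt_eqF// mul1e; apply: le_trans low.
rewrite sumEFin -EFinM.
have -> : (\sum_(z <- r') (K z)%:E * area (zero_box k z) = (\sum_(z <- r') c0 * g z)%:E)%E.
  rewrite -sumEFin; apply: eq_big_seq => z /r'1[z1 _].
  rewrite area_zero_box// -EFinM; congr (_%:E); rewrite /K z1 /c0 /g.
  have e0 : 0 < 1 - cabs z by rewrite subr_gt0.
  rewrite powRM ?invr_ge0 ?divr_ge0 ?(ltW d0) ?(ltW e0)//.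
  have -> : (1 - cabs z)^-1 `^ p = (1 - cabs z) `^ (- p).
    by rewrite -powR_inv1 ?(ltW e0)// -powRrM mulN1r.
  have -> : (1 - cabs z) `^ (2 - p) = (1 - cabs z) `^ (- p) * (1 - cabs z) ^+ 2.
    by rewrite [2 - p]addrC powRD ?(gt_eqF e0) ?implybT// (powR_mulrn 2 (ltW e0)).
  by ring.
rewrite lee_fin -mulr_sumr; apply: ler_wpM2l; first exact: ltW.
rewrite big_filter [leRHS]big_mkcond /= big_seq [leRHS]big_seq.
apply: ler_sum => z zr; have z1 := rZ z zr.
have := separated_zero_mult_le1 enum sep z1; rewrite /g.
by case: (zero_mult B z) => [|[|//]] _ /=; rewrite ?mul0r ?mul1r.
Qed.

End LowerEstimate.

Unset Implicit Arguments.

Theorem theorem2 (R : realType) (w : R -> R) (p : R)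
    (w_normal : normal_weight w) (w_bounded : bounded_on_compacts w)
    (p_gt : 2^-1 < p) :
  (* (i); the factor 1 + log (1/(1-|z|)) is log (e/(1-|z|)), which does not
     vanish at a zero of B at the origin *)
  ([/\ p <= 1, a_exp w < 2 * p - 2 & -1 < b_exp w] \/
   [/\ 1 < p, a_exp w < p - 1 & p - 2 < b_exp w] ->
   exists c : R, 0 < c /\
     forall B : R[i] -> R[i], blaschke_product B ->
       (wnorm_pow p w (derive1 B) <=
        c%:E * zero_sum B (fun z => (1 - cabs z) `^ (2 - p) * w (cabs z))%R)%E)
  /\
  (([/\ p <= 1, a_exp w = 2 * p - 2 & -1 < b_exp w] \/
    [/\ 1 < p, a_exp w = p - 1 & p - 2 < b_exp w]) /\
   log_condition w ->
   exists c : R, 0 < c /\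
     forall B : R[i] -> R[i], blaschke_product B ->
       (wnorm_pow p w (derive1 B) <=
        c%:E * zero_sum B (fun z => (1 - cabs z) `^ (2 - p) * w (cabs z) *
                                    (1 + ln ((1 - cabs z)^-1)))%R)%E)
  /\
  (* (ii) *)
  (forall delta : R, 0 < delta ->
   ([/\ p <= 1, a_exp w < 2 * p - 2 & -1 < b_exp w] \/
    [/\ 1 < p, a_exp w < p - 2 & -1 < b_exp w] ->
    exists c : R, 0 < c /\
      forall B : R[i] -> R[i], blaschke_product B -> separated_zeros B delta ->
        (zero_sum B (fun z => (1 - cabs z) `^ (2 - p) * w (cabs z))%R <=
         c%:E * wnorm_pow p w (derive1 B))%E)
   /\
   (([/\ p <= 1, a_exp w = 2 * p - 2 & -1 < b_exp w] \/
     [/\ 1 < p, a_exp w = p - 1 & p - 2 < b_exp w]) /\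
    log_condition w ->
    exists c : R, 0 < c /\
      forall B : R[i] -> R[i], blaschke_product B -> separated_zeros B delta ->
        (zero_sum B (fun z => (1 - cabs z) `^ (2 - p) * w (cabs z))%R <=
         c%:E * area_int (fun z => cabs (derive1 B z) `^ p * w (cabs z) *
                                   ln ((1 - cabs z)^-1))%R)%E)).
Proof.
have p0 : 0 < p by apply: lt_trans p_gt; rewrite invr_gt0.
have w0 : forall r, r \in `[0, 1[ -> 0 <= w r by case: w_normal.
(* for [p > 1] Schwarz-Pick reduces the estimate to the exponent 1 *)
pose q := Num.min p 1.
have q_gt : 2^-1 < q by rewrite lt_min p_gt invf_lt1 ?ltr1n.
have q_le : q <= 1 by rewrite ge_min lexx orbT.
have qp : q <= p by rewrite ge_min lexx.
have qp1 : p <= 1 -> q = p by move=> p1; exact/min_idPl.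
have qp2 : 1 < p -> q = 1 by move=> /ltW p1; exact/min_idPr.
have [a0 [b0 [r0 [r01 inc dec]]]] : exists a b r0 : R,
  [/\ r0 \in `]0, 1[, incr_to_infty w a r0 & decr_to_zero w b r0] by case: w_normal.
have upE (x : R) : a_exp w < x -> exists a, a < x /\ exists2 r, r \in `]0, 1[ & incr_to_infty w a r.
  by move=> /inf_lt[|a [r rI h] ax]; [exists a0, r0|exists a; split=> //; exists r].
have downE (x : R) : x < b_exp w -> exists b, x < b /\ exists2 r, r \in `]0, 1[ & decr_to_zero w b r.
  by move=> /sup_gt[|b [r rI h] bx]; [exists b0, r0|exists b; split=> //; exists r].
split; [|split].
- move=> H; have [Ha Hb] : a_exp w < 2 * q - 2 - (q - p) /\ -1 - (q - p) < b_exp w.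
    by case: H => -[p1 ha hb]; rewrite ?(qp1 p1) ?(qp2 p1); split; lra.
  have [a [ax [ra ra01 ia]]] := upE _ Ha; have [b [bx [rb rb01 db]]] := downE _ Hb.
  by apply: (upper_subcritical w_bounded w0 q_gt q_le qp ra01 rb01 ia db); lra.
- move=> [H lc]; have [Ha Hb] : a_exp w = 2 * q - 2 - (q - p) /\ -1 - (q - p) < b_exp w.
    by case: H => -[p1 ha hb]; rewrite ?(qp1 p1) ?(qp2 p1); split; lra.
  have [b [bx [rb rb01 db]]] := downE _ Hb.
  by apply: (upper_critical w_bounded w0 q_gt q_le qp rb01 db lc); [rewrite Ha; ring|lra].
move=> delta delta0; split=> _.
- have one (s : R) : 0 < s -> exists2 m : R, 0 < m & forall r : R, s <= r < 1 -> m <= 1.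
    by move=> _; exists 1.
  have [c [c0 Hc]] := @lower_estimate R w (fun=> 1) p delta w_normal w_bounded p0 delta0
    (fun _ _ => ler01) one.
  exists c; split=> // B BB sB; apply: le_trans (Hc B BB sB) _.
  rewrite (_ : (fun z : R[i] => _ * 1) = fun z => cabs (derive1 B z) `^ p * w (cabs z))//.
  by apply/funext => z; rewrite mulr1.
apply: (@lower_estimate R w (fun r => ln ((1 - r)^-1))) => //; first by move=> r; exact: L_ge0.
move=> s s0; exists s => // r /andP[sr r1]; apply: le_trans sr _.
rewrite lnV ?posrE ?subr_gt0// lerNr.
by apply: (@le_ln1Dx R (- r)); rewrite ltrN2.
Qed.
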